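(* Let $\mathcal H$ be a separable complex Hilbert space and $A\in B(\mathcal H)$. If $C,C'\in B(\mathcal H)$ are selfadjoint trace-class operators and $\lambda(C')\prec\lambda(C)$, then $W_{\mathcal O(C')}(A)\subseteq W_{\mathcal O(C)}(A)$.
   Context: For trace-class $C$, $\mathcal U(C)=\{UCU^*:U\text{ unitary}\}$, $\mathcal O(C)$ is the trace-norm closure of $\mathcal U(C)$, and $W_{\mathcal O(C)}(A)=\{\operatorname{Tr}(XA):X\in\mathcal O(C)\}$. For a compact operator $C$, $\lambda(C)$ is its eigenvalue sequence (eigenvalues in order of decreasing modulus, repeated according to algebraic multiplicity, concatenated with zeros if there are only finitely many nonzero eigenvalues; zero eigenvalues are omitted if there are infinitely many nonzero ones). For a real sequence $\mu$ converging to zero, $\mu^+$ is the nonincreasing rearrangement of $(\max\{\mu_n,0\})_n$ (its $k$-th term is the $k$-th largest entry, counted with multiplicity), and $\mu^-:=(-\mu)^+$. For real sequences $d,\mu\in\ell^1$, $d$ is majorized by $\mu$, written $d\prec\mu$, if for all $n\in\mathbb N$ one has $\sum_{k=1}^n d^+_k\le\sum_{k=1}^n\mu^+_k$ and $\sum_{k=1}^n d^-_k\le\sum_{k=1}^n\mu^-_k$, and moreover $\sum_{k=1}^\infty d_k=\sum_{k=1}^\infty\mu_k$. *)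

(* Defs.v *)
From HB Require Import structures.
From mathcomp Require Import all_boot all_order all_algebra.
From mathcomp Require Import complex.
From mathcomp Require Import all_classical all_reals all_analysis.
Import Order.TTheory GRing.Theory Num.Theory.
Import numFieldNormedType.Exports.

Set Implicit Arguments.
Unset Strict Implicit.
Unset Printing Implicit Defensive.

Local Open Scope classical_set_scope.
Local Open Scope card_scope.
Local Open Scope ring_scope.
Local Open Scope complex_scope.

(* A complex Hilbert space is a complete normed space [H] over [R[i]] together
   with a positive definite hermitian form [dot] (linear in its first argument)
   that induces the norm of [H].  Operators are plain functions [H -> H], those
   in B(H) being singled out by [bounded_op]. *)
Definition induces_norm (R : realType) (H : completeNormedModType R[i])
    (dot : {dot H for @conjc R}) : Prop :=
  forall x : H, `|x| ^+ 2 = dot x x.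

Definition separable_space (T : topologicalType) : Prop :=
  exists2 D : set T, countable D & dense D.

Section Operators.
Context (R : realType) (H : completeNormedModType R[i]).
Context (dot : {dot H for @conjc R}).
Implicit Types (T S P U V A C X Y : H -> H).

Definition bounded_op T : Prop := linear T /\ continuous T.

Definition is_adjoint T S : Prop := forall x y, dot (T x) y = dot x (S y).

Definition selfadjoint T : Prop := bounded_op T /\ is_adjoint T T.

(* [U] is unitary and [V] is its adjoint. *)
Definition unitary_with_adjoint U V : Prop :=
  [/\ bounded_op U, is_adjoint U V, U \o V = id & V \o U = id].

(* In [R[i]], [0 <= z] means that [z] is real and nonnegative. *)
Definition positive_op P : Prop :=
  bounded_op P /\ forall x, 0 <= dot (P x) x.

(* [P] is the absolute value of [T], i.e. the positive square root of T^* T. *)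
Definition is_absop T P : Prop :=
  positive_op P /\ exists2 S, is_adjoint T S & P \o P = S \o T.

(* The default value 0 is never used when [T] is bounded: [T] then has exactly
   one absolute value. *)
Definition absop T : H -> H := xget (fun=> 0) [set P | is_absop T P].

(* An orthonormal basis enumerated by [nat], where zero vectors may be inserted
   so that finite-dimensional spaces are covered too; they do not contribute to
   any of the sums below. *)
Definition orthonormal_basis (e : nat -> H) : Prop :=
  [/\ forall n, e n = 0 \/ dot (e n) (e n) = 1,
      forall m n, m <> n -> dot (e m) (e n) = 0 &
      forall x, (forall n, dot x (e n) = 0) -> x = 0].

(* Traces are computed in one chosen orthonormal basis, which exists when [H] is
   separable; the trace of a positive or of a trace-class operator does not
   depend on the choice. *)
Definition onb : nat -> H := xget (fun=> 0) [set e | orthonormal_basis e].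

Definition trace_norm T : \bar R :=
  (\sum_(0 <= n <oo) (complex.Re (dot (absop T (onb n)) (onb n)))%:E)%E.

Definition trace_class T : Prop := bounded_op T /\ (trace_norm T < +oo)%E.

Definition trace T : R[i] :=
  limn (series (fun n => dot (T (onb n)) (onb n) : R[i]^o)).

Definition unitary_orbit C : set (H -> H) :=
  [set X | exists U V, unitary_with_adjoint U V /\ X = U \o C \o V].

Definition orbit_closure C : set (H -> H) :=
  [set X | trace_class X /\
    forall eps : R, 0 < eps ->
      exists2 Y, unitary_orbit C Y & (trace_norm (X \- Y)%R < eps%:E)%E].

Definition orbit_closed_range C A : set R[i] :=
  [set trace (X \o A) | X in orbit_closure C].

Definition generalized_eigenspace C (a : R[i]) : set H :=
  [set x | exists k, iter k (fun y => C y - a *: y) x = 0].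

Definition has_dim (V : set H) (n : nat) : Prop :=
  exists b : 'I_n -> H,
    (forall c : 'rV[R[i]]_n, \sum_i c 0 i *: b i = 0 -> c = 0) /\
    V = [set \sum_i c 0 i *: b i | c in [set: 'rV[R[i]]_n]].

(* [l] lists the eigenvalues of the compact operator [C] by decreasing modulus,
   each nonzero one as often as its algebraic multiplicity.  As the modulus is
   nonincreasing, a zero term is followed by zeros only: zeros occur exactly
   when there are finitely many nonzero eigenvalues.  The sequence is unique up
   to the order of eigenvalues of equal modulus. *)
Definition eigenvalue_sequence C (l : nat -> R[i]) : Prop :=
  (forall m n, (m <= n)%N -> `|l n| <= `|l m|) /\
  (forall a : R[i], a != 0 -> exists2 n : nat,
     has_dim (generalized_eigenspace C a) n & [set k | l k = a] #= `I_n).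

End Operators.

Section Majorization.
Context (R : realType).
Implicit Types d mu : nat -> R.

(* The (k+1)-st largest entry of max(mu, 0), with multiplicity: the largest [t]
   such that at least k+1 indices carry an entry >= t. *)
Definition pos_rearrangement mu (k : nat) : R :=
  sup [set t | exists s : seq nat,
    [/\ uniq s, size s = k.+1 & forall n, n \in s -> t <= Num.max (mu n) 0]].

Definition neg_rearrangement mu : nat -> R :=
  pos_rearrangement (fun n => - mu n).

(* Meant for summable [d] and [mu]. *)
Definition majorized d mu : Prop :=
  [/\ forall n, \sum_(k < n) pos_rearrangement d k <=
                \sum_(k < n) pos_rearrangement mu k,
      forall n, \sum_(k < n) neg_rearrangement d k <=
                \sum_(k < n) neg_rearrangement mu k &
      limn (series d) = limn (series mu)].

End Majorization.

(* Main.v *)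
From HB Require Import structures.
Require Import Defs.
From mathcomp Require Import all_boot all_order all_algebra.
From mathcomp Require Import complex.
From mathcomp Require Import all_classical all_reals all_analysis.
From mathcomp Require Import ring lra.
Import Order.TTheory GRing.Theory Num.Theory.
Import numFieldNormedType.Exports.

Set Implicit Arguments.
Unset Strict Implicit.
Unset Printing Implicit Defensive.

Local Open Scope classical_set_scope.
Local Open Scope card_scope.
Local Open Scope ring_scope.
Local Open Scope complex_scope.

Local Notation "x ^*" := (conjc x) : ring_scope.

(** Every operator in the orbit closure of [C'] is a norm limit of selfadjoint
    operators, hence selfadjoint and compact, with an orthonormal eigenbasis
    [e] and summable eigenvalues [mu].  Ky Fan's inequalities and the continuity
    of the trace show that [mu] is majorized by [lambda'], hence by [lambda]
    ([closure_eigenvalues]).  For a bounded [A] the trace of the product of this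
    operator with [A] is the sum of the [mu n * <A (e n), e n>]
    ([diag_trace_comp]).  Conversely, if [f] is an orthonormal system with unit
    vectors where [lambda k != 0], the operator with eigenvalues [lambda] and
    eigenvectors [f] lies in the orbit closure of [C], because a unitary operator
    matches any finite number of eigenvectors ([same_eigenvalues_closure]).
    Hence the theorem says that the sum of the [lambda k * <A (f k), f k>] can be
    made equal to the sum of the [mu n * <A (e n), e n>] by the choice of [f].
    This is [majorized_system], the heart of the proof.

    The system [f] is obtained from [e] by moving weight between vectors while
    the weighted sum of the quadratic form of [A] stays fixed.  By the
    Toeplitz-Hausdorff argument in the plane of two orthonormal vectors [g], [h],
    a rotation makes the value of the form at the first new vector any prescribed
    convex combination of the values at [g] and [h]; the trace of the compression
    to the plane being invariant, the second new vector takes the complementary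
    combination ([plane_rotation]).  So weight can be passed from [h] to [g]
    without changing the sum, provided that the larger weight grows.
    Infinitely many rotations can collect weight from infinitely many vectors on
    one vector: the angles are controlled by the moved weights, which are
    summable, so the accumulated vectors converge ([concentrate]).

    Targets are reached one at a time, each reached target being split off with
    its vector ([peel]).  The positive and the negative parts of [mu] are first
    raised to weights below those parts of [lambda] ([below_fill]): the largest
    weight is raised to the current target by cutting the others down to a common
    level, which preserves weak majorization, expressed by the sums of
    [max (x n - t) 0] over [n].  If the positive parts have different sums, both
    parts have the same defect, and finitely many vectors carry all the weight;
    there is then room for unit vectors in all other slots.  The defects are
    levelled by moving weight between slots of opposite sign
    ([dominated_fill]).

    The remaining parts build what these arguments use: the spectral theorem for
    compact selfadjoint operators, absolute values, the trace norm of
    diagonal operators, and the identification of the eigenvalue sequence, which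
    counts generalized eigenspaces, with the weights of a diagonal form of [C]. *)

(** * Absolutely summable real sequences *)

Section AbsSum.
Context {R : realType}.
Implicit Types u v w : nat -> R.

Definition asum u : Prop := exists M, forall N, \sum_(i < N) `|u i| <= M.

Definition rsum u : R := limn (series u).

Lemma asumP u : cvgn (series (fun n => `|u n|)) <-> asum u.
Proof.
split=> [/cvg_seq_bounded/bounded_fun_has_ubound[M v_M]|[M hM]].
  by exists M => N; apply: v_M; exists N => //=; rewrite seriesEord.
apply: nondecreasing_is_cvgn; first exact: nondecreasing_series.
by exists M => _ [N _ <-]; rewrite seriesEord; exact: hM.
Qed.

Lemma asum_le u v : asum v -> (forall n, `|u n| <= `|v n|) -> asum u.
Proof.
move=> [M hM] uv; exists M => N.
by apply: le_trans (hM N); apply: ler_sum.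
Qed.

Lemma rsum_cvg u : asum u -> series u @ \oo --> rsum u.
Proof. by move=> /asumP su; exact: normed_cvg. Qed.

Lemma rsum_cvgE u : asum u -> (fun N => \sum_(i < N) u i) @ \oo --> rsum u.
Proof. by move=> /rsum_cvg; rewrite seriesEord. Qed.

Lemma rsum_unique u l : (fun N => \sum_(i < N) u i) @ \oo --> l -> rsum u = l.
Proof. by move=> ul; apply: cvg_lim => //; rewrite seriesEord. Qed.

Lemma rsum_ext u v : (forall n, u n = v n) -> rsum u = rsum v.
Proof. by move=> uv; congr rsum; apply/funext. Qed.

Lemma asum_norm u : asum u -> asum (fun n => `|u n|).
Proof. by move=> su; apply: asum_le su _ => n; rewrite normr_id. Qed.

Lemma asumN u : asum u -> asum (fun n => - u n).
Proof. by move=> su; apply: asum_le su _ => n; rewrite normrN. Qed.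

Lemma asumD u v : asum u -> asum v -> asum (fun n => u n + v n).
Proof.
move=> [M hM] [M' hM']; exists (M + M') => N.
apply: le_trans (lerD (hM N) (hM' N)); rewrite -big_split /=.
by apply: ler_sum => i _; apply: ler_normD.
Qed.

Lemma asumB u v : asum u -> asum v -> asum (fun n => u n - v n).
Proof. by move=> su sv; apply: asumD => //; exact: asumN. Qed.

Lemma asumM u v M : asum u -> (forall n, `|v n| <= M) ->
  asum (fun n => u n * v n).
Proof.
move=> [B hB] hM.
have M0 : 0 <= M by apply: le_trans (hM 0%N).
exists (B * M) => N.
apply: le_trans (ler_wpM2r M0 (hB N)); rewrite mulr_suml.
by apply: ler_sum => i _; rewrite normrM; apply: ler_wpM2l.
Qed.

Lemma asumZ c u : asum u -> asum (fun n => c * u n).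
Proof.
move=> su; have := @asumM u (fun=> c) `|c| su (fun=> lexx _).
by congr asum; apply/funext => n; rewrite mulrC.
Qed.

Lemma asum_if (P : pred nat) u : asum u -> asum (fun n => if P n then u n else 0).
Proof. by move=> su; apply: asum_le su _ => n; case: ifP; rewrite ?normr0. Qed.

Lemma asum_ifn (P : pred nat) u : asum u -> asum (fun n => if P n then 0 else u n).
Proof. by move=> su; apply: asum_le su _ => n; case: ifP; rewrite ?normr0. Qed.

Lemma rsumD u v : asum u -> asum v -> rsum (fun n => u n + v n) = rsum u + rsum v.
Proof.
move=> su sv; apply: rsum_unique.
under eq_fun do rewrite big_split.
by apply: cvgD; exact: rsum_cvgE.
Qed.

Lemma rsumN u : asum u -> rsum (fun n => - u n) = - rsum u.
Proof.
move=> su; apply: rsum_unique.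
under eq_fun do rewrite sumrN.
by apply: cvgN; exact: rsum_cvgE.
Qed.

Lemma rsumB u v : asum u -> asum v -> rsum (fun n => u n - v n) = rsum u - rsum v.
Proof. by move=> su sv; rewrite rsumD ?rsumN//; exact: asumN. Qed.

Lemma rsumZ c u : asum u -> rsum (fun n => c * u n) = c * rsum u.
Proof.
move=> su; apply: rsum_unique.
under eq_fun do rewrite -mulr_sumr.
by apply: cvgMr; exact: rsum_cvgE.
Qed.

Lemma asum_fin u N : (forall n, (N <= n)%N -> u n = 0) -> asum u.
Proof.
move=> u0; exists (\sum_(i < N) `|u i|) => K.
rewrite -!(big_mkord xpredT (fun i => `|u i|)).
have [KN|/ltnW NK] := leqP K N.
  by rewrite (big_cat_nat (n := K) _ KN)//= lerDl sumr_ge0.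
rewrite (big_cat_nat (n := N) _ NK)//= [X in _ + X]big_nat.
by rewrite [X in _ + X]big1 ?addr0// => i /andP[Ni _]; rewrite u0 ?normr0.
Qed.

Lemma rsum_fin u N : (forall n, (N <= n)%N -> u n = 0) ->
  rsum u = \sum_(i < N) u i.
Proof.
move=> u0; apply: rsum_unique; apply/cvgrPdist_lt => e e0; exists N => // K /= NK.
rewrite -!(big_mkord xpredT u) (big_cat_nat (n := N) _ NK)//=.
rewrite [X in _ - (_ + X)]big_nat [X in _ - (_ + X)]big1 ?addr0 ?subrr ?normr0//.
by move=> i /andP[Ni _]; rewrite u0.
Qed.

Lemma rsum0 : rsum (fun=> 0) = 0.
Proof. by rewrite (@rsum_fin _ 0%N)// big_ord0. Qed.

Lemma rsum_ub u M : asum u -> (forall N, \sum_(i < N) u i <= M) -> rsum u <= M.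
Proof.
move=> su hM; rewrite -(cvg_lim (@Rhausdorff R) (rsum_cvgE su)).
by apply: limr_le; [exact: cvgP (rsum_cvgE su)|exact: nearW].
Qed.

Lemma rsum_part u N : asum u -> (forall n, 0 <= u n) ->
  \sum_(i < N) u i <= rsum u.
Proof.
move=> su u0; rewrite -(cvg_lim (@Rhausdorff R) (rsum_cvgE su)).
apply: limr_ge; first exact: cvgP (rsum_cvgE su).
exists N => // K /= NK.
by rewrite -!(big_mkord xpredT u) (big_cat_nat (n := N) _ NK)//= lerDl sumr_ge0.
Qed.

Lemma rsum_le u v : asum u -> asum v -> (forall n, u n <= v n) ->
  rsum u <= rsum v.
Proof.
move=> su sv uv; apply: (ler_cvg_to (rsum_cvgE su) (rsum_cvgE sv)).
by apply: nearW => n; apply: ler_sum.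
Qed.

Lemma rsum_ge0 u : asum u -> (forall n, 0 <= u n) -> 0 <= rsum u.
Proof. by move=> su /(rsum_part 0 su); rewrite big_ord0. Qed.

Lemma rsum_norm u : asum u -> `|rsum u| <= rsum (fun n => `|u n|).
Proof. by move=> /asumP su; exact: lim_series_norm. Qed.

Lemma rsum_sum K (a : nat -> nat -> R) : (forall i, asum (a i)) ->
  rsum (fun n => \sum_(i < K) a i n) = \sum_(i < K) rsum (a i) /\
  asum (fun n => \sum_(i < K) a i n).
Proof.
move=> sa; elim: K => [|K [IH sIH]].
  rewrite big_ord0; split.
    by under rsum_ext do rewrite big_ord0; exact: rsum0.
  by apply: (@asum_fin _ 0%N) => n _; rewrite big_ord0.
split; last first.
  have := asumD sIH (sa K); congr asum; apply/funext => n.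
  by rewrite big_ord_recr.
rewrite big_ord_recr /= -IH -rsumD//.
by apply: rsum_ext => n; rewrite big_ord_recr.
Qed.

Lemma rsum_split u N : asum u ->
  rsum u = \sum_(i < N) u i + rsum (fun n => if (n < N)%N then 0 else u n).
Proof.
move=> su; pose w n := if (n < N)%N then u n else 0.
have wN n : (N <= n)%N -> w n = 0 by rewrite /w ltnNge => ->.
have <- : rsum w = \sum_(i < N) u i.
  rewrite (rsum_fin wN); apply: eq_bigr => i _; rewrite /w ltn_ord//.
rewrite -rsumD//; [|exact: asum_fin wN|exact: asum_ifn].
by apply: rsum_ext => n; rewrite /w; case: ifP; rewrite ?addr0 ?add0r.
Qed.

Lemma rsum_D1 u k : asum u -> rsum u = u k + rsum (fun n => if n == k then 0 else u n).
Proof.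
move=> su; pose w n := if n == k then u n else 0.
have wN n : (k.+1 <= n)%N -> w n = 0.
  by rewrite /w; case: eqP => // ->; rewrite ltnn.
have <- : rsum w = u k.
  rewrite (rsum_fin wN) big_ord_recr /= big1 ?add0r /w ?eqxx// => i _.
  by rewrite ltn_eqF.
rewrite -rsumD//; [|exact: asum_fin wN|exact: asum_ifn].
by apply: rsum_ext => n; rewrite /w; case: ifP; rewrite ?addr0 ?add0r.
Qed.

Lemma rsum_tail u : asum u ->
  (fun N => rsum (fun n => if (n < N)%N then 0 else `|u n|)) @ \oo --> 0.
Proof.
move=> /asum_norm su.
rewrite (_ : (fun N => _) = fun N => rsum (fun n => `|u n|) - \sum_(i < N) `|u i|).
  have := cvgB (cvg_cst (rsum (fun n => `|u n|))) (rsum_cvgE su).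
  rewrite subrr => h; exact: h.
by apply/funext => N; rewrite (rsum_split N su) addrC addKr.
Qed.

Lemma rsum_tail_lt u (eps : R) : asum u -> 0 < eps ->
  exists N, rsum (fun n => if (n < N)%N then 0 else `|u n|) < eps.
Proof.
move=> /rsum_tail/cvgrPdist_lt h e0; have [N _ /(_ N (leqnn _))/=] := h _ e0.
rewrite sub0r normrN => hN; exists N; apply: le_lt_trans hN.
exact: ler_norm.
Qed.

Lemma sum_le_tail u N m n : asum u -> (forall k, 0 <= u k) -> (N <= m <= n)%N ->
  \sum_(m <= k < n) u k <= rsum (fun k => if (k < N)%N then 0 else `|u k|).
Proof.
move=> su u0 /andP[Nm mn]; set w := fun k => if _ then 0 else _.
have sw : asum w by apply/asum_ifn/asum_norm.
have w0 k : 0 <= w k by rewrite /w; case: ifP.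
apply: le_trans (rsum_part n sw w0).
rewrite -(big_mkord xpredT w) (big_cat_nat (leq0n m) mn)//=.
rewrite ler_wpDl ?sumr_ge0// [leLHS]big_nat [leRHS]big_nat.
apply: ler_sum => i /andP[mi _]; rewrite /w ltnNge (leq_trans Nm mi)/=.
exact: ler_norm.
Qed.

Lemma asum_cvg0 u : asum u -> u @ \oo --> 0.
Proof. by move=> su; apply: cvg_series_cvg_0; exact: rsum_cvg. Qed.

Lemma rsum_term u k : asum u -> (forall n, 0 <= u n) -> u k <= rsum u.
Proof.
move=> su u0; rewrite (rsum_D1 k su) lerDl rsum_ge0//; first exact: asum_ifn.
by move=> n; case: ifP.
Qed.

Lemma rsum_eq_le u v : asum u -> asum v -> (forall n, u n <= v n) ->
  rsum u = rsum v -> forall n, u n = v n.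
Proof.
move=> su sv uv e n; apply/eqP; rewrite eq_le uv -subr_le0 /=.
have sd := asumB sv su.
have := @rsum_term _ n sd (fun n => _).
by rewrite rsumB// e subrr; apply => k; rewrite subr_ge0.
Qed.

Lemma cvg_sum_ord N (v : nat -> nat -> R) (s : nat -> R) : (forall n, v n @ \oo --> s n) ->
  (fun K => \sum_(i < N) v i K) @ \oo --> \sum_(i < N) s i.
Proof.
move=> vs; elim: N => [|N IH].
  under eq_fun do rewrite big_ord0.
  by rewrite big_ord0; exact: cvg_cst.
under eq_fun do rewrite big_ord_recr /=.
by rewrite big_ord_recr; apply: cvgD.
Qed.

(** Tannery's theorem, the dominated convergence theorem for series: a common
    tail of the dominating series is split off. *)
Lemma tannery (v : nat -> nat -> R) (b s : nat -> R) : asum b ->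
  (forall n K, `|v n K| <= b n) -> (forall n, v n @ \oo --> s n) ->
  asum s /\ (fun K => rsum (fun n => v n K)) @ \oo --> rsum s.
Proof.
move=> sb vb vs.
have b0 n : 0 <= b n by apply: le_trans (vb n 0%N).
have bn n : `|b n| = b n by rewrite ger0_norm.
have sb' n : `|s n| <= b n.
  by apply: (ler_cvg_to (cvg_norm (vs n)) (cvg_cst (b n))); exact: nearW.
have ss : asum s by apply: asum_le sb _ => n; rewrite bn.
split=> //; apply/cvgrPdist_lt => e e0.
have e3 : 0 < e / 3%:R by rewrite divr_gt0.
have [N hN] := rsum_tail_lt sb e3.
have hf : (fun K => \sum_(i < N) v i K) @ \oo --> \sum_(i < N) s i.
  exact: cvg_sum_ord.
have [K0 _ hK] := (cvgrPdist_lt _ _).1 hf _ e3.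
exists K0 => // K /= /hK {hK}/= hK.
have svK : asum (fun n => v n K) by apply: asum_le sb _ => n; rewrite bn.
rewrite (rsum_split N ss) (rsum_split N svK) opprD addrACA.
apply: le_lt_trans (ler_normD _ _) _.
have tl w : asum w -> (forall n, `|w n| <= b n) ->
    `|rsum (fun n => if (n < N)%N then 0 else w n)| < e / 3%:R.
  move=> sw wb; apply: le_lt_trans hN.
  have sw' := asum_ifn (fun n : nat => (n < N)%N) sw.
  apply: le_trans (rsum_norm sw') _.
  apply: rsum_le => [||n].
  - exact/asum_norm/asum_ifn.
  - exact/asum_ifn/asum_norm.
  - by case: ifP; rewrite ?normr0// bn.
have := tl _ ss sb'; have := tl _ svK (fun n => vb n K).
set x := rsum _; set y := rsum _ => hx hy.
have := ler_normB y x; lra.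
Qed.

End AbsSum.

(** * The inner product and its norm *)

Section ComplexModulus.
Context {R : realType}.
Implicit Types z w : R[i].

(** The norm of [R[i]] takes its values in [R[i]]; [cabs] is the same modulus
    with values in [R], where the order is total. *)
Definition cabs z : R := complex.Re `|z|.

Lemma cabsE z : `|z| = (cabs z)%:C.
Proof. by rewrite /cabs normc_def. Qed.

Lemma cabs_sqr z : cabs z ^+ 2 = complex.Re z ^+ 2 + complex.Im z ^+ 2.
Proof. by rewrite /cabs normc_def /= sqr_sqrtr// addr_ge0// sqr_ge0. Qed.

Lemma cabs_ge0 z : 0 <= cabs z.
Proof. by rewrite -lecR -cabsE normr_ge0. Qed.

Lemma cabsM z w : cabs (z * w) = cabs z * cabs w.
Proof. by apply: complexI; rewrite -cabsE normrM !cabsE rmorphM. Qed.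

Lemma cabsD z w : cabs (z + w) <= cabs z + cabs w.
Proof. by rewrite -lecR rmorphD /= -!cabsE ler_normD. Qed.

Lemma cabsN z : cabs (- z) = cabs z.
Proof. by rewrite /cabs normrN. Qed.

Lemma cabs0 : cabs 0 = 0. Proof. by rewrite /cabs normr0. Qed.

Lemma cabs1 : cabs 1 = 1. Proof. by rewrite /cabs normr1. Qed.

Lemma cabs_eq0 z : cabs z = 0 -> z = 0.
Proof. by move=> h; apply/eqP; rewrite -normr_eq0 cabsE h. Qed.

Lemma cabsJ z : cabs z^* = cabs z.
Proof. by rewrite /cabs normcJ. Qed.

Lemma cabsR (x : R) : cabs x%:C = `|x|.
Proof. by rewrite /cabs normc_def /= expr0n addr0 sqrtr_sqr. Qed.

Lemma mulJc z : z * z^* = (cabs z ^+ 2)%:C.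
Proof. by rewrite -sqr_normc cabsE rmorphXn. Qed.

Lemma Re_le_cabs z : `|complex.Re z| <= cabs z.
Proof. by rewrite -lecR -cabsE normc_ge_Re. Qed.

Lemma Im_le_cabs z : `|complex.Im z| <= cabs z.
Proof.
rewrite -ler_sqr ?nnegrE ?cabs_ge0// cabs_sqr real_normK ?num_real//.
by rewrite lerDr sqr_ge0.
Qed.

Lemma cabs_le_ReIm z : cabs z <= `|complex.Re z| + `|complex.Im z|.
Proof.
rewrite -ler_sqr ?nnegrE ?cabs_ge0 ?addr_ge0// cabs_sqr sqrrD !real_normK ?num_real//.
by rewrite -addrA lerD2l lerDr mulrn_wge0 ?mulr_ge0.
Qed.

Lemma conjR (x : R) : (x%:C)^* = x%:C :> R[i].
Proof. by apply/eqP; rewrite eq_complex /= oppr0 !eqxx. Qed.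

Lemma ReD z w : complex.Re (z + w) = complex.Re z + complex.Re w.
Proof. by case: z; case: w. Qed.

Lemma ImD z w : complex.Im (z + w) = complex.Im z + complex.Im w.
Proof. by case: z; case: w. Qed.

Lemma ReN z : complex.Re (- z) = - complex.Re z. Proof. by case: z. Qed.

Lemma ImN z : complex.Im (- z) = - complex.Im z. Proof. by case: z. Qed.

Lemma ReZ (x : R) z : complex.Re (x%:C * z) = x * complex.Re z.
Proof. by case: z => a b /=; rewrite mul0r subr0. Qed.

Lemma ImZ (x : R) z : complex.Im (x%:C * z) = x * complex.Im z.
Proof. by case: z => a b /=; rewrite mul0r addr0. Qed.

Lemma Re_sum I (r : seq I) (P : pred I) (F : I -> R[i]) :
  complex.Re (\sum_(i <- r | P i) F i) = \sum_(i <- r | P i) complex.Re (F i).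
Proof. by apply: (big_morph _ ReD). Qed.

Lemma Im_sum I (r : seq I) (P : pred I) (F : I -> R[i]) :
  complex.Im (\sum_(i <- r | P i) F i) = \sum_(i <- r | P i) complex.Im (F i).
Proof. by apply: (big_morph _ ImD). Qed.

Lemma cabs_sum I (r : seq I) (P : pred I) (F : I -> R[i]) :
  cabs (\sum_(i <- r | P i) F i) <= \sum_(i <- r | P i) cabs (F i).
Proof.
apply: (big_ind2 (fun z x => cabs z <= x)); rewrite ?cabs0// => z x w y zx wy.
by apply: le_trans (cabsD _ _) (lerD _ _).
Qed.

Lemma cvg0_le (u v : nat -> R) : (forall n, 0 <= u n <= v n) ->
  v @ \oo --> 0 -> u @ \oo --> 0.
Proof.
by move=> uv v0; apply: (squeeze_cvgr _ (cvg_cst 0) v0); apply: nearW.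
Qed.

Lemma cvgD0 (u v : nat -> R) : u @ \oo --> 0 -> v @ \oo --> 0 ->
  (fun n => u n + v n) @ \oo --> 0.
Proof. by move=> u0 v0; rewrite -[X in _ --> X](addr0 0); apply: cvgD. Qed.

Lemma cvgM0 (u : nat -> R) c : u @ \oo --> 0 -> (fun n => c * u n) @ \oo --> 0.
Proof. by move=> u0; rewrite -[X in _ --> X](mulr0 c); apply: cvgMr. Qed.

Definition ccvg (u : nat -> R[i]) l : Prop :=
  (fun n => cabs (u n - l)) @ \oo --> (0 : R).

Lemma cvgP0 (u : nat -> R) l : (u @ \oo --> l) <-> ((fun n => `|u n - l|) @ \oo --> (0 : R)).
Proof.
split=> [ul|/cvgrPdist_lt h].
  by rewrite -(@normr0 R R) -(subrr l); apply: cvg_norm; apply: cvgB => //; exact: cvg_cst.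
apply/cvgrPdist_lt => e /h; apply: filterS => n /=.
by rewrite sub0r normrN normr_id distrC.
Qed.

Lemma ccvgP (u : nat -> R[i]) l : ccvg u l <->
  (fun n => complex.Re (u n)) @ \oo --> complex.Re l /\
  (fun n => complex.Im (u n)) @ \oo --> complex.Im l.
Proof.
split=> [ul|[/cvgP0 h1 /cvgP0 h2]].
  split; apply/cvgP0; apply: cvg0_le ul => n; rewrite normr_ge0 /=.
    by rewrite -ReN -ReD Re_le_cabs.
  by rewrite -ImN -ImD Im_le_cabs.
have := cvgD0 h1 h2; move=> h; apply: cvg0_le h => n; rewrite cabs_ge0 /=.
by rewrite (le_trans (cabs_le_ReIm _))// !ReD !ImD ReN ImN.
Qed.

Lemma rcvg_unique (u : nat -> R) (l l' : R) : u @ \oo --> l -> u @ \oo --> l' -> l = l'.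
Proof. by move=> h h'; exact: (@cvg_unique _ (@Rhausdorff R) _ _ _ _ h h'). Qed.

Lemma ccvg_unique (u : nat -> R[i]) l l' : ccvg u l -> ccvg u l' -> l = l'.
Proof.
move=> /ccvgP[h1 h2] /ccvgP[h1' h2'].
by apply/eqP; rewrite eq_complex (rcvg_unique h1 h1') (rcvg_unique h2 h2') !eqxx.
Qed.

Lemma ccvgJ (u : nat -> R[i]) l : ccvg u l -> ccvg (fun n => (u n)^*) l^*.
Proof.
move=> ul; rewrite /ccvg; under eq_fun do rewrite -rmorphB cabsJ.
exact: ul.
Qed.

End ComplexModulus.

Section InnerProduct.
Context {R : realType} {H : completeNormedModType R[i]}.
Context {dot : {dot H for @conjc R}} (dot_norm : induces_norm dot).
Implicit Types x y z : H.

Lemma dotDl x y z : dot (x + y) z = dot x z + dot y z.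
Proof. by rewrite linearDl. Qed.

Lemma dotDr x y z : dot z (x + y) = dot z x + dot z y.
Proof. by rewrite linearDr. Qed.

Lemma dotZl a x z : dot (a *: x) z = a * dot x z.
Proof. by rewrite linearZl. Qed.

Lemma dotZr a x z : dot z (a *: x) = a^* * dot z x.
Proof. by rewrite linearZr. Qed.

Lemma dotRr (a : R) x z : dot z (a%:C *: x) = a%:C * dot z x.
Proof. by rewrite dotZr; congr (_ * _); apply/eqP; rewrite eq_complex /= oppr0 !eqxx. Qed.

Lemma dotNl x y : dot (- x) y = - dot x y.
Proof. by rewrite linearNl. Qed.

Lemma dotNr x y : dot x (- y) = - dot x y.
Proof. by rewrite linearNr. Qed.

Lemma dotBl x y z : dot (x - y) z = dot x z - dot y z.
Proof. by rewrite dotDl dotNl. Qed.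

Lemma dotBr x y z : dot z (x - y) = dot z x - dot z y.
Proof. by rewrite dotDr dotNr. Qed.

Lemma dot0l x : dot 0 x = 0. Proof. by rewrite linear0l. Qed.

Lemma dot0r x : dot x 0 = 0. Proof. by rewrite linear0r. Qed.

Lemma dotC x y : dot x y = (dot y x)^*.
Proof. by rewrite hermC expr0 mul1r. Qed.

Lemma dot_suml I (r : seq I) (P : pred I) (F : I -> H) y :
  dot (\sum_(i <- r | P i) F i) y = \sum_(i <- r | P i) dot (F i) y.
Proof. by apply: (big_morph (fun x => dot x y)) => [a b|]; rewrite ?dotDl ?dot0l. Qed.

Lemma dot_sumr I (r : seq I) (P : pred I) (F : I -> H) y :
  dot y (\sum_(i <- r | P i) F i) = \sum_(i <- r | P i) dot y (F i).
Proof. by apply: (big_morph (fun x => dot y x)) => [a b|]; rewrite ?dotDr ?dot0r. Qed.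

Lemma cabs_dotC x y : cabs (dot x y) = cabs (dot y x).
Proof. by rewrite dotC cabsJ. Qed.

Lemma dot_eq0C x y : dot x y = 0 -> dot y x = 0.
Proof. by rewrite dotC => /eqP; rewrite conjc_eq0 => /eqP. Qed.

(** The norm of [H], likewise with values in [R]. *)
Definition nrm x : R := Num.sqrt (complex.Re (dot x x)).

Lemma dot_ge0 x : 0 <= dot x x.
Proof.
have [->|/neq0_dnorm_gt0 x0] := eqVneq x 0; first by rewrite dot0l.
exact/ltW/x0.
Qed.

Lemma dotE x : dot x x = (nrm x ^+ 2)%:C.
Proof.
have := dot_ge0 x; rewrite /nrm; case: (dot x x) => a b.
by rewrite lecE /= => /andP[/eqP -> a0]; rewrite sqr_sqrtr.
Qed.

Lemma nrm_ge0 x : 0 <= nrm x. Proof. exact: sqrtr_ge0. Qed.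

Lemma nrmE x : `|x| = (nrm x)%:C.
Proof.
apply/eqP; rewrite -(@eqrXn2 _ 2)//; last by rewrite lecR nrm_ge0.
by rewrite dot_norm dotE rmorphXn.
Qed.

Lemma nrm0 : nrm 0 = 0. Proof. by rewrite /nrm dot0l sqrtr0. Qed.

Lemma nrm_eq0 x : nrm x = 0 -> x = 0.
Proof. by move=> h; apply/eqP; rewrite -normr_eq0 nrmE h. Qed.

Lemma nrmD x y : nrm (x + y) <= nrm x + nrm y.
Proof. by rewrite -lecR rmorphD /= -!nrmE ler_normD. Qed.

Lemma nrmN x : nrm (- x) = nrm x.
Proof. by rewrite /nrm dotNl dotNr opprK. Qed.

Lemma nrmB x y : nrm (x - y) <= nrm x + nrm y.
Proof. by rewrite -(nrmN y) nrmD. Qed.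

Lemma nrm_distC x y : nrm (x - y) = nrm (y - x).
Proof. by rewrite -opprB nrmN. Qed.

Lemma nrmZ a x : nrm (a *: x) = cabs a * nrm x.
Proof. by apply: complexI; rewrite rmorphM /= -!nrmE -cabsE normrZ. Qed.

Lemma nrm_sum I (r : seq I) (P : pred I) (F : I -> H) :
  nrm (\sum_(i <- r | P i) F i) <= \sum_(i <- r | P i) nrm (F i).
Proof.
apply: (big_ind2 (fun z (c : R) => nrm z <= c)); rewrite ?nrm0// => z c w d zc wd.
by apply: le_trans (nrmD _ _) (lerD _ _).
Qed.

Lemma nrm_sqrD x y : nrm (x + y) ^+ 2 = nrm x ^+ 2 + nrm y ^+ 2 + 2 * complex.Re (dot x y).
Proof.
apply: complexI; rewrite -dotE dotDl !dotDr (dotC y x) !dotE.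
by case: (dot x y) => a b; apply/eqP; rewrite eq_complex /=; apply/andP; split; apply/eqP; ring.
Qed.

Lemma pythagoras x y : dot x y = 0 -> nrm (x + y) ^+ 2 = nrm x ^+ 2 + nrm y ^+ 2.
Proof. by move=> xy; rewrite nrm_sqrD xy mulr0 addr0. Qed.

Lemma cauchy_schwarz x y : cabs (dot x y) <= nrm x * nrm y.
Proof.
have [->|y0] := eqVneq y 0; first by rewrite dot0r cabs0 nrm0 mulr0.
have ny : 0 < nrm y by rewrite lt_def nrm_ge0 andbT; apply: contra_neq y0 => /nrm_eq0.
pose a := dot x y / dot y y.
have dyy : dot y y != 0.
  by rewrite dotE; apply/eqP => /complexI/eqP; rewrite expf_eq0 /= gt_eqF.
have ort : dot (x - a *: y) (a *: y) = 0.
  by rewrite dotBl dotZl !dotZr mulrCA divfK// subrr.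
have := pythagoras ort; rewrite subrK => e.
have : nrm (a *: y) ^+ 2 <= nrm x ^+ 2 by rewrite e lerDr sqr_ge0.
rewrite ler_sqr ?nnegrE ?nrm_ge0// nrmZ.
have : cabs a * nrm y ^+ 2 = cabs (dot x y).
  have -> : nrm y ^+ 2 = cabs (dot y y) by rewrite dotE cabsR ger0_norm// sqr_ge0.
  by rewrite -cabsM divfK.
by move=> <- le_a; rewrite expr2 mulrA; apply: ler_wpM2r => //; exact: nrm_ge0.
Qed.

Definition hcvg (u : nat -> H) l : Prop :=
  (fun n => nrm (u n - l)) @ \oo --> (0 : R).

Lemma hcvg_unique u l l' : hcvg u l -> hcvg u l' -> l = l'.
Proof.
move=> ul ul'; apply/subr0_eq/nrm_eq0.
have := cvgD0 ul ul' => h.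
apply: (@cvg_unique _ (@Rhausdorff R) ((fun=> nrm (l - l')) @ \oo)); first exact: cvg_cst.
apply: cvg0_le h => n; rewrite nrm_ge0 /= -(nrmN (u n - l)).
by apply: le_trans (nrmD _ _); rewrite opprB addrA subrK.
Qed.

Lemma hcvg_cst l : hcvg (fun=> l) l.
Proof. by rewrite /hcvg subrr nrm0; exact: cvg_cst. Qed.

Lemma hcvg_shift k u l : hcvg u l -> hcvg (fun n => u (n + k)%N) l.
Proof. by rewrite /hcvg (cvg_shiftn k (fun n => nrm (u n - l))). Qed.

Lemma hcvgD u v l k : hcvg u l -> hcvg v k -> hcvg (fun n => u n + v n) (l + k).
Proof.
move=> ul vk; have := cvgD0 ul vk; move=> h; apply: cvg0_le h => n.
by rewrite nrm_ge0 /= opprD addrACA nrmD.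
Qed.

Lemma hcvgZ a u l : hcvg u l -> hcvg (fun n => a *: u n) (a *: l).
Proof.
move=> ul; have := cvgM0 (cabs a) ul; move=> h; apply: cvg0_le h => n.
by rewrite nrm_ge0 /= -scalerBr nrmZ.
Qed.

Lemma hcvg_dot u l y : hcvg u l -> ccvg (fun n => dot (u n) y) (dot l y).
Proof.
move=> ul; have := cvgM0 (nrm y) ul; move=> h; apply: cvg0_le h => n.
by rewrite cabs_ge0 /= -dotBl mulrC cauchy_schwarz.
Qed.

Lemma hcvg_dot_const u l y c : (forall n, dot (u n) y = c) -> hcvg u l -> dot l y = c.
Proof.
move=> uc /(hcvg_dot y); rewrite /ccvg; under eq_fun do rewrite uc.
move=> h; apply/esym/subr0_eq/cabs_eq0.
by apply: (@cvg_unique _ (@Rhausdorff R) ((fun=> cabs (c - dot l y)) @ \oo)) => //; exact: cvg_cst.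
Qed.

Lemma hcvg_nrm u l : hcvg u l -> (fun n => nrm (u n)) @ \oo --> nrm l.
Proof.
move=> ul; apply/cvgP0; apply: cvg0_le ul => n; rewrite normr_ge0 /= ler_norml.
apply/andP; split.
  by rewrite lerNl opprB lerBlDr nrm_distC -{1}(subrK (u n) l) nrmD.
by rewrite lerBlDr -{1}(subrK l (u n)) nrmD.
Qed.

Lemma hilbert_complete (u : nat -> H) :
  (forall eps : R, 0 < eps -> exists N, forall m n, (N <= m <= n)%N ->
     nrm (u m - u n) < eps) -> exists l, hcvg u l.
Proof.
move=> cu.
have : cauchy (u @ \oo).
  apply/cauchy_ballP => -[e1 e2] e0.
  have e1_0 : 0 < e1 by move: e0; rewrite ltcE /= => /andP[].
  have ee : e2 = 0 by move: e0; rewrite ltcE /= => /andP[/eqP ->].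
  have [N hN] := cu _ e1_0.
  exists (u @` [set n | (N <= n)%N], u @` [set n | (N <= n)%N]).
    by split; exists N => // n /= Nn; exists n.
  move=> [_ _] /= [[m Nm <-] [n Nn <-]]; rewrite -ball_normE /= nrmE ee ltcR.
  have [mn|/ltnW nm] := leqP m n; first by rewrite hN// Nm.
  by rewrite nrm_distC hN// Nn.
move=> /cauchy_cvg ul; exists (lim (u @ \oo)); apply/cvgP0.
have /cvgrPdist_lt := ul => h.
apply/cvgrPdist_lt => e e0.
have [|N _ hN] := h e%:C; first by rewrite ltcR.
exists N => // n /= /hN /=; rewrite nrmE ltcR nrm_distC.
by rewrite subr0 sub0r normrN normr_id ger0_norm ?nrm_ge0.
Qed.

End InnerProduct.

(** * Orthonormal systems *)

Section OrthonormalSystems.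
Context {R : realType} {H : completeNormedModType R[i]}.
Context {dot : {dot H for @conjc R}} (dot_norm : induces_norm dot).
Implicit Types x y z : H.
Local Notation nrm := (@nrm R H dot).
Local Notation hcvg := (@hcvg R H dot).

(** Families indexed by [nat] whose nonzero members are orthonormal.  Zero
    members allow one index set for finite and infinite families, and let
    vectors be deleted without renumbering. *)
Definition ons (f : nat -> H) : Prop :=
  (forall n, f n = 0 \/ dot (f n) (f n) = 1) /\
  (forall m n, m <> n -> dot (f m) (f n) = 0).

Definition total_sys (f : nat -> H) : Prop :=
  forall x, (forall n, dot x (f n) = 0) -> x = 0.

Lemma dot1_nrm x : dot x x = 1 -> nrm x = 1.
Proof. by rewrite /nrm => ->; rewrite sqrtr1. Qed.

Lemma nrm1_dot x : nrm x = 1 -> dot x x = 1.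
Proof. by rewrite dotE => ->; rewrite expr1n. Qed.

Lemma ons_unit f n : ons f -> f n <> 0 -> dot (f n) (f n) = 1.
Proof. by move=> [/(_ n)[]]. Qed.

Lemma ons_nrm f n : ons f -> nrm (f n) <= 1.
Proof. by move=> [/(_ n)[->|/dot1_nrm ->] _]; rewrite ?nrm0. Qed.

Lemma ons_if (P : pred nat) f : ons f -> ons (fun n => if P n then f n else 0).
Proof.
move=> [f1 f2]; split=> [n|m n mn]; first by case: (P n); [exact: f1|left].
by case: (P m); case: (P n); rewrite ?dot0l ?dot0r// f2.
Qed.

Lemma ons_mul f n x : ons f -> dot x (f n) * dot (f n) (f n) = dot x (f n).
Proof. by move=> [/(_ n)[->|->] _]; rewrite ?dot0r ?mulr0 ?mulr1. Qed.

Lemma ons_comb_sqr f (c : nat -> R[i]) m n : ons f ->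
  nrm (\sum_(m <= i < n) c i *: f i) ^+ 2 <= \sum_(m <= i < n) cabs (c i) ^+ 2.
Proof.
move=> of_; elim: n => [|n IH]; first by rewrite !big_geq// nrm0 expr0n.
have [mn|nm] := leqP m n; last by rewrite !big_geq// nrm0 expr0n.
rewrite !big_nat_recr//= pythagoras; last first.
  rewrite dot_suml big_nat big1// => i /andP[_ i_n].
  by rewrite dotZl dotZr of_.2 ?mulr0//; apply/eqP; rewrite ltn_eqF.
rewrite lerD// nrmZ// exprMn ler_piMr ?sqr_ge0//.
by rewrite expr_le1 ?nrm_ge0 ?(ons_nrm n of_).
Qed.

Definition psum (f : nat -> H) x N := \sum_(i < N) dot x (f i) *: f i.

Lemma dot_comb f (c : nat -> R[i]) N n : ons f ->
  dot (\sum_(i < N) c i *: f i) (f n) =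
    if (n < N)%N then c n * dot (f n) (f n) else 0.
Proof.
move=> of_; rewrite dot_suml; case: ifP => [nN|/negbT]; last first.
  rewrite -leqNgt => Nn; rewrite big1// => i _.
  by rewrite dotZl of_.2 ?mulr0//; apply/eqP; rewrite ltn_eqF// (leq_trans _ Nn).
rewrite (bigD1 (Ordinal nN))//= dotZl big1 ?addr0// => i.
rewrite -val_eqE /= => /eqP ni.
by rewrite dotZl of_.2 ?mulr0.
Qed.

Lemma psum_ortho f x N n : ons f -> (n < N)%N -> dot (x - psum f x N) (f n) = 0.
Proof.
by move=> of_ nN; rewrite dotBl (dot_comb (fun i => dot x (f i)))// nN ons_mul// subrr.
Qed.

Lemma psum_nrm f x N : ons f ->
  nrm (psum f x N) ^+ 2 = \sum_(i < N) cabs (dot x (f i)) ^+ 2.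
Proof.
move=> of_; apply: complexI; rewrite -dotE.
rewrite {2}/psum dot_sumr rmorph_sum; apply: eq_bigr => i _.
rewrite dotZr (dot_comb (fun i => dot x (f i)))// ltn_ord ons_mul//.
by rewrite mulrC mulJc.
Qed.

Lemma psum_split f x N : ons f ->
  nrm x ^+ 2 = nrm (x - psum f x N) ^+ 2 + \sum_(i < N) cabs (dot x (f i)) ^+ 2.
Proof.
move=> of_; rewrite -psum_nrm// -pythagoras ?subrK//.
by rewrite /psum dot_sumr big1// => i _; rewrite dotZr psum_ortho// mulr0.
Qed.

Lemma bessel f x N : ons f -> \sum_(i < N) cabs (dot x (f i)) ^+ 2 <= nrm x ^+ 2.
Proof. by move=> of_; rewrite (psum_split x N of_) lerDr sqr_ge0. Qed.

Lemma bessel_asum f x : ons f -> asum (fun i => cabs (dot x (f i)) ^+ 2).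
Proof.
move=> of_; exists (nrm x ^+ 2) => N; apply: le_trans (bessel x N of_).
by apply: ler_sum => i _; rewrite ger0_norm ?sqr_ge0.
Qed.

(** The Cauchy-Schwarz inequality for the two coefficient sequences; after
    scaling by the norms it is [2 a b <= a ^+ 2 + b ^+ 2] termwise. *)
Lemma bessel_mul f x y N : ons f ->
  \sum_(i < N) cabs (dot x (f i)) * cabs (dot y (f i)) <= nrm x * nrm y.
Proof.
move=> of_; have [x0|x0] := eqVneq (nrm x) 0.
  rewrite x0 mul0r big1// => i _.
  by rewrite (nrm_eq0 dot_norm x0) dot0l cabs0 mul0r.
have [y0|y0] := eqVneq (nrm y) 0.
  rewrite y0 mulr0 big1// => i _.
  by rewrite (nrm_eq0 dot_norm y0) dot0l cabs0 mulr0.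
have xp : 0 < nrm x by rewrite lt_def x0 nrm_ge0.
have yp : 0 < nrm y by rewrite lt_def y0 nrm_ge0.
have xy : 0 < nrm x * nrm y by rewrite mulr_gt0.
rewrite -(ler_pM2r xy) mulr_suml -(ler_pM2l (ltr0Sn R 1)) mulr_sumr.
pose F i := cabs (dot x (f i)) ^+ 2 * nrm y ^+ 2 + cabs (dot y (f i)) ^+ 2 * nrm x ^+ 2.
apply: (@le_trans _ _ (\sum_(i < N) F i)).
  apply: ler_sum => i _; rewrite /F.
  have := sqr_ge0 (cabs (dot x (f i)) * nrm y - cabs (dot y (f i)) * nrm x).
  by nra.
rewrite big_split /= -!mulr_suml.
have := bessel x N of_; have := bessel y N of_.
have := sqr_ge0 (nrm x); have := sqr_ge0 (nrm y).
by nra.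
Qed.

Lemma ons_cvg f (c : nat -> R[i]) : ons f -> asum (fun i => cabs (c i) ^+ 2) ->
  exists l, hcvg (fun N => \sum_(i < N) c i *: f i) l.
Proof.
move=> of_ sc; apply: (hilbert_complete dot_norm) => e e0.
have e2 : 0 < e ^+ 2 by rewrite exprn_gt0.
have [N hN] := rsum_tail_lt sc e2; exists N => m n /andP[Nm mn].
rewrite nrm_distC -!(big_mkord xpredT (fun i => c i *: f i)).
have -> : \sum_(0 <= i < n) c i *: f i - \sum_(0 <= i < m) c i *: f i =
    \sum_(m <= i < n) c i *: f i.
  by rewrite (big_cat_nat (leq0n m) mn)/= addrAC subrr add0r.
rewrite -(@ltr_pXn2r _ 2)// ?nnegrE ?nrm_ge0 ?(ltW e0)//.
apply: le_lt_trans (ons_comb_sqr _ _ _ of_) _; apply: le_lt_trans hN.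
by apply: sum_le_tail => [//|k|]; [exact: sqr_ge0|rewrite Nm].
Qed.

(** Orthogonal projection onto the closed span of [f]. *)
Lemma ons_proj f x : ons f ->
  exists p, hcvg (psum f x) p /\ forall n, dot (x - p) (f n) = 0.
Proof.
move=> of_; have [p hp] := ons_cvg of_ (bessel_asum x of_).
exists p; split=> // n.
have h : hcvg (fun N => x - psum f x (N + n.+1)) (x - p).
  apply: hcvgD => //; first exact: hcvg_cst.
  have := hcvg_shift n.+1 hp.
  move=> /(hcvgZ dot_norm (-1)); rewrite scaleN1r.
  by under eq_fun do rewrite scaleN1r.
apply: (hcvg_dot_const dot_norm _ h) => N.
by rewrite psum_ortho// addnS ltnS leq_addl.
Qed.

Lemma total_expand f x : ons f -> total_sys f -> hcvg (psum f x) x.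
Proof.
move=> of_ tf; have [p [hp /tf/subr0_eq xp]] := ons_proj x of_.
by rewrite {2}xp.
Qed.

Lemma parseval f x y : ons f -> total_sys f ->
  ccvg (fun N => \sum_(i < N) dot x (f i) * dot (f i) y) (dot x y).
Proof.
move=> of_ tf; have := hcvg_dot dot_norm y (total_expand x of_ tf).
congr ccvg; apply/funext => N; rewrite /psum dot_suml.
by apply: eq_bigr => i _; rewrite dotZl.
Qed.

Lemma parseval_nrm f x : ons f -> total_sys f ->
  (fun N => \sum_(i < N) cabs (dot x (f i)) ^+ 2) @ \oo --> nrm x ^+ 2.
Proof.
move=> of_ tf; have /ccvgP[h _] := parseval x x of_ tf.
move: h; rewrite dotE /=; apply: cvg_trans; apply: near_eq_cvg; apply: nearW => N.
rewrite Re_sum; apply: eq_bigr => i _.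
by rewrite (dotC _ x) mulJc.
Qed.

End OrthonormalSystems.

(** * Bounded operators and their adjoints *)

Section BoundedOperators.
Context {R : realType} {H : completeNormedModType R[i]}.
Context {dot : {dot H for @conjc R}} (dot_norm : induces_norm dot).
Implicit Types (x y z : H) (T S P A B : H -> H).
Local Notation nrm := (@nrm R H dot).
Local Notation hcvg := (@hcvg R H dot).
Local Notation ons := (@ons R H dot).
Local Notation total_sys := (@total_sys R H dot).
Local Notation psum := (@psum R H dot).

(** Boundedness with an explicit constant, which estimates can refer to. *)
Definition bnd T (M : R) : Prop :=
  [/\ linear T, 0 <= M & forall x, nrm (T x) <= M * nrm x].

Section LinearMaps.
Variables (T : H -> H) (lT : linear T).

Lemma linD x y : T (x + y) = T x + T y.
Proof. by have := lT 1 x y; rewrite !scale1r. Qed.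

Lemma lin0 : T 0 = 0.
Proof. by apply: (addrI (T 0)); rewrite -linD !addr0. Qed.

Lemma linZ a x : T (a *: x) = a *: T x.
Proof. by have := lT a x 0; rewrite lin0 !addr0. Qed.

Lemma linN x : T (- x) = - T x.
Proof. by rewrite -scaleN1r linZ scaleN1r. Qed.

Lemma linB x y : T (x - y) = T x - T y.
Proof. by rewrite linD linN. Qed.

Lemma lin_sum I (r : seq I) (Q : pred I) (F : I -> H) :
  T (\sum_(i <- r | Q i) F i) = \sum_(i <- r | Q i) T (F i).
Proof. exact: (big_morph T linD lin0). Qed.

End LinearMaps.

Lemma boundedP T : bounded_op T <-> exists M, bnd T M.
Proof.
split=> [[lT cT]|[M [lT M0 hM]]].
  pose fT := GRing.isLinear.Build _ _ _ _ T lT.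
  pose T' : {linear H -> H} := HB.pack T fT.
  have /linear_bounded_continuous/linear_boundedP : continuous T' by [].
  move=> [M [Mr hM]].
  have := hM (M + 1) _; rewrite ltrDl ltr01 => /(_ isT) {}hM.
  have Mr1 : M + 1 \is Num.real by rewrite rpredD// rpred1.
  exists `|complex.Re (M + 1)|; split=> // x.
  have := hM x; rewrite !(nrmE dot_norm) -(RRe_real Mr1) -rmorphM lecR => /le_trans; apply.
  by rewrite ler_wpM2r ?nrm_ge0// ler_norm.
split=> // x; apply/cvgrPdist_lt => e e0.
have e1 : 0 < complex.Re e by move: e0; rewrite ltcE => /andP[].
have ee : e = (complex.Re e)%:C.
  by case: e e0 {e1} => a b; rewrite ltcE /= => /andP[/eqP -> _].
have d0 : (0 : R[i]) < (complex.Re e / (M + 1))%:C.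
  by rewrite ltcR divr_gt0// ltr_wpDl.
apply: filterS (@cvgr_dist_lt _ _ _ _ _ id x (@cvg_id _ _) _ d0) => y /=.
rewrite -linB// !(nrmE dot_norm) [in X in _ -> X]ee !ltcR => h.
apply: le_lt_trans (hM _) _.
have M1 : 0 < M + 1 by rewrite ltr_wpDl.
move: h; rewrite ltr_pdivlMr// => h; apply: le_lt_trans h.
by rewrite mulrC ler_wpM2l ?nrm_ge0// lerDl.
Qed.

Lemma bnd_comp T S M N : bnd T M -> bnd S N -> bnd (T \o S) (M * N).
Proof.
move=> [lT M0 hT] [lS N0 hS]; split; first by move=> a x y /=; rewrite lS lT.
  exact: mulr_ge0.
by move=> x /=; apply: le_trans (hT _) _; rewrite -mulrA ler_wpM2l.
Qed.

Lemma bnd_add T S M N : bnd T M -> bnd S N -> bnd (fun x => T x + S x) (M + N).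
Proof.
move=> [lT M0 hT] [lS N0 hS]; split; last 2 first.
- exact: addr_ge0.
- by move=> x; apply: le_trans (nrmD _ _ _) _; rewrite // mulrDl lerD.
by move=> a x y /=; rewrite lS lT scalerDr addrACA.
Qed.

Lemma bnd_scale T M a : bnd T M -> bnd (fun x => a *: T x) (cabs a * M).
Proof.
move=> [lT M0 hT]; split; last 2 first.
- by rewrite mulr_ge0// cabs_ge0.
- by move=> x; rewrite nrmZ// -mulrA ler_wpM2l// cabs_ge0.
by move=> b x y /=; rewrite lT scalerDr !scalerA mulrC.
Qed.

Lemma bnd_id : bnd id 1.
Proof. by split=> // x; rewrite mul1r. Qed.

Lemma bnd_sub T S M N : bnd T M -> bnd S N -> bnd (fun x => T x - S x) (M + N).
Proof.
move=> bT bS; have := bnd_add bT (bnd_scale (-1) bS).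
rewrite cabsN cabs1 mul1r; congr (bnd _ _).
by apply/funext => x; rewrite scaleN1r.
Qed.

Lemma bnd_le T M N : M <= N -> bnd T M -> bnd T N.
Proof.
move=> MN [lT M0 hT]; split=> //; first exact: le_trans MN.
by move=> x; apply: le_trans (hT _) _; rewrite ler_wpM2r// nrm_ge0.
Qed.

Lemma bnd_hcvg T M u l : bnd T M -> hcvg u l -> hcvg (fun n => T (u n)) (T l).
Proof.
move=> [lT M0 hT] /(cvgM0 M) h; apply: cvg0_le h => n.
by rewrite nrm_ge0 /= -linB.
Qed.

Lemma dot_extr y z : (forall x, dot x y = dot x z) -> y = z.
Proof.
move=> h; apply/subr0_eq/(nrm_eq0 dot_norm).
by rewrite /nrm dotBr h subrr sqrtr0.
Qed.

Lemma adjoint_sym T S : is_adjoint dot T S -> is_adjoint dot S T.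
Proof. by move=> TS x y; rewrite dotC -TS -dotC. Qed.

Lemma adjoint_bnd T S M : bnd T M -> is_adjoint dot T S -> bnd S M.
Proof.
move=> [lT M0 hT] TS; split=> //.
  move=> a x y; apply: dot_extr => z.
  by rewrite -TS !dotDr !dotZr -!TS.
move=> y; have [->|ny] := eqVneq (nrm (S y)) 0; first by rewrite mulr_ge0 ?nrm_ge0.
have n0 : 0 < nrm (S y) by rewrite lt_def ny nrm_ge0.
rewrite -(ler_pM2r n0) -expr2.
have -> : nrm (S y) ^+ 2 = cabs (dot (T (S y)) y).
  by rewrite TS dotE cabsR ger0_norm// sqr_ge0.
apply: le_trans (cauchy_schwarz dot_norm _ _) _.
by rewrite mulrAC ler_wpM2r ?nrm_ge0.
Qed.

(** [S y] is the sum of the [dot y (T (e i)) *: e i].  It converges because the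
    sum [s] of the first squared coefficients is [dot y (T v)] for the partial
    sum [v] itself, whose squared norm is at most [s]; so [sqrt s] is at most
    [M * nrm y]. *)
Lemma adjoint_exists e T M : ons e -> total_sys e -> bnd T M ->
  exists S, is_adjoint dot T S.
Proof.
move=> oe te [lT M0 hT].
pose c y i := dot y (T (e i)).
have c_le y N : \sum_(i < N) cabs (c y i) ^+ 2 <= (M * nrm y) ^+ 2.
  set s := \sum_(i < N) _; pose v := \sum_(i < N) c y i *: e i.
  have sv : dot y (T v) = s%:C.
    rewrite /v lin_sum// dot_sumr rmorph_sum; apply: eq_bigr => i _.
    by rewrite linZ// dotZr -/(c y i) mulrC mulJc.
  have vs : nrm v ^+ 2 <= s.
    have := ons_comb_sqr dot_norm (c y) 0 N oe.
    by rewrite !big_mkord.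
  have s0 : 0 <= s by rewrite sumr_ge0// => i _; rewrite sqr_ge0.
  have : s <= nrm y * (M * nrm v).
    have <- : cabs (dot y (T v)) = s by rewrite sv cabsR ger0_norm.
    apply: le_trans (cauchy_schwarz dot_norm _ _) _.
    by rewrite ler_wpM2l ?nrm_ge0.
  rewrite mulrA (mulrC _ M); set k := M * nrm y => sk.
  have k0 : 0 <= k by rewrite mulr_ge0 ?nrm_ge0.
  have := nrm_ge0 (dot := dot) v; set a := nrm v in vs sk * => a0.
  by nra.
have /choice[S hS] : forall y, exists l, hcvg (fun N => \sum_(i < N) c y i *: e i) l.
  move=> y; apply: ons_cvg => //; exists ((M * nrm y) ^+ 2) => N.
  apply: le_trans (c_le y N); apply: ler_sum => i _.
  by rewrite ger0_norm// sqr_ge0.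
exists S => x y; rewrite [RHS]dotC.
have h1 := hcvg_dot dot_norm x (hS y).
have bT : bnd T M by split.
have h2 := hcvg_dot dot_norm y (bnd_hcvg bT (total_expand dot_norm x oe te)).
have h3 : (fun n => dot (T (psum e x n)) y) =
    fun n => (dot (\sum_(i < n) c y i *: e i) x)^*.
  apply/funext => N; rewrite /psum lin_sum// -[RHS]dotC dot_suml dot_sumr.
  by apply: eq_bigr => i _; rewrite linZ// dotZl dotZr /c [dot (T (e i)) y]dotC mulrC.
rewrite h3 in h2; exact: ccvg_unique h2 (ccvgJ h1).
Qed.

End BoundedOperators.

(** * Positive operators and absolute values *)

Section PositiveOperators.
Context {R : realType} {H : completeNormedModType R[i]}.
Context {dot : {dot H for @conjc R}} (dot_norm : induces_norm dot).
Implicit Types (x y z : H) (T S P A B : H -> H).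
Local Notation nrm := (@nrm R H dot).
Local Notation hcvg := (@hcvg R H dot).
Local Notation ons := (@ons R H dot).
Local Notation total_sys := (@total_sys R H dot).
Local Notation bnd := (@bnd R H dot).

Definition pos T : Prop := forall x, 0 <= dot (T x) x.

Lemma pos_re T x : pos T -> dot (T x) x = (complex.Re (dot (T x) x))%:C.
Proof.
by move=> /(_ x); case: (dot (T x) x) => a b; rewrite lecE /= => /andP[/eqP -> _].
Qed.

Lemma pos_re_ge0 T x : pos T -> 0 <= complex.Re (dot (T x) x).
Proof. by move=> /(_ x); rewrite lecE /= => /andP[]. Qed.

Lemma pos_self T : linear T -> pos T -> is_adjoint dot T T.
Proof.
move=> lT pT x y.
have im z : complex.Im (dot (T z) z) = 0 by rewrite (pos_re z pT).
have h1 := im (x + y); have h2 := im (x + 'i%C *: y).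
rewrite [RHS]dotC; move: h1 h2; rewrite !linD// linZ// !dotDl !dotDr !dotZl !dotZr !ImD !im.
rewrite (pos_re y pT).
case: (dot (T x) y) => a b; case: (dot (T y) x) => c d /=.
by simpc => h1 h2; congr (_ +i* _); lra.
Qed.

Lemma pos_cauchy_schwarz T x y : linear T -> pos T ->
  cabs (dot (T x) y) ^+ 2 <= complex.Re (dot (T x) x) * complex.Re (dot (T y) y).
Proof.
move=> lT pT; set c := dot (T x) y; set p := complex.Re _; set q := complex.Re _.
set k := cabs c ^+ 2.
have k0 : 0 <= k by rewrite sqr_ge0.
have yx : dot (T y) x = c^* by rewrite (pos_self lT pT) dotC.
have h (t : R) : 0 <= p - 2 * t * k + t ^+ 2 * k * q.
  have := pos_re_ge0 (x - (t%:C * c) *: y) pT.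
  rewrite linB// linZ// dotBl !dotBr !dotZl !dotZr -/c yx.
  rewrite (pos_re y pT) -/q !ReD !ReN ReD ReN -/p.
  rewrite /k cabs_sqr; case: (c) => a b /=; lra.
have p0 : 0 <= p by exact: pos_re_ge0.
have q0 : 0 <= q by exact: pos_re_ge0.
have [qz|qn] := eqVneq q 0.
  rewrite qz mulr0; have [//|kp] := leP k 0.
  have := h ((p + 1) / (2 * k)); rewrite qz mulr0 addr0.
  have -> : 2 * ((p + 1) / (2 * k)) * k = p + 1 by field; rewrite gt_eqF.
  by lra.
have qp : 0 < q by rewrite lt_def qn.
have := h q^-1.
have -> : p - 2 * q^-1 * k + q^-1 ^+ 2 * k * q = p - k / q by field; rewrite gt_eqF.
by rewrite subr_ge0 ler_pdivrMr.
Qed.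

(** Cauchy-Schwarz for the form of [T], at [x] and [T x]. *)
Lemma pos_apply T M x : bnd T M -> pos T ->
  nrm (T x) ^+ 2 <= M * complex.Re (dot (T x) x).
Proof.
move=> [lT M0 hM] pT.
have := pos_cauchy_schwarz x (T x) lT pT.
set a := complex.Re (dot (T x) x).
rewrite dotE cabsR ger0_norm ?sqr_ge0//.
set n := nrm (T x) ^+ 2.
have b_le : complex.Re (dot (T (T x)) (T x)) <= M * n.
  apply: le_trans (ler_norm _) _; apply: le_trans (Re_le_cabs _) _.
  apply: le_trans (cauchy_schwarz dot_norm _ _) _.
  by rewrite /n expr2 mulrA ler_wpM2r ?nrm_ge0.
have a0 : 0 <= a by exact: pos_re_ge0.
move=> h; have n0 : 0 <= n by rewrite sqr_ge0.
have := ler_wpM2l a0 b_le => h2.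
have [->|nz] := eqVneq n 0; first by rewrite mulr_ge0.
have np : 0 < n by rewrite lt_def nz.
by rewrite -(ler_pM2r np) -expr2; apply: le_trans h _; rewrite (le_trans h2)// mulrCA mulrA.
Qed.

(** [pcone A T r]: [T] is a polynomial in [A] with nonnegative coefficients and
    no constant term, and [r] is the sum of its coefficients.  If [A] is a
    contraction then [r] bounds the norm of [T]. *)
Inductive pcone A : (H -> H) -> R -> Prop :=
| pcone0 : pcone A (fun=> 0) 0
| pcone1 : pcone A A 1
| pconeD T S r s : pcone A T r -> pcone A S s -> pcone A (fun x => T x + S x) (r + s)
| pconeM T S r s : pcone A T r -> pcone A S s -> pcone A (T \o S) (r * s)
| pconeZ T r (c : R) : 0 <= c -> pcone A T r -> pcone A (fun x => c%:C *: T x) (c * r).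

Section Cone.
Variables (A : H -> H) (bA : bnd A 1) (sA : is_adjoint dot A A).

Lemma pcone_bnd T r : pcone A T r -> bnd T r.
Proof.
elim=> [|//|T' S r' s _ bT _ bS|T' S r' s _ bT _ bS|T' r' c c0 _ bT].
- split=> //; first by move=> a x y; rewrite scaler0 addr0.
  by move=> x; rewrite nrm0 mul0r.
- exact: bnd_add.
- exact: bnd_comp.
- by have := bnd_scale dot_norm c%:C bT; rewrite cabsR ger0_norm.
Qed.

Lemma pcone_comm1 T r : pcone A T r -> forall x, A (T x) = T (A x).
Proof.
have [lA _ _] := bA.
elim=> [x|//|T' S r' s _ h _ h' x|T' S r' s _ h _ h' x|T' r' c c0 _ h x] /=.
- exact: lin0.
- by rewrite linD// h h'.
- by rewrite h h'.
- by rewrite linZ// h.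
Qed.

Lemma pcone_comm T r S s : pcone A T r -> pcone A S s ->
  forall x, T (S x) = S (T x).
Proof.
move=> pT pS; have [lS _ _] := pcone_bnd pS; move: T r pT.
move=> T r; elim=> [x|x|T1 T2 r1 r2 _ h _ h' x|T1 T2 r1 r2 _ h _ h' x|T1 r1 c c0 _ h x] /=.
- by rewrite lin0.
- exact: pcone_comm1 pS x.
- by rewrite linD// h h'.
- by rewrite h' h.
- by rewrite linZ// h.
Qed.

Lemma pcone_adj T r : pcone A T r -> is_adjoint dot T T.
Proof.
elim=> [x y|//|T' S r' s _ h _ h' x y|T' S r' s pT h pS h' x y|T' r' c c0 _ h x y] /=.
- by rewrite dot0l dot0r.
- by rewrite dotDl dotDr h h'.
- by rewrite h h' (pcone_comm pT pS).
- by rewrite dotZl dotRr h.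
Qed.

(** The iteration [q <- (A + q ^ 2) / 2] tends to an operator [Q] with
    [2 Q = A + Q ^ 2], that is, [(1 - Q) ^ 2 = 1 - A]; [qsc] is the same
    iteration for the number [1] in place of [A]. *)
Fixpoint qop n : H -> H :=
  if n is m.+1 then fun x => (2^-1 : R)%:C *: (A x + qop m (qop m x)) else fun=> 0.

Fixpoint qsc n : R := if n is m.+1 then 2^-1 * (1 + qsc m * qsc m) else 0.

Lemma qop_cone n : pcone A (qop n) (qsc n).
Proof.
elim: n => [|n IH] /=; first exact: pcone0.
apply: (@pconeZ _ (fun x => A x + qop n (qop n x))); first by rewrite invr_ge0.
by apply: (@pconeD _ A (qop n \o qop n)); [exact: pcone1|exact: pconeM].
Qed.

Lemma qsc01 n : 0 <= qsc n <= 1.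
Proof. by elim: n => [|n /andP[h0 h1]] /=; rewrite ?lexx ?ler01//; apply/andP; split; nra. Qed.

(** Increments of the iteration are polynomials in [A] with nonnegative
    coefficients, whose sum is the increment of the scalar iteration: this
    turns scalar convergence into operator convergence. *)
Lemma qop_diff n : pcone A (fun x => qop n.+1 x - qop n x) (qsc n.+1 - qsc n).
Proof.
have lq k : linear (qop k) by have [] := pcone_bnd (qop_cone k).
elim: n => [|n IH].
  have := pconeZ (_ : 0 <= 2^-1 :> R) (pcone1 A); rewrite invr_ge0 ler0n => /(_ isT).
  congr pcone; last by rewrite /=; ring.
  by apply/funext => x /=; rewrite addr0 subr0.
have c0 : 0 <= 2^-1 :> R by rewrite invr_ge0.
have := pconeZ c0 (pconeM IH (pconeD (qop_cone n.+1) (qop_cone n))).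
congr pcone; last by rewrite /=; ring.
apply/funext => x; rewrite [qop n.+2]/= -/(qop n.+1).
have -> : qop n.+1 x = (2^-1 : R)%:C *: (A x + qop n (qop n x)) by [].
rewrite -scalerBr; congr (_ *: _).
rewrite opprD addrACA subrr add0r /comp !(linD (lq _)).
rewrite (pcone_comm (qop_cone n.+1) (qop_cone n)).
by rewrite opprD addrA addrK.
Qed.

Lemma qop_le n k x : nrm (qop (n + k) x - qop n x) <= (qsc (n + k) - qsc n) * nrm x.
Proof.
elim: k => [|k IH]; first by rewrite addn0 !subrr nrm0 mul0r.
have -> : qop (n + k.+1) x - qop n x =
    (qop (n + k).+1 x - qop (n + k) x) + (qop (n + k) x - qop n x).
  by rewrite addrA subrK addnS.
apply: le_trans (nrmD dot_norm _ _) _.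
have [_ _ /(_ x) h] := pcone_bnd (qop_diff (n + k)).
have -> : qsc (n + k.+1) - qsc n = (qsc (n + k).+1 - qsc (n + k)) + (qsc (n + k) - qsc n).
  by rewrite addrA subrK addnS.
by rewrite mulrDl lerD.
Qed.

Lemma qsc_nd : nondecreasing_seq qsc.
Proof.
apply/nondecreasing_seqP => n; rewrite -subr_ge0.
by have [_ h _] := pcone_bnd (qop_diff n).
Qed.

Lemma sqrt_aux : exists Q, [/\ bnd Q 1, is_adjoint dot Q Q &
  forall x, Q x + Q x = A x + Q (Q x)].
Proof.
have cq : cvgn qsc.
  apply: nondecreasing_is_cvgn; first exact: qsc_nd.
  by exists 1 => _ [n _ <-]; have /andP[] := qsc01 n.
have q1 := qsc01; have bq n := pcone_bnd (qop_cone n).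
have /choice[Q hQ] : forall x, exists l, hcvg (fun n => qop n x) l.
  move=> x; apply: (hilbert_complete dot_norm) => e e0.
  have e1 : 0 < e / (nrm x + 1) by rewrite divr_gt0// ltr_wpDl ?nrm_ge0.
  have /cvgrPdist_lt/(_ _ e1)[N _ hN] := cq; exists N => m n /andP[Nm mn].
  have := hN _ Nm; have := nondecreasing_cvgn_le qsc_nd cq n => /= h1.
  rewrite ger0_norm ?subr_ge0 ?(nondecreasing_cvgn_le qsc_nd cq)// ltr_pdivlMr ?ltr_wpDl ?nrm_ge0// => h2.
  rewrite nrm_distC; apply: le_lt_trans h2; rewrite -(subnKC mn).
  apply: le_trans (qop_le _ _ _) _; rewrite subnKC//.
  apply: ler_pM; rewrite ?nrm_ge0 ?subr_ge0 ?(qsc_nd mn)//.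
    by rewrite lerD2r.
  by rewrite lerDl.
have lQ : linear Q.
  move=> a x y; apply: (hcvg_unique dot_norm (hQ _)).
  have := hcvgD dot_norm (hcvgZ dot_norm a (hQ x)) (hQ y).
  congr hcvg; apply/funext => n; by have [lq _ _] := bq n; rewrite lq.
have bQ : bnd Q 1.
  split=> // x; rewrite mul1r.
  apply: (ler_cvg_to (hcvg_nrm dot_norm (hQ x)) (cvg_cst (nrm x))).
  apply: nearW => n; have [_ _ /(_ x) h] := bq n; apply: le_trans h _.
  by rewrite -[leRHS]mul1r ler_wpM2r ?nrm_ge0//; have /andP[] := q1 n.
exists Q; split=> //.
  move=> x y; have h1 := hcvg_dot dot_norm y (hQ x).
  have h2 := ccvgJ (hcvg_dot dot_norm x (hQ y)).
  rewrite (dotC x); apply: ccvg_unique h1 _; move: h2.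
  congr ccvg; apply/funext => n.
  by rewrite -dotC (pcone_adj (qop_cone n)).
move=> x; apply: (hcvg_unique dot_norm (u := fun n => qop n.+1 x + qop n.+1 x)).
  have := hcvg_shift 1 (hcvgD dot_norm (hQ x) (hQ x)).
  by under eq_fun do rewrite addn1.
have h : hcvg (fun n => qop n (qop n x)) (Q (Q x)).
  have h1 := cvgD0 (hQ x) (hQ (Q x)); apply: cvg0_le h1 => n.
  rewrite nrm_ge0 /=; have [lq _ hq] := bq n.
  have -> : qop n (qop n x) - Q (Q x) = qop n (qop n x - Q x) + (qop n (Q x) - Q (Q x)).
    by rewrite (linB lq) addrA subrK.
  apply: le_trans (nrmD dot_norm _ _) _; rewrite lerD2r.
  apply: le_trans (hq _) _; rewrite -[leRHS]mul1r ler_wpM2r ?nrm_ge0//.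
  by have /andP[] := q1 n.
have := hcvgD dot_norm (hcvg_cst (A x)) h; congr hcvg; apply/funext => n /=.
rewrite -scalerDl -rmorphD /= -mulr2n -[_ *+ 2]mulr_natl divff ?pnatr_eq0//.
by rewrite scale1r.
Qed.

End Cone.

(** After scaling, [B = 1 - A] with [A] a contraction, and the square root is
    [1 - Q] where [2 Q = A + Q ^ 2]. *)
Lemma sqrt_exists B M : bnd B M -> pos B ->
  exists P, positive_op dot P /\ P \o P = B.
Proof.
move=> bB0 pB; pose M1 := M + 1.
have [lB M0 _] := bB0.
have M1p : 0 < M1 by rewrite ltr_wpDl.
have bB : bnd B M1 by apply: bnd_le bB0; rewrite lerDl.
pose m := M1^-1; have mp : 0 < m by rewrite invr_gt0.
pose A x := x - m%:C *: B x.
have sB := pos_self lB pB.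
have bA0 : bnd A (1 + cabs m%:C * M1).
  exact: (bnd_sub dot_norm bnd_id (bnd_scale dot_norm m%:C bB)).
have [lA _ _] := bA0.
have sA : is_adjoint dot A A.
  by move=> x y; rewrite /A dotBl dotBr dotZl dotRr sB.
have reA x : complex.Re (dot (A x) x) = nrm x ^+ 2 - m * complex.Re (dot (B x) x).
  by rewrite /A dotBl dotZl ReD ReN ReZ dotE.
have pA : pos A.
  move=> x; rewrite lecE /=; apply/andP; split.
    by rewrite /A dotBl dotZl ImD ImN ImZ dotE (pos_re x pB) /= mulr0 subr0.
  rewrite reA subr_ge0 /m mulrC ler_pdivrMr//.
  apply: le_trans (ler_norm _) _; apply: le_trans (Re_le_cabs _) _.
  apply: le_trans (cauchy_schwarz dot_norm _ _) _.
  have [_ _ /(_ x) h] := bB.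
  by rewrite expr2 mulrC -mulrA [_ * M1]mulrC ler_wpM2l ?nrm_ge0.
have bA : bnd A 1.
  split=> // x; rewrite mul1r.
  have qA y : complex.Re (dot (A y) y) <= nrm y ^+ 2.
    by rewrite reA gerDl oppr_le0 mulr_ge0 ?(ltW mp)// pos_re_ge0.
  have := pos_cauchy_schwarz x (A x) lA pA.
  rewrite dotE cabsR ger0_norm ?sqr_ge0// => h.
  have h2 := le_trans h (ler_pM (pos_re_ge0 x pA) (pos_re_ge0 (A x) pA) (qA x) (qA (A x))).
  have [->|nz] := eqVneq (nrm (A x)) 0; first exact: nrm_ge0.
  have np : 0 < nrm (A x) ^+ 2 by rewrite exprn_gt0// lt_def nz nrm_ge0.
  by move: h2; rewrite expr2 ler_pM2r// ler_sqr ?nnegrE ?nrm_ge0.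
have [Q [bQ sQ eQ]] := sqrt_aux bA sA.
have [lQ _ hQ] := bQ.
pose r := Num.sqrt M1.
have rr : r * r = M1 by rewrite -expr2 sqr_sqrtr// ltW.
pose P x := r%:C *: (x - Q x).
have bP : bnd P (cabs r%:C * (1 + 1)).
  exact: (bnd_scale dot_norm r%:C (bnd_sub dot_norm bnd_id bQ)).
have [lP _ _] := bP.
exists P; split; last first.
  apply/funext => x; rewrite /comp /P (linZ lQ) -scalerBr scalerA -rmorphM rr (linB lQ).
  have -> : (x - Q x) - (Q x - Q (Q x)) = x + Q (Q x) - (Q x + Q x).
    by rewrite opprB addrACA -opprD.
  rewrite eQ /A opprD opprB addrACA subrr addr0 addrC subrK.
  by rewrite scalerA -rmorphM divff ?gt_eqF// scale1r.
split; first by apply/(boundedP dot_norm); eexists; exact: bP.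
move=> x; rewrite /P dotZl mulr_ge0 ?ler0c ?sqrtr_ge0// dotBl dotE subr_ge0.
have : complex.Im (dot (Q x) x) = 0.
  have := sQ x x; rewrite [RHS]dotC; case: (dot (Q x) x) => a b [] /=; lra.
have := Re_le_cabs (dot (Q x) x); have := cauchy_schwarz dot_norm (Q x) x.
have := hQ x; rewrite mul1r => h1 h2 h3 h4.
rewrite lecE /= h4 eqxx /=; apply: le_trans (ler_norm _) _.
apply: (le_trans h3); apply: (le_trans h2).
by rewrite expr2 ler_wpM2r ?nrm_ge0.
Qed.

Lemma absop_exists e T M : ons e -> total_sys e -> bnd T M ->
  exists P, is_absop dot T P.
Proof.
move=> oe te bT; have [S TS] := adjoint_exists dot_norm oe te bT.
have bS := adjoint_bnd dot_norm bT TS.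
have pST : pos (S \o T).
  by move=> x /=; rewrite (adjoint_sym TS) dot_ge0.
have [P [pP PP]] := sqrt_exists (bnd_comp bS bT) pST.
by exists P; split=> //; exists S.
Qed.

End PositiveOperators.

(** * Spectral theorem for compact selfadjoint operators *)

Section Spectral.
Context {R : realType} {H : completeNormedModType R[i]}.
Context {dot : {dot H for @conjc R}} (dot_norm : induces_norm dot).
Implicit Types (x y z : H) (T S P A B : H -> H).
Local Notation nrm := (@nrm R H dot).
Local Notation hcvg := (@hcvg R H dot).
Local Notation ons := (@ons R H dot).
Local Notation total_sys := (@total_sys R H dot).
Local Notation psum := (@psum R H dot).
Local Notation bnd := (@bnd R H dot).

(** A cluster point of [u] in a product of compact intervals, found
    coordinatewise along one ultrafilter. *)
Lemma diagonal_extraction (u : nat -> nat -> R) : (forall n j, `|u n j| <= 1) ->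
  exists xi : nat -> R, forall k (eps : R), 0 < eps ->
    exists2 n, (k <= n)%N & forall j, (j < k)%N -> `|u n j - xi j| < eps.
Proof.
move=> u1.
have [G [GU oG]] := ultraFilterLemma (eventually_filter : ProperFilter \oo).
have /choice[xi hxi] : forall j, exists x : R, forall e : R, 0 < e ->
    G [set n | `|u n j - x| < e].
  move=> j; have FG : ProperFilter ((fun n => u n j) @ G) by apply: fmap_proper_filter.
  have := @segment_compact R (-1) 1 _ FG.
  have hG : ((fun n => u n j) @ G) `[(-1 : R), 1]%classic.
    rewrite /fmap/= (_ : _ @^-1` _ = setT); first exact: filterT.
    by apply/seteqP; split=> // n _ /=; rewrite in_itv /= -ler_norml.
  move=> /(_ hG)[x [_ cx]]; exists x => e e0.
  have [//|hC] := @in_ultra_setVsetC _ G [set n | `|u n j - x| < e] GU.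
  have := cx [set y | ~ `|y - x| < e] [set y | `|y - x| < e] hC.
  have : nbhs x [set y | `|y - x| < e].
    apply/nbhs_ballP; exists e => // y /=.
    by rewrite -ball_normE /= distrC.
  by move=> h /(_ h)[y []].
exists xi => k eps e0.
suff : G [set n | (k <= n)%N /\ forall j, (j < k)%N -> `|u n j - xi j| < eps].
  by move=> /filter_ex[n [kn hn]]; exists n.
suff h m : G [set n | forall j, (j < m)%N -> `|u n j - xi j| < eps].
  apply: filterI; last exact: h.
  by apply: oG; exists k.
elim: m => [|m IH]; first by apply: filterS (@filterT _ G _) => n.
apply: filterS (filterI IH (hxi m _ e0)) => n [h1 h2] j.
by rewrite ltnS leq_eqVlt => /orP[/eqP ->//|]; exact: h1.
Qed.

(** For bounded [T] and total orthonormal [e] this says that [T] is compact. *)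
Definition tail_small e T : Prop := forall eps : R, 0 < eps ->
  exists N, forall y, (forall n, (n < N)%N -> dot y (e n) = 0) ->
    nrm (T y) <= eps * nrm y.

Lemma unit_normalize x : x <> 0 -> let v := ((nrm x)^-1)%:C *: x in
  dot v v = 1 /\ x = (nrm x)%:C *: v.
Proof.
move=> x0; have nx : nrm x != 0 by apply/eqP => /(nrm_eq0 dot_norm).
split; last by rewrite scalerA -rmorphM divff// scale1r.
rewrite dotZl dotRr mulrA -rmorphM dotE -rmorphM /=.
by have -> : (nrm x)^-1 * (nrm x)^-1 * nrm x ^+ 2 = 1 by field.
Qed.

Lemma cvg0_sqr (u : nat -> R) : (forall n, 0 <= u n) ->
  (fun n => u n ^+ 2) @ \oo --> 0 -> u @ \oo --> 0.
Proof.
move=> u0 /cvgrPdist_lt h; apply/cvgrPdist_lt => e e0.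
have e2 : 0 < e ^+ 2 by rewrite exprn_gt0.
apply: filterS (h _ e2) => n /=; rewrite !sub0r !normrN.
by rewrite ger0_norm ?sqr_ge0// ger0_norm// ltr_sqr ?nnegrE ?(ltW e0).
Qed.

Lemma cvg_inv_succ (c : R) : (fun n => c * (n.+1%:R)^-1) @ \oo --> (0 : R).
Proof. by apply: cvgM0; exact: cvg_harmonic. Qed.

(** Along indices at which the coordinates of [X] converge, the first [N]
    coordinates of [X (s m) - X (s n)] tend to [0], while [T] is small on the
    rest. *)
Lemma tail_small_subseq e T M (X : nat -> H) : bnd T M -> ons e ->
  tail_small e T -> (forall n, nrm (X n) = 1) ->
  exists (s : nat -> nat) y, (forall k, (k <= s k)%N) /\
    hcvg (fun k => T (X (s k))) y.
Proof.
move=> bT oe tT X1; have [lT M0 hT] := bT.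
pose u n j := if odd j then complex.Im (dot (X n) (e j./2))
              else complex.Re (dot (X n) (e j./2)).
have u1 n j : `|u n j| <= 1.
  have : cabs (dot (X n) (e j./2)) <= 1.
    apply: le_trans (cauchy_schwarz dot_norm _ _) _; rewrite X1 mul1r.
    exact: ons_nrm.
  by rewrite /u; case: ifP => _; apply: le_trans; rewrite ?Re_le_cabs ?Im_le_cabs.
have [xi hxi] := diagonal_extraction u1.
have /choice[s hs] : forall k, exists n, (k <= n)%N /\
    forall j, (j < k)%N -> `|u n j - xi j| < (k.+1%:R)^-1.
  move=> k; have [|n kn hn] := hxi k (k.+1%:R)^-1; first by rewrite invr_gt0 ltr0n.
  by exists n.
exists s; suff [y hy] : exists y, hcvg (fun k => T (X (s k))) y.
  by exists y; split=> // k; have [] := hs k.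
apply: (hilbert_complete dot_norm) => eps e0.
have e4 : 0 < eps / 4%:R by rewrite divr_gt0.
have [N hN] := tT _ e4.
have /cvgrPdist_lt := cvg_inv_succ (M * N%:R * 4%:R).
have e2 : 0 < eps / 2 by rewrite divr_gt0.
move=> /(_ _ e2)[K _ hK]; exists (maxn K N.*2) => m n.
rewrite geq_max => /andP[/andP[Km Nm] mn].
have Nn := leq_trans Nm mn.
set w := X (s m) - X (s n).
have w2 : nrm w <= 2 by apply: le_trans (nrmB dot_norm _ _) _; rewrite !X1.
have cw j : (j < N)%N -> cabs (dot w (e j)) <= 4%:R * (m.+1%:R)^-1.
  move=> jN; apply: le_trans (cabs_le_ReIm _) _.
  have hj b : (b + j.*2 < m)%N && (b + j.*2 < n)%N ->
      `|u (s m) (b + j.*2)%N - u (s n) (b + j.*2)%N| <= 2 * (m.+1%:R)^-1.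
    move=> /andP[jm jn].
    have h1 := (hs m).2 _ jm; have h2 := (hs n).2 _ jn.
    have h3 : (n.+1%:R)^-1 <= (m.+1%:R)^-1 :> R by rewrite lef_pV2 ?posrE ?ltr0n// ler_nat ltnS.
    move: h1 h2 h3; set c := (m.+1%:R)^-1; set d := (n.+1%:R)^-1.
    rewrite !ltr_norml => /andP[? ?] /andP[? ?] ?.
    by rewrite ler_norml; apply/andP; split; lra.
  have j2 : (1 + j.*2 < N.*2)%N by rewrite add1n -doubleS ltn_Sdouble //.
  have := hj 0%N; have := hj 1%N; rewrite !add1n !add0n.
  rewrite (leq_trans j2 Nm) (leq_trans j2 Nn) !(leq_trans (ltnW j2)) //=.
  rewrite /u /= !odd_double /= uphalf_double half_double => /(_ isT) h1 /(_ isT) h2.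
  rewrite /w dotBl ReD ImD ReN ImN; move: h1 h2; set c := (m.+1%:R)^-1.
  by lra.
rewrite -linB// -/w -[w](subrK (psum e w N)) linD//.
apply: le_lt_trans (nrmD dot_norm _ _) _.
have h1 : nrm (T (w - psum e w N)) <= eps / 4%:R * 2.
  apply: le_trans (hN _ (fun n hn => psum_ortho w oe hn)) _.
  apply: (ler_wpM2l (ltW e4)); apply: le_trans w2.
  rewrite -ler_sqr ?nnegrE ?nrm_ge0// [leRHS](psum_split w N oe).
  by rewrite lerDl sumr_ge0// => i _; rewrite sqr_ge0.
have h2 : nrm (T (psum e w N)) <= M * N%:R * 4%:R * (m.+1%:R)^-1.
  apply: le_trans (hT _) _; rewrite -!mulrA ler_wpM2l//.
  apply: le_trans (nrm_sum dot_norm _ _ _) _.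
  have -> : N%:R * (4%:R * (m.+1%:R)^-1) = \sum_(i < N) (4%:R * (m.+1%:R)^-1) :> R.
    by rewrite sumr_const card_ord mulr_natl.
  apply: ler_sum => i _; rewrite nrmZ//.
  apply: le_trans (cw i (ltn_ord i)).
  by rewrite ler_piMr ?cabs_ge0 ?(ons_nrm _ oe).
have := hK m Km; rewrite /= sub0r normrN ltr_norml => /andP[_ h3].
have : eps / 4%:R * 2 = eps / 2 by field.
by move: h1 h2 h3; set a := _ * _ / _; lra.
Qed.

(** Let [b] be the supremum of [nrm (T x)] over the unit vectors [x] orthogonal
    to [S].  Then [nrm (T (T x) - b ^+ 2 *: x) ^+ 2] is at most
    [b ^+ 2 * (b ^+ 2 - nrm (T x) ^+ 2)], so compactness makes a maximizing
    sequence converge to some [w] with [T (T w) = b ^+ 2 *: w].  Either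
    [T w + b *: w] is an eigenvector for [b], or it vanishes and [w] is one
    for [- b]. *)
Lemma eigenvector_exists e T M (S : set H) : bnd T M -> is_adjoint dot T T ->
  ons e -> tail_small e T ->
  (forall s, S s -> exists a : R, T s = a%:C *: s) ->
  (exists2 x, x <> 0 & forall s, S s -> dot x s = 0) ->
  exists v (a : R), [/\ dot v v = 1, T v = a%:C *: v &
    forall s, S s -> dot v s = 0].
Proof.
move=> bT sT oe tT eS [x0 x0n x0S]; have [lT M0 hT] := bT.
pose D x := forall s, S s -> dot x s = 0.
have DT x : D x -> D (T x).
  by move=> Dx s Ss; rewrite sT; have [a ->] := eS _ Ss; rewrite dotRr Dx// mulr0.
have DZ a x : D x -> D (a *: x) by move=> Dx s Ss; rewrite dotZl Dx// mulr0.
have DD x y : D x -> D y -> D (x + y).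
  by move=> Dx Dy s Ss; rewrite dotDl Dx// Dy// addr0.
have [T0|/existsNP[x1 /not_implyP[Dx1 Tx1]]] :=
    pselect (forall x, D x -> T x = 0).
  have [v1 _] := unit_normalize x0n.
  exists (((nrm x0)^-1)%:C *: x0), 0; split=> //; last exact: DZ.
  by rewrite scale0r T0//; exact: DZ.
pose E := [set r | exists2 x, D x /\ nrm x = 1 & r = nrm (T x)].
have Eub : has_ubound E.
  by exists M => _ [x [_ x1'] ->]; have := hT x; rewrite x1' mulr1.
have x1n : x1 <> 0 by move=> x10; apply: Tx1; rewrite x10 lin0.
have [v1 ev1] := unit_normalize x1n.
set v := _ *: x1 in v1 ev1.
have Ev : E (nrm (T v)) by exists v => //; split; [exact: DZ|exact: dot1_nrm].
pose b := sup E.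
have bE r : E r -> r <= b by move=> Er; apply: ub_le_sup.
have b0 : 0 < b.
  apply: lt_le_trans (bE _ Ev); rewrite lt_def nrm_ge0 andbT.
  apply/eqP => /(nrm_eq0 dot_norm) Tv0; apply: Tx1.
  by rewrite ev1 linZ// Tv0 scaler0.
have hb x : D x -> nrm (T x) <= b * nrm x.
  move=> Dx; have [->|xn] := pselect (x = 0); first by rewrite lin0// nrm0 mulr0.
  have [w1 ew] := unit_normalize xn; rewrite {1}ew linZ// nrmZ//.
  rewrite cabsR ger0_norm ?nrm_ge0// mulrC ler_wpM2r ?nrm_ge0//.
  by apply: bE; eexists; last by []; split; [exact: DZ|exact: dot1_nrm].
have /choice[X hX] : forall n, exists x, [/\ D x, nrm x = 1 & b - (n.+1%:R)^-1 < nrm (T x)].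
  move=> n; have n0 : 0 < (n.+1%:R)^-1 :> R by rewrite invr_gt0 ltr0n.
  have [|r [x [Dx x1'] ->] hr] := @sup_adherent _ E _ n0; last by exists x.
  by split; [exists (nrm (T v))|exact: Eub].
have [s [y [sk hy]]] := tail_small_subseq bT oe tT (fun n => let: And3 _ h _ := hX n in h).
pose Z k := X (s k).
have DZk k : D (Z k) by have [] := hX (s k).
have Z1 k : nrm (Z k) = 1 by have [] := hX (s k).
have TZ k : b - (k.+1%:R)^-1 <= nrm (T (Z k)).
  have [_ _ /ltW] := hX (s k); apply: le_trans; rewrite lerD2l lerN2.
  by rewrite lef_pV2 ?posrE ?ltr0n// ler_nat ltnS.
have TTZ : (fun k => nrm (T (T (Z k)) - (b ^+ 2)%:C *: Z k)) @ \oo --> 0.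
  apply: cvg0_sqr => [k|]; first exact: nrm_ge0.
  have := cvg_inv_succ (2 * b ^+ 3); apply: cvg0_le => k.
  rewrite sqr_ge0 /= nrm_sqrD nrmN nrmZ// cabsR Z1 dotNr dotRr ReN ReZ.
  rewrite sT dotE /= mulr1 real_normK ?num_real//.
  have h1 := hb _ (DT _ (DZk k)); have h2 := hb _ (DZk k).
  rewrite Z1 mulr1 in h2; have h3 := TZ k.
  have h4 := nrm_ge0 (dot := dot) (T (Z k)).
  have h5 := nrm_ge0 (dot := dot) (T (T (Z k))).
  move: h1 h2 h3 h4 h5; set t := nrm (T (Z k)); set tt := nrm _; set c := _^-1.
  move=> h1 h2 h3 h4 h5.
  have g1 : tt ^+ 2 <= b ^+ 2 * t ^+ 2.
    by rewrite -exprMn ler_sqr ?nnegrE// mulr_ge0// ltW.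
  have g2 : b ^+ 2 - t ^+ 2 <= 2 * b * c.
    rewrite subr_sqr; apply: le_trans (_ : c * (b + b) <= _); last by lra.
    by apply: ler_pM; lra.
  have b2 : 0 <= b ^+ 2 by rewrite sqr_ge0.
  have := ler_wpM2l b2 g2.
  by lra.
pose w := ((b ^+ 2)^-1)%:C *: T y.
have bn : b ^+ 2 != 0 by rewrite expf_neq0// gt_eqF.
have Zw : hcvg Z w.
  have h1 := cvgD0 TTZ (bnd_hcvg bT hy).
  have := cvgM0 `|(b ^+ 2)^-1| h1; apply: cvg0_le => k.
  rewrite nrm_ge0 /= /w.
  have -> : Z k - ((b ^+ 2)^-1)%:C *: T y = ((b ^+ 2)^-1)%:C *: ((b ^+ 2)%:C *: Z k - T y).
    by rewrite scalerBr scalerA -rmorphM mulVf// scale1r.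
  rewrite nrmZ// cabsR ler_wpM2l//.
  have -> : (b ^+ 2)%:C *: Z k - T y =
      ((b ^+ 2)%:C *: Z k - T (T (Z k))) + (T (T (Z k)) - T y) by rewrite addrA subrK.
  apply: le_trans (nrmD dot_norm _ _) _; rewrite (nrm_distC (_ *: _)); exact: lexx.
have Dw : D w by move=> s' Ss; apply: (hcvg_dot_const dot_norm _ Zw) => k; exact: DZk.
have w1 : nrm w = 1.
  have := hcvg_nrm dot_norm Zw; under eq_fun do rewrite Z1.
  by move=> h; exact: (rcvg_unique h (cvg_cst _)).
have TTw : T (T w) = (b ^+ 2)%:C *: w.
  apply: (hcvg_unique dot_norm (u := fun k => T (T (Z k)))).
    by apply: (bnd_hcvg bT); apply: (bnd_hcvg bT).
  have := cvgD0 TTZ (hcvgZ dot_norm (b ^+ 2)%:C Zw); apply: cvg0_le => k.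
  rewrite nrm_ge0 /=; apply: le_trans (nrmD dot_norm _ _).
  by rewrite addrA subrK.
have [wz|wn] := pselect (T w + b%:C *: w = 0).
  exists w, (- b); split=> //; first exact: nrm1_dot.
  by rewrite rmorphN scaleNr; apply/eqP; rewrite -addr_eq0 wz.
have [u1 _] := unit_normalize wn; eexists; exists b; split; first exact: u1.
  rewrite (linZ lT) (linD lT) (linZ lT b%:C w) TTw [RHS]scalerA mulrC -scalerA.
  have -> // : b%:C *: (T w + b%:C *: w) = (b ^+ 2)%:C *: w + b%:C *: T w.
  by rewrite scalerDr scalerA -rmorphM addrC expr2.
by apply/DZ/DD; [exact: DT|exact: DZ].
Qed.

(** An orthonormal set in a separable space is countable, as its points are
    at distance [sqrt 2]. *)
Lemma ortho_countable (S : set H) : separable_space H ->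
  (forall s, S s -> dot s s = 1) ->
  (forall s t, S s -> S t -> s <> t -> dot s t = 0) -> countable S.
Proof.
move=> [D cD dD] S1 So.
have /choice[d hd] : forall s, exists t, D t /\ nrm (s - t) < 2^-1.
  move=> s; have o : open (ball s ((2^-1 : R)%:C)).
    by apply: ball_open; rewrite ltcR invr_gt0 ltr0n.
  have [|t [Bt Dt]] := dD _ _ o.
    exists s; apply: ballxx; rewrite ltcR invr_gt0 ltr0n//.
  exists t; split=> //; move: Bt.
  by rewrite -ball_normE /= (nrmE dot_norm) ltcR.
have /countable_injP[f fi] := cD.
apply/countable_injP; exists (f \o d) => s t.
rewrite !inE => Ss St /fi; rewrite !inE => /(_ (hd s).1 (hd t).1) dst.
apply: contrapT => st.
have h1 := (hd s).2; have h2 := (hd t).2; rewrite -dst nrm_distC in h2.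
have : nrm (s - t) < 1.
  rewrite -(subrK (d s) s) -addrA; apply: le_lt_trans (nrmD dot_norm _ _) _.
  by lra.
have := @pythagoras _ _ dot s (- t); rewrite dotNr So// oppr0 nrmN => /(_ erefl).
rewrite (dot1_nrm (S1 _ Ss)) (dot1_nrm (S1 _ St)) expr1n => h3.
have := nrm_ge0 (dot := dot) (s - t); nra.
Qed.

(** A maximal orthonormal set of eigenvectors is total, as
    [eigenvector_exists] would enlarge it, and separability makes it countable. *)
Theorem spectral e T M : separable_space H -> bnd T M -> is_adjoint dot T T ->
  ons e -> tail_small e T ->
  exists f (mu : nat -> R), [/\ ons f, total_sys f,
    forall n, T (f n) = (mu n)%:C *: f n & forall n, f n = 0 -> mu n = 0].
Proof.
move=> sepH bT sT oe tT.
pose P (S : set H) := [/\ forall s, S s -> dot s s = 1,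
  forall s t, S s -> S t -> s <> t -> dot s t = 0 &
  forall s, S s -> exists a : R, T s = a%:C *: s].
have [F FP tF|S [[S1 So eS] Smax]] := @Zorn_bigcup _ P.
  split=> [s [X FX Xs]|s t [X FX Xs] [Y FY Yt]|s [X FX Xs]].
  - by have [h _ _] := FP _ FX; exact: h.
  - have [XY|YX] := tF _ _ FX FY.
      by have [_ h _] := FP _ FY; apply: h => //; exact: XY.
    by have [_ h _] := FP _ FX; apply: h => //; exact: YX.
  - by have [_ _ h] := FP _ FX; exact: h.
have Stot x : (forall s, S s -> dot x s = 0) -> x = 0.
  move=> xS; apply: contrapT => xn.
  have [v [a [v1 Tv vS]]] := eigenvector_exists bT sT oe tT eS (ex_intro2 _ _ x xn xS).
  apply: (Smax (S `|` [set v])).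
    split; first by left.
    move=> /(_ v (or_intror erefl)) Sv.
    by have := vS v Sv; rewrite v1 => /eqP; rewrite oner_eq0.
  split=> [s [/S1//|->//]|s t|s [/eS//|->]]; last by exists a.
  move=> [Ss|->] [St|->] st; first exact: So.
  - by apply: dot_eq0C; exact: vS.
  - exact: vS.
  - by [].
have /countable_injP[g gi] := ortho_countable sepH S1 So.
pose f n := xget 0 [set s | S s /\ g s = n].
have fP n : (S (f n) /\ g (f n) = n) \/ f n = 0.
  rewrite /f; case: xgetP => [y _ [Sy gy]|_]; first by left.
  by right.
have fg s : S s -> f (g s) = s.
  move=> Ss; rewrite /f; case: xgetP => [y _ [Sy gy]|/(_ s)[]//].
  by apply: gi; rewrite ?inE.
have /choice[mu hmu] : forall n, exists a : R,
    T (f n) = a%:C *: f n /\ (f n = 0 -> a = 0).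
  move=> n; have [[Sf _]|f0] := fP n.
    have [a ha] := eS _ Sf; exists a; split=> // f0.
    by have := S1 _ Sf; rewrite f0 dot0l => /esym/eqP; rewrite oner_eq0.
  by exists 0; have [lT _ _] := bT; rewrite f0 lin0// scaler0.
exists f, mu; split.
- split=> [n|m n mn]; first by have [[/S1]|] := fP n; [right|left].
  have [[Sm gm]|->] := fP m; last by rewrite dot0l.
  have [[Sn gn]|->] := fP n; last by rewrite dot0r.
  by apply: So => // fmn; apply: mn; rewrite -gm fmn gn.
- by move=> x hx; apply: Stot => s Ss; rewrite -(fg s Ss) hx.
- by move=> n; have [] := hmu n.
- by move=> n; have [] := hmu n.
Qed.

(** The eigenvectors of the zero operator form an orthonormal basis. *)
Lemma onb_spec : separable_space H -> ons (onb dot) /\ total_sys (onb dot).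
Proof.
move=> sepH.
have b0 : bnd (fun=> 0) 0.
  by split=> // [a x y|x]; rewrite ?scaler0 ?addr0// nrm0 mul0r.
have oe : ons (fun=> 0) by split=> [n|m n _]; [left|rewrite dot0l].
have [||f [_ [of_ tf _ _]]] := @spectral (fun=> 0) (fun=> 0) 0 sepH b0 _ oe.
- by move=> x y; rewrite dot0l dot0r.
- by move=> eps e0; exists 0%N => y _; rewrite nrm0 mulr_ge0 ?nrm_ge0// ltW.
have : orthonormal_basis dot (onb dot).
  rewrite /onb; case: xgetP => [y _ //|/(_ f)[]].
  by split; [exact: of_.1|exact: of_.2|exact: tf].
by move=> [h1 h2 h3]; split.
Qed.

Lemma absop_spec T : separable_space H -> bounded_op T ->
  is_absop dot T (absop dot T).
Proof.
move=> sepH /(boundedP dot_norm)[M bT]; have [oe te] := onb_spec sepH.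
have [P hP] := absop_exists dot_norm oe te bT.
by rewrite /absop; case: xgetP => [//|/(_ P)[]].
Qed.

End Spectral.

(** * Diagonalizable trace-class operators *)

Section RealPart.
Context {R : realType}.
Implicit Types z w : R[i].

(** The real part for [b = true], the imaginary part for [b = false]: complex
    identities below are pairs of real ones. *)
Definition rpart (b : bool) z : R := if b then complex.Re z else complex.Im z.

Lemma rpartD b z w : rpart b (z + w) = rpart b z + rpart b w.
Proof. by case: b; rewrite /rpart ?ReD ?ImD. Qed.

Lemma rpartZ b (x : R) z : rpart b (x%:C * z) = x * rpart b z.
Proof. by case: b; rewrite /rpart ?ReZ ?ImZ. Qed.

Lemma rpart_sum b I (r : seq I) (P : pred I) (F : I -> R[i]) :
  rpart b (\sum_(i <- r | P i) F i) = \sum_(i <- r | P i) rpart b (F i).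
Proof. by case: b; rewrite /rpart ?Re_sum ?Im_sum. Qed.

Lemma rpart_le b z : `|rpart b z| <= cabs z.
Proof. by case: b; rewrite /rpart ?Re_le_cabs ?Im_le_cabs. Qed.

Lemma ccvg_rpart b (u : nat -> R[i]) l :
  ccvg u l -> (fun n => rpart b (u n)) @ \oo --> rpart b l.
Proof. by move=> /ccvgP[h1 h2]; case: b. Qed.

Lemma nneseries_asum (u : nat -> R) : (forall n, 0 <= u n) ->
  (\sum_(0 <= n <oo) (u n)%:E < +oo)%E -> asum u.
Proof.
move=> u0 uoo; have h n : (0 <= n)%N -> predT n -> (0%E <= (u n)%:E)%E by rewrite lee_fin.
have fin : (\sum_(0 <= n <oo) (u n)%:E)%E \is a fin_num.
  by rewrite ge0_fin_numE// nneseries_ge0// => n _ _; rewrite lee_fin.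
exists (fine (\sum_(0 <= n <oo) (u n)%:E)%E) => N.
rewrite -lee_fin fineK// -sumEFin.
under eq_bigr do rewrite ger0_norm//.
have := @nneseries_lim_ge R (fun n => (u n)%:E) predT 0 N h.
by rewrite big_mkord.
Qed.

Lemma nneseries_rsum (u : nat -> R) : (forall n, 0 <= u n) -> asum u ->
  (\sum_(0 <= n <oo) (u n)%:E)%E = (rsum u)%:E.
Proof.
move=> u0 su; rewrite /rsum -EFin_lim; last exact: cvgP (rsum_cvg su).
by congr (limn _); apply/funext => n /=; rewrite sumEFin.
Qed.

End RealPart.

Section TraceNorm.
Context {R : realType} {H : completeNormedModType R[i]}.
Context {dot : {dot H for @conjc R}} (dot_norm : induces_norm dot).
Context (sepH : separable_space H).
Implicit Types (x y z : H) (T S P A B : H -> H).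
Local Notation nrm := (@nrm R H dot).
Local Notation hcvg := (@hcvg R H dot).
Local Notation ons := (@ons R H dot).
Local Notation total_sys := (@total_sys R H dot).
Local Notation psum := (@psum R H dot).
Local Notation bnd := (@bnd R H dot).
Local Notation pos := (@pos R H dot).
Local Notation tail_small := (@tail_small R H dot).
Local Notation e := (onb dot).

Let oe : ons e. Proof. by have [] := onb_spec dot_norm sepH. Qed.
Let te : total_sys e. Proof. by have [] := onb_spec dot_norm sepH. Qed.

Lemma lin_psum T f x N : linear T ->
  T (psum f x N) = \sum_(i < N) dot x (f i) *: T (f i).
Proof. by move=> lT; rewrite lin_sum//; apply: eq_bigr => i _; rewrite linZ. Qed.

Lemma absop_bnd T : bounded_op T -> exists M, bnd (absop dot T) M.
Proof. by move=> /(absop_spec dot_norm sepH)[[/(boundedP dot_norm)[M hM] _] _]; exists M. Qed.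

Lemma absop_pos T : bounded_op T -> pos (absop dot T).
Proof. by move=> /(absop_spec dot_norm sepH)[[_ h] _]. Qed.

Lemma absop_nrm T x : bounded_op T -> nrm (absop dot T x) = nrm (T x).
Proof.
move=> bT; have [[/(boundedP dot_norm)[M [lP _ _]] pP] [S TS PP]] := absop_spec dot_norm sepH bT.
rewrite /nrm -(pos_self lP pP).
by rewrite -[absop dot T (absop dot T x)]/((absop dot T \o absop dot T) x) PP /= (adjoint_sym TS).
Qed.

(** The vector [w = absop T v - `|a| *: v] satisfies [absop T w = - `|a| *: w],
    which positivity allows only for [w = 0]. *)
Lemma absop_eigen T v (a : R) : bounded_op T -> is_adjoint dot T T ->
  T v = a%:C *: v -> absop dot T v = `|a|%:C *: v.
Proof.
move=> bT sT Tv; have [[/(boundedP dot_norm)[M [lP _ _]] pP] [S TS PP]] := absop_spec dot_norm sepH bT.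
apply/subr0_eq; set P := absop dot T in lP pP PP *.
have [N [lT _ _]] := (boundedP dot_norm T).1 bT.
have [a0|an] := eqVneq a 0.
  apply: (nrm_eq0 dot_norm); rewrite a0 normr0 scale0r subr0.
  by rewrite /P absop_nrm// Tv a0 scale0r nrm0.
have ST z : S z = T z by apply: (dot_extr dot_norm) => x; rewrite -TS sT.
have PPv : P (P v) = (`|a| ^+ 2)%:C *: v.
  rewrite -[P (P v)]/((P \o P) v) PP /= ST Tv (linZ lT) Tv scalerA -rmorphM.
  by rewrite real_normK ?num_real.
set w := P v - _.
have Pw : P w = - (`|a|%:C *: w).
  rewrite /w (linB lP) (linZ lP) PPv scalerBr scalerA -rmorphM opprB.
  by rewrite expr2.
have := pos_re_ge0 w pP; rewrite Pw dotNl dotZl ReN ReZ dotE /= oppr_ge0 => h.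
apply: (nrm_eq0 dot_norm); apply/eqP; rewrite -sqrf_eq0.
have a0 : 0 < `|a| by rewrite normr_gt0.
by rewrite eq_le sqr_ge0 andbT -(pmulr_rle0 _ a0).
Qed.

Definition absdiag T n : R := complex.Re (dot (absop dot T (e n)) (e n)).

Lemma absdiag_ge0 T n : bounded_op T -> 0 <= absdiag T n.
Proof. by move=> bT; apply: pos_re_ge0; exact: absop_pos. Qed.

Lemma trace_norm_fin T : bounded_op T -> (trace_norm dot T < +oo)%E ->
  asum (absdiag T) /\ trace_norm dot T = (rsum (absdiag T))%:E.
Proof.
move=> bT h; have h0 n := absdiag_ge0 n bT.
have su : asum (absdiag T) by exact: nneseries_asum.
by split=> //; exact: nneseries_rsum.
Qed.

(** In the expansion of [dot (P y) y] each term is bounded by Cauchy-Schwarz for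
    the form of [P], and the product is split with weight [tau]: the
    coordinates of [y] give [tau * nrm y ^+ 2] and the diagonal of [P] gives
    back a multiple of [dot (P y) y] that is absorbed. *)
Lemma pos_tail P M N (tau : R) y : bnd P M -> pos P ->
  let p n := complex.Re (dot (P (e n)) (e n)) in asum p ->
  0 < tau -> rsum (fun n => if (n < N)%N then 0 else p n) <= tau ->
  (forall n, (n < N)%N -> dot y (e n) = 0) ->
  complex.Re (dot (P y) y) <= tau * nrm y ^+ 2.
Proof.
move=> bP pP p sp t0 ptau yN; set g := complex.Re _; have [lP _ _] := bP.
have g0 : 0 <= g by exact: pos_re_ge0.
have p0 n : 0 <= p n by exact: pos_re_ge0.
suff h : g <= 2^-1 * (tau * nrm y ^+ 2 + g) by lra.
have /ccvgP[hr _] := hcvg_dot dot_norm y (bnd_hcvg bP (total_expand dot_norm y oe te)).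
apply: (ler_cvg_to hr (cvg_cst _)); apply: nearW => K.
rewrite lin_psum// dot_suml Re_sum.
pose q n := if (n < N)%N then 0 else p n.
pose F (i : 'I_K) := 2^-1 * (tau * cabs (dot y (e i)) ^+ 2 + q i * (g / tau)).
apply: (@le_trans _ _ (\sum_(i < K) F i)).
  apply: ler_sum => i _; rewrite dotZl /F /q; case: ifP => iN.
    by rewrite yN// mul0r cabs0 expr0n /= mulr0 add0r mul0r mulr0.
  apply: le_trans (ler_norm _) _; apply: le_trans (Re_le_cabs _) _; rewrite cabsM.
  have := pos_cauchy_schwarz (e i) y lP pP; rewrite -/(p i) -/g.
  set d := cabs _; set c := cabs _ => hd.
  have hd' : d ^+ 2 / tau <= p i * (g / tau) by rewrite mulrA; apply: ler_wpM2r; rewrite ?invr_ge0 ?(ltW t0).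
  apply: (@le_trans _ _ (2^-1 * (tau * c ^+ 2 + d ^+ 2 / tau))); last by lra.
  have : 0 <= tau * (c - d / tau) ^+ 2 by rewrite mulr_ge0 ?sqr_ge0// ltW.
  have -> : tau * (c - d / tau) ^+ 2 = tau * c ^+ 2 + d ^+ 2 / tau - 2 * (c * d).
    by field; rewrite gt_eqF.
  by lra.
rewrite /F -mulr_sumr; apply: ler_wpM2l; rewrite ?invr_ge0// big_split /= -mulr_sumr -mulr_suml.
apply: lerD; first by apply: (ler_wpM2l (ltW t0)); exact: bessel.
have q0 n : 0 <= q n by rewrite /q; case: ifP.
have sq : asum q by exact: asum_ifn.
have := le_trans (rsum_part K sq q0) ptau => hq.
have gt : 0 <= g / tau by rewrite divr_ge0// ltW.
apply: le_trans (ler_wpM2r gt hq) _.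
by rewrite mulrCA divff ?mulr1// gt_eqF.
Qed.

Lemma trace_norm_tail_small T : bounded_op T -> (trace_norm dot T < +oo)%E ->
  tail_small e T.
Proof.
move=> bT /(trace_norm_fin bT)[sp _] eps e0.
have [M bP] := absop_bnd bT; have pP := absop_pos bT; have [lP M0 _] := bP.
pose tau := eps ^+ 2 / (M + 1).
have M1 : 0 < M + 1 by rewrite ltr_wpDl.
have t0 : 0 < tau by rewrite divr_gt0// exprn_gt0.
have [N hN] := rsum_tail_lt sp t0; exists N => y yN.
rewrite -absop_nrm// -ler_sqr ?nnegrE ?nrm_ge0 ?mulr_ge0 ?nrm_ge0 ?(ltW e0)//.
apply: le_trans (pos_apply dot_norm y bP pP) _.
have ht : rsum (fun n => if (n < N)%N then 0 else absdiag T n) <= tau.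
  apply/ltW; apply: le_lt_trans hN; apply: rsum_le => [||n].
  - exact: asum_ifn.
  - exact/asum_ifn/asum_norm.
  - by case: ifP => // _; exact: ler_norm.
have h := pos_tail bP pP sp t0 ht yN.
apply: le_trans (ler_wpM2l M0 h) _.
rewrite mulrA exprMn ler_wpM2r ?sqr_ge0// /tau mulrCA -[leRHS]mulr1.
by rewrite ler_wpM2l ?sqr_ge0// ler_pdivrMr// mul1r lerDl.
Qed.

Lemma trace_norm_ge T (t : R) y : bounded_op T -> 0 < t ->
  (trace_norm dot T <= t%:E)%E -> nrm (T y) <= t * nrm y.
Proof.
move=> bT t0 ht; have [|sp tE] := trace_norm_fin bT.
  by apply: le_lt_trans ht _; rewrite ltry.
have [M bP] := absop_bnd bT; have pP := absop_pos bT; have [lP M0 _] := bP.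
have ht0 : rsum (fun n => if (n < 0)%N then 0 else absdiag T n) <= t.
  by move: ht; rewrite tE lee_fin.
have h z : complex.Re (dot (absop dot T z) z) <= t * nrm z ^+ 2.
  by have := @pos_tail _ _ 0%N _ z bP pP sp t0 ht0; apply.
rewrite -absop_nrm//; set P := absop dot T in lP pP bP h *.
have := pos_cauchy_schwarz y (P y) lP pP.
rewrite dotE cabsR ger0_norm ?sqr_ge0// => h1.
have := le_trans h1 (ler_pM (pos_re_ge0 y pP) (pos_re_ge0 (P y) pP) (h y) (h (P y))).
set n := nrm (P y); have n0 : 0 <= n by exact: nrm_ge0.
have [->|nz] := eqVneq n 0; first by rewrite mulr_ge0 ?nrm_ge0// ltW.
have np : 0 < n ^+ 2 by rewrite exprn_gt0// lt_def nz.
rewrite (expr2 (n ^+ 2)) [leRHS]mulrA ler_pM2r// => h2.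
rewrite -ler_sqr ?nnegrE ?mulr_ge0 ?nrm_ge0 ?(ltW t0)//.
by apply: le_trans h2 _; rewrite exprMn; lra.
Qed.

(** [T] is the sum of the [mu n] times the projections onto the [f n]. *)
Definition diag_op T (mu : nat -> R) (f : nat -> H) : Prop :=
  [/\ exists M, bnd T M, ons f, forall n, T (f n) = (mu n)%:C *: f n,
      forall n, f n = 0 -> mu n = 0 &
      forall x, (forall n, dot x (f n) = 0) -> T x = 0].

Lemma ons_nrm_neq0 f n : ons f -> f n <> 0 -> nrm (f n) = 1.
Proof. by move=> of_ fn; apply: dot1_nrm; exact: ons_unit. Qed.

(** On [x] the absolute value of [T] is at least its compression to the span of
    finitely many [f k]; sum over the basis in which the trace norm is
    computed. *)
Lemma trace_norm_lower T mu f : bounded_op T -> is_adjoint dot T T ->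
  (trace_norm dot T < +oo)%E -> ons f ->
  (forall n, T (f n) = (mu n)%:C *: f n) -> (forall n, f n = 0 -> mu n = 0) ->
  asum mu /\ ((rsum (fun n => `|mu n|))%:E <= trace_norm dot T)%E.
Proof.
move=> bT sT fin of_ Tf f0; have [sp tE] := trace_norm_fin bT fin.
have [M bP] := absop_bnd bT; have pP := absop_pos bT; have [lP M0 _] := bP.
set P := absop dot T in bP pP lP.
have Pf n : P (f n) = `|mu n|%:C *: f n by exact: absop_eigen.
have low x N : \sum_(k < N) `|mu k| * cabs (dot x (f k)) ^+ 2 <= complex.Re (dot (P x) x).
  pose s := psum f x N.
  have [y xy ys] : exists2 y, x = s + y & dot y (P s) = 0.
    exists (x - s); first by rewrite addrC subrK.
    rewrite /s (lin_psum _ _ _ lP) dot_sumr big1// => i _.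
    by rewrite dotZr Pf dotRr psum_ortho// !mulr0.
  have -> : dot (P x) x = dot (P (s + y)) (s + y) by rewrite -xy.
  rewrite (linD lP) dotDl !dotDr !ReD (pos_self lP pP y s) ys.
  rewrite [dot (P s) y]dotC ys /= addr0 add0r.
  rewrite -[leLHS]addr0 lerD ?pos_re_ge0//.
  rewrite {1}/s (lin_psum _ _ _ lP) dot_suml Re_sum; apply: ler_sum => i _.
  rewrite Pf dotZl dotZl [X in complex.Re X]mulrCA ReZ (dotC (f i)).
  by rewrite (dot_comb (fun i => dot x (f i)))// ltn_ord ons_mul// mulJc.
have part N : \sum_(k < N) `|mu k| <= rsum (absdiag T).
  pose F K := \sum_(k < N) `|mu k| * \sum_(n < K) cabs (dot (e n) (f k)) ^+ 2.
  have hF : F @ \oo --> \sum_(k < N) `|mu k|.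
    apply: (@cvg_sum_ord _ N 
      (fun k K => `|mu k| * \sum_(n < K) cabs (dot (e n) (f k)) ^+ 2) (fun k => `|mu k|)) => k.
    have [fk|fk] := pselect (f k = 0).
      by rewrite (f0 _ fk) normr0; under eq_fun do rewrite mul0r; exact: cvg_cst.
    rewrite -[X in _ --> X]mulr1; apply: cvgMr.
    have := @parseval_nrm _ _ _ dot_norm e (f k) oe te; rewrite (ons_nrm_neq0 of_ fk) expr1n.
    apply: cvg_trans; apply: near_eq_cvg; apply: nearW => K.
    by apply: eq_bigr => i _; rewrite cabs_dotC.
  apply: (ler_cvg_to hF (cvg_cst _)); apply: nearW => K.
  apply: le_trans (rsum_part K sp (fun n => absdiag_ge0 n bT)).
  rewrite /F; under eq_bigr do rewrite mulr_sumr.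
  by rewrite exchange_big /=; apply: ler_sum => n _; exact: low.
have smu : asum mu by exists (rsum (absdiag T)).
split=> //; rewrite tE lee_fin; apply: rsum_ub => //; exact: asum_norm.
Qed.

Section Diagonal.
Variables (T : H -> H) (mu : nat -> R) (f : nat -> H).
Hypotheses (dT : diag_op T mu f) (smu : asum mu).

Lemma diag_expand x y :
  ccvg (fun N => \sum_(k < N) (mu k)%:C * (dot x (f k) * dot (f k) y)) (dot (T x) y).
Proof.
have [[M bT] of_ Tf _ Tk] := dT; have [lT _ _] := bT.
have [p [hp xp]] := ons_proj dot_norm x of_.
have -> : T x = T p by apply/subr0_eq; rewrite -linB// Tk.
have := hcvg_dot dot_norm y (bnd_hcvg bT hp); congr ccvg; apply/funext => N.
rewrite (lin_psum _ _ _ lT) dot_suml; apply: eq_bigr => i _.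
by rewrite Tf !dotZl mulrCA.
Qed.

Lemma diag_re x : complex.Re (dot (T x) x) =
    rsum (fun k => mu k * cabs (dot x (f k)) ^+ 2) /\
  asum (fun k => mu k * cabs (dot x (f k)) ^+ 2).
Proof.
have [_ of_ _ _ _] := dT; split; last first.
  apply: (@asumM _ _ _ (nrm x ^+ 2)) => // n.
  rewrite ger0_norm ?sqr_ge0// ler_sqr ?nnegrE ?cabs_ge0 ?nrm_ge0//.
  apply: le_trans (cauchy_schwarz dot_norm _ _) _.
  by rewrite ler_piMr ?nrm_ge0// (ons_nrm n of_).
symmetry; apply: rsum_unique; have /ccvgP[h _] := diag_expand x x.
apply: cvg_trans h; apply: near_eq_cvg; apply: nearW => N.
by rewrite Re_sum; apply: eq_bigr => i _; rewrite ReZ (dotC (f i)) mulJc.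
Qed.

Lemma diag_adjoint : is_adjoint dot T T.
Proof.
move=> x y; rewrite [RHS]dotC; apply: ccvg_unique (diag_expand x y) _.
have := ccvgJ (diag_expand y x); congr ccvg; apply/funext => N.
rewrite rmorph_sum; apply: eq_bigr => i _; rewrite !rmorphM /= -!dotC mulrC.
by rewrite [RHS]mulrC; congr (_ * _); [rewrite mulrC|rewrite /= oppr0].
Qed.

(** The matrix of the [cabs (dot (g n) (f k)) ^+ 2] is doubly substochastic, by
    Bessel's inequality for [g] and for [f]. *)
Lemma diag_compress (g : nat -> H) (chi : nat -> R) N : ons g ->
  (forall n, `|chi n| <= 1) ->
  let theta k := \sum_(n < N) chi n * cabs (dot (g n) (f k)) ^+ 2 in
  [/\ \sum_(n < N) chi n * complex.Re (dot (T (g n)) (g n)) = rsum (fun k => mu k * theta k),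
      forall k, `|theta k| <= 1 &
      forall K, \sum_(k < K) `|theta k| <= \sum_(n < N) `|chi n|].
Proof.
move=> og chi1 theta; have [_ of_ _ _ _] := dT.
have absth k : `|theta k| <= \sum_(n < N) `|chi n| * cabs (dot (g n) (f k)) ^+ 2.
  apply: le_trans (ler_norm_sum _ _ _) _; apply: ler_sum => n _.
  by rewrite normrM [`|_ ^+ 2|]ger0_norm ?sqr_ge0.
split.
- pose a n k := chi n * (mu k * cabs (dot (g n) (f k)) ^+ 2).
  have sa n : asum (a n) by apply: asumZ; have [] := diag_re (g n).
  transitivity (\sum_(n < N) rsum (a n)).
    by apply: eq_bigr => n _; have [-> s] := diag_re (g n); rewrite -rsumZ.
  have [<- _] := rsum_sum N sa; apply: rsum_ext => k.
  by rewrite /theta mulr_sumr; apply: eq_bigr => n _; rewrite /a mulrCA.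
- move=> k; apply: le_trans (absth k) _.
  have := bessel (f k) N og.
  have := ons_nrm k of_; have := nrm_ge0 (dot := dot) (f k) => n0 n1 h.
  apply: (@le_trans _ _ (\sum_(n < N) cabs (dot (f k) (g n)) ^+ 2)).
    by apply: ler_sum => n _; rewrite cabs_dotC ler_piMl ?sqr_ge0.
  by apply: le_trans h _; rewrite expr_le1.
- move=> K; apply: (@le_trans _ _
    (\sum_(k < K) \sum_(n < N) `|chi n| * cabs (dot (g n) (f k)) ^+ 2)).
    by apply: ler_sum => k _; exact: absth.
  rewrite exchange_big /=; apply: ler_sum => n _; rewrite -mulr_sumr.
  rewrite ler_piMr//; apply: le_trans (bessel _ K of_) _.
  by rewrite expr_le1 ?nrm_ge0// (ons_nrm n og).
Qed.

Lemma diag_compress_le (g : nat -> H) (chi : nat -> R) N : ons g ->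
  (forall n, `|chi n| <= 1) ->
  `|\sum_(n < N) chi n * complex.Re (dot (T (g n)) (g n))| <= rsum (fun k => `|mu k|).
Proof.
move=> og chi1; have [-> t1 _] := diag_compress N og chi1.
apply: le_trans (rsum_norm (asumM smu t1)) _; apply: rsum_le => [||k].
- exact/asum_norm/(asumM smu t1).
- exact: asum_norm.
- by rewrite normrM ler_piMr.
Qed.

Lemma diag_rpart b x y : rpart b (dot (T x) y) =
    rsum (fun k => mu k * rpart b (dot x (f k) * dot (f k) y)) /\
  asum (fun k => mu k * rpart b (dot x (f k) * dot (f k) y)).
Proof.
have [_ of_ _ _ _] := dT; split; last first.
  apply: (@asumM _ _ _ (nrm x * nrm y)) => // n.
  apply: le_trans (rpart_le _ _) _; rewrite cabsM.
  have h1 := le_trans (cauchy_schwarz dot_norm x (f n)) (ler_piMr (nrm_ge0 x) (ons_nrm n of_)).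
  have h2 := le_trans (cauchy_schwarz dot_norm (f n) y) (ler_piMl (nrm_ge0 y) (ons_nrm n of_)).
  by apply: ler_pM; rewrite ?cabs_ge0.
symmetry; apply: rsum_unique; have h := @ccvg_rpart _ b _ _ (diag_expand x y).
apply: cvg_trans h; apply: near_eq_cvg; apply: nearW => N.
by rewrite rpart_sum; apply: eq_bigr => i _; rewrite rpartZ.
Qed.

(** Independence of the trace from the basis: both sides are a double sum
    over [f] and [g], and Parseval evaluates it either way. *)
Lemma diag_trace (g : nat -> H) B M b : bnd B M -> ons g -> total_sys g ->
  asum (fun n => mu n * rpart b (dot (B (f n)) (f n))) /\
  (fun K => rpart b (\sum_(k < K) dot (T (B (g k))) (g k))) @ \oo -->
    rsum (fun n => mu n * rpart b (dot (B (f n)) (f n))).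
Proof.
move=> bB og tg; have [_ of_ _ _ _] := dT.
have [B' BB'] := adjoint_exists dot_norm oe te bB.
have [_ M0 hB'] := adjoint_bnd dot_norm bB BB'.
pose v n K := mu n * rpart b (\sum_(k < K) dot (f n) (g k) * dot (g k) (B' (f n))).
have vE K : rpart b (\sum_(k < K) dot (T (B (g k))) (g k)) = rsum (fun n => v n K).
  pose a k n := mu n * rpart b (dot (B (g k)) (f n) * dot (f n) (g k)).
  rewrite rpart_sum (eq_bigr (fun k : 'I_K => rsum (a k))); last first.
    by move=> k _; have [-> _] := diag_rpart b (B (g k)) (g k).
  have [|<- _] := @rsum_sum _ K a.
    by move=> k; have [] := diag_rpart b (B (g k)) (g k).
  apply: rsum_ext => n; rewrite /v /a -mulr_sumr -rpart_sum; congr (_ * rpart _ _).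
  by apply: eq_bigr => k _; rewrite BB' mulrC.
have -> := funext vE.
apply: (@tannery _ v (fun n => M * `|mu n|)).
- exact/asumZ/asum_norm.
- move=> n K; rewrite /v normrM mulrC ler_wpM2r//.
  apply: le_trans (rpart_le _ _) _; apply: le_trans (cabs_sum _ _ _) _.
  under eq_bigr do rewrite cabsM [cabs (dot (g _) _)]cabs_dotC.
  apply: le_trans (bessel_mul dot_norm _ _ K og) _.
  have := hB' (f n); have := ons_nrm n of_.
  have := nrm_ge0 (dot := dot) (f n); set t := nrm (f n); set r := nrm _.
  have := nrm_ge0 (dot := dot) (B' (f n)); rewrite -/r.
  by move=> r0 t0 t1 rt; nra.
- move=> n; apply: cvgMr; rewrite BB'.
  exact: (@ccvg_rpart _ b _ _ (parseval dot_norm (f n) (B' (f n)) og tg)).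
Qed.

End Diagonal.

(** The absolute value of [T] is diagonal in the same system, with eigenvalues
    [`|mu n|]. *)
Lemma diag_trace_norm_le T mu f : diag_op T mu f -> asum mu ->
  (trace_norm dot T <= (rsum (fun n => `|mu n|))%:E)%E.
Proof.
move=> dT smu; have [[M bT0] of_ Tf f0 Tk] := dT.
have bT : bounded_op T by apply/(boundedP dot_norm); exists M.
have dP : diag_op (absop dot T) (fun n => `|mu n|) f.
  split=> //; first exact: absop_bnd.
  - by move=> n; apply: absop_eigen => //; exact: diag_adjoint dT.
  - by move=> n /f0 ->; rewrite normr0.
  - by move=> x /Tk Tx; apply: (nrm_eq0 dot_norm); rewrite absop_nrm// Tx nrm0.
have sa := asum_norm smu.
have hK K : \sum_(n < K) absdiag T n <= rsum (fun n => `|mu n|).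
  have := @diag_compress_le _ _ _ dP sa e (fun=> 1) K oe.
  rewrite [rsum (fun k => `| `|mu k| |)](@rsum_ext _ _ (fun n => `|mu n|)); last first.
    by move=> n; rewrite normr_id.
  under eq_bigr do rewrite mul1r.
  by move=> h; apply: le_trans (ler_norm _) (h _) => n; rewrite normr1.
have sp : asum (absdiag T).
  exists (rsum (fun n => `|mu n|)) => K; apply: le_trans (hK K).
  by apply: ler_sum => i _; rewrite ger0_norm ?absdiag_ge0.
rewrite /trace_norm (nneseries_rsum (fun n => absdiag_ge0 n bT) sp) lee_fin.
exact: rsum_ub.
Qed.

Lemma diag_exists mu f : ons f -> asum mu -> (forall n, f n = 0 -> mu n = 0) ->
  exists T, diag_op T mu f.
Proof.
move=> of_ smu f0; pose S := rsum (fun n => `|mu n|).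
have S0 : 0 <= S by apply: rsum_ge0 => //; exact: asum_norm.
have muS n : `|mu n| <= S by apply: (@rsum_term _ (fun n => `|mu n|)) => //; exact: asum_norm.
pose c x k := (mu k)%:C * dot x (f k).
have cS x k : cabs (c x k) ^+ 2 <= S ^+ 2 * cabs (dot x (f k)) ^+ 2.
  rewrite /c cabsM cabsR -exprMn ler_sqr ?nnegrE ?mulr_ge0 ?cabs_ge0//.
  by rewrite ler_wpM2r ?cabs_ge0.
have sc x : asum (fun k => cabs (c x k) ^+ 2).
  apply: asum_le (asumZ (S ^+ 2) (bessel_asum x of_)) _ => n.
  by rewrite ger0_norm ?sqr_ge0//; apply: le_trans (cS x n) (ler_norm _).
have /choice[T hT] : forall x, exists l, hcvg (fun N => \sum_(k < N) c x k *: f k) l.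
  by move=> x; exact: ons_cvg.
have lT : linear T.
  move=> a x y; apply: (hcvg_unique dot_norm (hT _)).
  have := hcvgD dot_norm (hcvgZ dot_norm a (hT x)) (hT y); congr hcvg.
  apply/funext => N; rewrite scaler_sumr -big_split /=; apply: eq_bigr => i _.
  by rewrite scalerA -scalerDl /c dotDl dotZl mulrDr mulrCA.
exists T; split=> //.
- exists S; split=> // x.
  apply: (ler_cvg_to (hcvg_nrm dot_norm (hT x)) (cvg_cst _)); apply: nearW => N.
  rewrite -ler_sqr ?nnegrE ?nrm_ge0 ?mulr_ge0 ?nrm_ge0// exprMn.
  have := ons_comb_sqr dot_norm (c x) 0 N of_; rewrite !big_mkord => /le_trans; apply.
  apply: (@le_trans _ _ (\sum_(k < N) S ^+ 2 * cabs (dot x (f k)) ^+ 2)).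
    by apply: ler_sum => k _; exact: cS.
  by rewrite -mulr_sumr ler_wpM2l ?sqr_ge0 ?bessel.
- move=> n; apply: (hcvg_unique dot_norm (hcvg_shift n.+1 (hT (f n)))).
  have := @hcvg_cst _ _ dot ((mu n)%:C *: f n); congr hcvg; apply/funext => N.
  have nN : (n < N + n.+1)%N by rewrite addnS ltnS leq_addl.
  rewrite (bigD1 (Ordinal nN))//= big1 ?addr0 => [|i].
    have [-> |fn] := pselect (f n = 0); first by rewrite !scaler0.
    by rewrite /c (ons_unit of_ fn) mulr1.
  rewrite -val_eqE /= => /eqP ni.
  by rewrite /c of_.2 ?mulr0 ?scale0r//; apply/eqP; rewrite eq_sym; apply/eqP.
- move=> x xf; apply: (hcvg_unique dot_norm (hT x)).
  have := @hcvg_cst _ _ dot 0; congr hcvg; apply/funext => N.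
  by rewrite big1// => i _; rewrite /c xf mulr0 scale0r.
Qed.

Lemma unitary_dot U V x y : unitary_with_adjoint dot U V -> dot (U x) (U y) = dot x y.
Proof. by move=> [_ UV _ VU]; rewrite UV -[V (U y)]/((V \o U) y) VU. Qed.

Lemma unitary_conj U V T mu f : unitary_with_adjoint dot U V -> diag_op T mu f ->
  diag_op (U \o T \o V) mu (U \o f).
Proof.
move=> hU; have [/(boundedP dot_norm)[M bU] UV UVid VUid] := hU.
move=> [[M' bT] of_ Tf f0 Tk]; have [lU _ _] := bU.
have VU x : V (U x) = x by rewrite -[V (U x)]/((V \o U) x) VUid.
have bV := adjoint_bnd dot_norm bU UV.
split.
- by eexists; exact: bnd_comp (bnd_comp bU bT) bV.
- split=> [n|m n mn] /=; last by rewrite (unitary_dot _ _ hU) of_.2.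
  by rewrite (unitary_dot _ _ hU); case: (of_.1 n) => [->|]; [left; rewrite lin0|right].
- by move=> n /=; rewrite VU Tf linZ.
- by move=> n /= h; apply: f0; rewrite -(VU (f n)) h; have [lV _ _] := bV; rewrite lin0.
- move=> x h /=; rewrite Tk ?lin0// => n.
  by rewrite (adjoint_sym UV) h.
Qed.

Lemma tail_small_sub g T S M N : bnd T M -> bnd S N ->
  tail_small g T -> tail_small g S -> tail_small g (fun x => T x - S x).
Proof.
move=> bT bS tT tS eps e0; have e2 : 0 < eps / 2 by rewrite divr_gt0.
have [K hK] := tT _ e2; have [L hL] := tS _ e2; exists (maxn K L) => y hy.
apply: le_trans (nrmB dot_norm _ _) _.
have h1 : nrm (T y) <= eps / 2 * nrm y.
  by apply: hK => n nK; apply: hy; rewrite leq_max nK.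
have h2 : nrm (S y) <= eps / 2 * nrm y.
  by apply: hL => n nL; apply: hy; rewrite leq_max nL orbT.
by lra.
Qed.

Lemma diag_tail_small T mu f : diag_op T mu f -> asum mu -> tail_small e T.
Proof.
move=> dT smu; have [[M bT] _ _ _ _] := dT.
apply: trace_norm_tail_small; first by apply/(boundedP dot_norm); exists M.
by apply: le_lt_trans (diag_trace_norm_le dT smu) _; rewrite ltry.
Qed.

(** Diagonalize [X - Y] by [v] with eigenvalues [t].  Each [`|t k|] is a sum over
    [n] of [mu n] times the difference of the squared coordinates of [v k] at
    [f n] and [g n]; the hypothesis removes the terms with [n < N], and for
    the other [n] Bessel's inequality bounds the sum over [k] by [2]. *)
Lemma diag_close X Y mu f g N : diag_op X mu f -> diag_op Y mu g -> asum mu ->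
  (forall n x, (n < N)%N -> mu n != 0 -> cabs (dot x (f n)) = cabs (dot x (g n))) ->
  (trace_norm dot (X \- Y)%R <=
     (2 * rsum (fun n => if (n < N)%N then 0 else `|mu n|))%:E)%E.
Proof.
move=> dX dY smu fg; have [[M bX] of_ _ _ _] := dX; have [[M' bY] og _ _ _] := dY.
set T := (X \- Y)%R.
have bT : bnd T (M + M') by exact: bnd_sub.
have sT : is_adjoint dot T T.
  by move=> x y; rewrite /T dotBl dotBr (diag_adjoint dX) (diag_adjoint dY).
have tT : tail_small e T.
  exact: tail_small_sub bX bY (diag_tail_small dX smu) (diag_tail_small dY smu).
have [v [t [ov tv Tv v0]]] := spectral dot_norm sepH bT sT oe tT.
have dT : diag_op T t v.
  split=> //; first by exists (M + M').
  by move=> x /tv ->; have [lT _ _] := bT; rewrite (lin0 lT).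
pose w n := if (n < N)%N then 0 else `|mu n|.
have sw : asum w by exact/asum_ifn/asum_norm.
have part K : \sum_(k < K) `|t k| <= 2 * rsum w.
  pose a k n := mu n * (Num.sg (t k) * (cabs (dot (v k) (f n)) ^+ 2 - cabs (dot (v k) (g n)) ^+ 2)).
  have ta k : `|t k| = rsum (a k) /\ asum (a k).
    have [eX sX] := diag_re dX smu (v k); have [eY sY] := diag_re dY smu (v k).
    have sd := asumB sX sY.
    have -> : a k = fun n => Num.sg (t k) *
        (mu n * cabs (dot (v k) (f n)) ^+ 2 - mu n * cabs (dot (v k) (g n)) ^+ 2).
      by apply/funext => n; rewrite /a -mulrBr mulrCA.
    split; last exact: asumZ.
    rewrite rsumZ// rsumB// -eX -eY -ReN -ReD -dotBl -[X (v k) - Y (v k)]/(T (v k)).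
    rewrite Tv dotZl ReZ mulrA -normrEsg.
    have [vk|vk] := pselect (v k = 0); first by rewrite (v0 _ vk) normr0 mul0r.
    by rewrite dotE (ons_nrm_neq0 ov vk) expr1n /= mulr1.
  have sa k : asum (a k) by have [] := ta k.
  rewrite (eq_bigr (fun k : 'I_K => rsum (a k))); last by move=> k _; have [] := ta k.
  have [<- ss] := rsum_sum K sa.
  rewrite -rsumZ//; apply: rsum_le => //; first exact: asumZ.
  move=> n; rewrite /a -mulr_sumr /w; case: ifP => nN.
    have [->|mun] := eqVneq (mu n) 0; first by rewrite mul0r mulr0.
    by rewrite big1 ?mulr0// => k _; rewrite fg// subrr mulr0.
  apply: le_trans (ler_norm _) _; rewrite normrM mulrC ler_wpM2r//.
  apply: le_trans (ler_norm_sum _ _ _) _.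
  apply: (@le_trans _ _ (\sum_(k < K) (cabs (dot (f n) (v k)) ^+ 2 + cabs (dot (g n) (v k)) ^+ 2))).
    apply: ler_sum => k _; rewrite normrM.
    rewrite [cabs (dot (f n) _)]cabs_dotC [cabs (dot (g n) _)]cabs_dotC.
    have s1 : `|Num.sg (t k)| <= 1 by rewrite normr_sg lern1 leq_b1.
    apply: le_trans (ler_piMl (normr_ge0 _) s1) _.
    apply: le_trans (ler_normB _ _) _.
    by rewrite !ger0_norm ?sqr_ge0.
  rewrite big_split /=.
  have h1 := le_trans (bessel (f n) K ov) (_ : nrm (f n) ^+ 2 <= 1).
  have h2 := le_trans (bessel (g n) K ov) (_ : nrm (g n) ^+ 2 <= 1).
  apply: lerD; [apply: h1|apply: h2]; by rewrite expr_le1 ?nrm_ge0// (ons_nrm n).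
have st : asum t by exists (2 * rsum w).
apply: le_trans (diag_trace_norm_le dT st) _; rewrite lee_fin.
by apply: rsum_ub => //; exact: asum_norm.
Qed.

End TraceNorm.

(** * Spreading weights along orthonormal systems *)

Section Rotation.
Context {R : realType}.

(** Solving for a real value is one real linear equation for the phase [u], and
    the sign of [u] is free. *)
Lemma phase_real (g d : R[i]) : exists u : R[i],
  [/\ u * u^* = 1, complex.Im (u^* * g + u * d) = 0 & complex.Re (u^* * g + u * d) <= 0].
Proof.
suff [u [u1 uI]] : exists u : R[i], u * u^* = 1 /\ complex.Im (u^* * g + u * d) = 0.
  have [h|/ltW h] := leP (complex.Re (u^* * g + u * d)) 0; first by exists u.
  exists (- u); rewrite rmorphN mulrNN !mulNr -opprD ImN ReN uI oppr0 oppr_le0.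
  by split.
case: g d => [g1 g2] [h1 h2].
pose p := g2 + h2; pose r := h1 - g1; pose n2 := p ^+ 2 + r ^+ 2.
have [n0|nn] := eqVneq n2 0.
  exists 1; rewrite rmorph1 mulr1 !mul1r; split=> //=.
  have := sqr_ge0 p; have := sqr_ge0 r; move: n0; rewrite /n2 => h a b.
  have /eqP : p ^+ 2 = 0 by lra.
  by rewrite sqrf_eq0 => /eqP pz; exact: pz.
have np : 0 < n2 by rewrite lt_def nn addr_ge0 ?sqr_ge0.
pose n := Num.sqrt n2; have nE : n ^+ 2 = n2 by rewrite sqr_sqrtr ?ltW.
have n0 : n != 0 by rewrite sqrtr_eq0 -ltNge.
exists ((- r / n) +i* (p / n)); split; last by rewrite /= /p /r; field.
apply/eqP; rewrite eq_complex /=; apply/andP; split; apply/eqP; last by field.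
have -> : - r / n * (- r / n) - p / n * - (p / n) = n2 / n ^+ 2 by rewrite /n2; field.
by rewrite nE divff.
Qed.

(** With [T = c ^+ 2] the last equation is [T - t = k * sqrt (T * (1 - T))]; the
    difference of the squared sides changes sign between [T = t] and [T = 1]. *)
Lemma mixing_angle (t k : R) : 0 <= t <= 1 -> 0 <= k ->
  exists c s : R, [/\ 0 <= c, 0 <= s, c * c + s * s = 1, t <= c * c &
    c * c - t = k * (c * s)].
Proof.
move=> /andP[t0 t1] k0.
pose p : {poly R} := ('X - t%:P) ^+ 2 - (k ^+ 2)%:P * ('X * (1 - 'X)).
have pE T : p.[T] = (T - t) ^+ 2 - k ^+ 2 * (T * (1 - T)) by rewrite /p !hornerE.
have [|T /andP[tT T1] /rootP] := @poly_ivt _ p t 1 t1.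
  rewrite !pE; apply/andP; split; last by rewrite subrr !mulr0 subr0 sqr_ge0.
  by rewrite subrr expr0n sub0r oppr_le0 !mulr_ge0 ?sqr_ge0 ?subr_ge0.
rewrite pE => /eqP; rewrite subr_eq0 => /eqP h.
have T0 : 0 <= T by exact: le_trans tT.
have T1' : 0 <= 1 - T by rewrite subr_ge0.
exists (Num.sqrt T), (Num.sqrt (1 - T)); rewrite -!expr2 !sqr_sqrtr//.
split; rewrite ?sqrtr_ge0//; first by rewrite addrC subrK.
apply/eqP; rewrite -(@eqrXn2 _ 2)// ?subr_ge0 ?mulr_ge0 ?sqrtr_ge0//.
by rewrite h !exprMn !sqr_sqrtr// subr_ge0.
Qed.

End Rotation.

Section Spreading.
Context {R : realType} {H : completeNormedModType R[i]}.
Context {dot : {dot H for @conjc R}} (dot_norm : induces_norm dot).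
Implicit Types (x y z : H).
Local Notation nrm := (@nrm R H dot).
Local Notation hcvg := (@hcvg R H dot).
Local Notation ons := (@ons R H dot).
Local Notation bnd := (@bnd R H dot).
Variables (A : H -> H) (M : R) (bA : bnd A M).

(** Statements about [qf] hold for both values of [b]: they are about the complex
    number [dot (A x) x]. *)
Definition qf b x : R := rpart b (dot (A x) x).

Lemma qf_le b x : `|qf b x| <= M * nrm x ^+ 2.
Proof.
have [_ _ hA] := bA; apply: le_trans (rpart_le _ _) _.
apply: le_trans (cauchy_schwarz dot_norm _ _) _.
by rewrite expr2 mulrA ler_wpM2r ?nrm_ge0.
Qed.

Lemma qf_phase b (om : R[i]) z : om * om^* = 1 -> qf b (om *: z) = qf b z.
Proof.
move=> h; have [lA _ _] := bA; rewrite /qf (linZ lA) dotZl dotZr mulrA h.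
by rewrite mul1r.
Qed.

(** The rotation with cosine [p.1] and sine [p.2] in the plane of [g] and [h]
    leaves the fraction [t] of the value at [g] in place and moves the rest to
    the value at [h], and conversely. *)
Definition spreads g h (t : R) (p : R * R[i]) : Prop :=
  [/\ 0 <= p.1, t <= p.1 * p.1, p.1%:C * p.1%:C + p.2 * p.2^* = 1 &
    forall b, qf b (p.1%:C *: g + p.2 *: h) = t * qf b g + (1 - t) * qf b h /\
      qf b (- p.2^* *: g + p.1%:C *: h) = (1 - t) * qf b g + t * qf b h].

(** A quantitative form of the Toeplitz-Hausdorff theorem in the plane: the
    phase of the sine makes the cross terms real after division by the
    difference of the values at [g] and [h], and the intermediate value theorem
    gives the angle.  The cosine is at least [sqrt t], so the rotation is close
    to the identity when [t] is close to [1]. *)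
Lemma plane_rotation g h (t : R) : dot g g = 1 -> dot h h = 1 -> dot g h = 0 ->
  0 <= t <= 1 -> exists p, spreads g h t p.
Proof.
move=> g1 h1 gh t01; have /andP[t0 t1] := t01; have [lA _ _] := bA.
set al := dot (A g) g; set be := dot (A h) h.
set ga := dot (A g) h; set de := dot (A h) g.
have e1 (c : R) s : dot (A (c%:C *: g + s *: h)) (c%:C *: g + s *: h) =
    c%:C * c%:C * al + s * s^* * be + c%:C * (s^* * ga + s * de).
  rewrite (linD lA) !(linZ lA) !dotDl !dotDr !dotZl !dotRr !dotZr -!/al -!/be -!/ga -!/de.
  by ring.
have e2 (c : R) s : dot (A (- s^* *: g + c%:C *: h)) (- s^* *: g + c%:C *: h) =
    s * s^* * al + c%:C * c%:C * be - c%:C * (s^* * ga + s * de).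
  rewrite (linD lA) !(linZ lA) !dotDl !dotDr !dotZl !dotRr !dotZr -!/al -!/be -!/ga -!/de.
  by rewrite rmorphN /= conjcK; ring.
suff [c [s [c0 tc cs eq]]] : exists (c : R) (s : R[i]), [/\ 0 <= c, t <= c * c,
    c%:C * c%:C + s * s^* = 1 &
    (c%:C * c%:C - t%:C) * (al - be) + c%:C * (s^* * ga + s * de) = 0].
  exists (c, s); split=> // b; rewrite /qf e1 e2 -/al -/be.
  have -> : s * s^* = 1 - c%:C * c%:C by rewrite -cs; ring.
  have e3 : c%:C * (s^* * ga + s * de) = - ((c%:C * c%:C - t%:C) * (al - be)).
    by apply/eqP; rewrite -addr_eq0 addrC eq.
  rewrite e3 -!rpartZ -!rpartD !rmorphB /= rmorph1.
  by split; congr (rpart b _); ring.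
have [ab|ab] := eqVneq al be.
  exists 1, 0; split; first exact: ler01.
  - by rewrite mulr1.
  - by rewrite mul0r addr0 rmorph1 mulr1.
  - by rewrite ab subrr mulr0 rmorph0 !mul0r addr0 mulr0 addr0.
have abn : al - be != 0 by rewrite subr_eq0.
have [u [u1 uI uR]] := phase_real (ga / (al - be)) (de / (al - be)).
set ka := u^* * _ + _ in uI uR.
have kaE : ka = (complex.Re ka)%:C by move: uI; case: (ka) => a b /= ->.
set k1 := complex.Re ka in kaE uR.
have k0 : 0 <= - k1 by rewrite oppr_ge0.
have [c [r [c0 r0 cr tc eT]]] := mixing_angle t01 k0.
exists c, (r%:C * u).
have sgs : (r%:C * u)^* = r%:C * u^* by rewrite rmorphM; congr (_ * _); exact: conjR.
split=> //.
  rewrite sgs mulrACA u1 mulr1 -!rmorphM -rmorphD /=; by rewrite cr.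
rewrite -rmorphM -rmorphB eT sgs.
have -> : r%:C * u^* * ga + r%:C * u * de = r%:C * ka * (al - be) by rewrite /ka; field.
rewrite kaE [X in _ + X = _]mulrA -mulrDl; apply/eqP; rewrite mulf_eq0; apply/orP; left; apply/eqP.
by rewrite -!rmorphM -rmorphD (_ : _ + _ = 0)//; ring.
Qed.

Lemma qf_le_M b x : nrm x <= 1 -> `|qf b x| <= M.
Proof.
move=> x1; apply: le_trans (qf_le b x) _; have [_ M0 _] := bA.
by rewrite ler_piMr// expr_le1 ?nrm_ge0.
Qed.

Lemma qf_cvg b u l : hcvg u l -> (fun n => qf b (u n)) @ \oo --> qf b l.
Proof.
move=> ul; have [lA M0 hA] := bA.
have hn := hcvg_nrm dot_norm ul.
apply/cvgP0; have h : (fun n => M * (nrm (u n) + nrm l) * nrm (u n - l)) @ \oo --> 0.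
  rewrite -[X in _ --> X](mulr0 (M * (nrm l + nrm l))).
  by apply: cvgM ul; apply: cvgMr; apply: cvgD => //; exact: cvg_cst.
apply: cvg0_le h => n; rewrite normr_ge0 /=.
have -> : qf b (u n) - qf b l = rpart b (dot (A (u n - l)) (u n) + dot (A l) (u n - l)).
  rewrite (linB lA) dotBl dotBr addrA subrK /qf.
  by case: b; rewrite /rpart ?ReD ?ReN ?ImD ?ImN.
apply: le_trans (rpart_le _ _) _; apply: le_trans (cabsD _ _) _.
have h1 := cauchy_schwarz dot_norm (A (u n - l)) (u n).
have h2 := cauchy_schwarz dot_norm (A l) (u n - l).
have g1 := ler_wpM2r (nrm_ge0 (dot := dot) (u n)) (hA (u n - l)).
have g2 := ler_wpM2r (nrm_ge0 (dot := dot) (u n - l)) (hA l).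
by lra.
Qed.

Lemma asum_qf b (x : nat -> R) e : asum x -> ons e -> asum (fun n => x n * qf b (e n)).
Proof. by move=> sx oe; apply: (asumM sx (M := M)) => n; apply/qf_le_M/ons_nrm. Qed.

Definition rot g h t : R * R[i] := xget (1, 0) [set p | spreads g h t p].

Lemma rotP g h (t : R) : dot g g = 1 -> dot h h = 1 -> dot g h = 0 ->
  0 <= t <= 1 -> spreads g h t (rot g h t).
Proof.
move=> g1 h1 gh t01; have [p hp] := plane_rotation g1 h1 gh t01.
by rewrite /rot; case: xgetP => [q _ //|/(_ p)[]].
Qed.

Section Concentrate.
Variables (e : nat -> H) (i0 : nat) (x d : nat -> R).
Hypotheses (oe : ons e) (e1 : dot (e i0) (e i0) = 1) (sx : asum x) (sd : asum d).
Hypotheses (d0 : forall n, 0 <= d n) (di0 : d i0 = 0).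
Hypotheses (de : forall n, e n = 0 -> d n = 0).
Hypotheses (xd : forall n, 0 < d n -> x n <= x i0).
Hypotheses (w0 : 0 < x i0 + rsum d).
(* [W n] is the weight accumulated from the indices below [n].  Rotating by
   [t n] replaces the weights [W n] and [x n] of two vectors by [W n + d n] and
   [x n - d n] without changing the weighted sum of the form; this amounts to
   [t n * (W n - x n + 2 * d n) = W n - x n + d n]. *)
Let W n : R := x i0 + \sum_(m < n) d m.
Let D n : R := W n - x n + 2 * d n.
Let t n : R := (D n - d n) / D n.

Let acc := fix acc n : H := if n is m.+1 then
  (if d m == 0 then acc m else
   (rot (acc m) (e m) (t m)).1%:C *: acc m + (rot (acc m) (e m) (t m)).2 *: e m)
  else e i0.

Let rest (n : nat) : H := if n == i0 then 0 else if d n == 0 then e n else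
  - (rot (acc n) (e n) (t n)).2^* *: acc n + (rot (acc n) (e n) (t n)).1%:C *: e n.

Let DP n : d n != 0 -> [/\ 0 < d n, n != i0, dot (e n) (e n) = 1, 0 < D n &
   d n <= D n].
Proof.
move=> dn; have dp : 0 < d n by rewrite lt_def dn d0.
have xn := xd dp; have Wx : x i0 <= W n by rewrite lerDl sumr_ge0.
split=> //.
- by apply: contra_neq dn => ->.
- by apply: ons_unit oe _ => en; move: dn; rewrite (de en) eqxx.
- by rewrite /D; lra.
- by rewrite /D; lra.
Qed.

Let t01 n : d n != 0 -> 0 <= t n <= 1.
Proof.
move=> /DP[dp _ _ Dp dD]; rewrite /t divr_ge0 ?subr_ge0 ?(ltW Dp)//=.
by rewrite ler_pdivrMr// mul1r gerBl ltW.
Qed.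

Let accP n : [/\ dot (acc n) (acc n) = 1,
  forall m, (n <= m)%N -> m != i0 -> dot (acc n) (e m) = 0 &
  forall u, (forall k, dot (e k) u = 0) -> dot (acc n) u = 0].
Proof.
elim: n => [|n [a1 ae au]] /=.
  by split=> // m _ mi; apply: oe.2; apply/eqP; rewrite eq_sym.
case: eqP => [dn|/eqP dn].
  by split=> // m nm; apply: ae; exact: ltnW.
have [dp ni en Dp dD] := DP dn.
have := rotP a1 en (ae n (leqnn n) ni) (t01 dn).
case: (rot _ _ _) => c s [/= c0 tc cs qq]; split.
- rewrite !dotDl !dotDr !dotZl !dotRr !dotZr a1 en (ae n (leqnn n) ni).
  by rewrite (dot_eq0C (ae n (leqnn n) ni)) -[RHS]cs; ring.
- move=> m nm mi; rewrite dotDl !dotZl ae ?(ltnW nm)// oe.2 ?mulr0 ?addr0//.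
  by apply/eqP; rewrite ltn_eqF.
- by move=> u hu; rewrite dotDl !dotZl au// hu !mulr0 addr0.
Qed.

Let rest_e m n : (m < n)%N -> n != i0 -> dot (rest m) (e n) = 0.
Proof.
move=> mn ni; have em : dot (e m) (e n) = 0 by apply: oe.2; apply/eqP; rewrite ltn_eqF.
rewrite /rest; case: eqP => _; first by rewrite dot0l.
case: eqP => _ //; have [_ ae _] := accP m.
by rewrite dotDl !dotZl em ae ?(ltnW mn)// !mulr0 addr0.
Qed.

Let acc_rest n m : (m < n)%N -> dot (acc n) (rest m) = 0.
Proof.
elim: n => // n IH; rewrite ltnS leq_eqVlt => /orP[/eqP ->|mn] /=.
  have [a1 ae _] := accP n.
  have [ni|ni] := eqVneq n i0; first by rewrite [rest n](_ : _ = 0) ?dot0r// /rest ni eqxx.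
  rewrite /rest (negPf ni).
  case: eqP => [dn|/eqP dn]; first exact: ae.
  have [_ _ en _ _] := DP dn.
  rewrite !dotDl !dotDr !dotZl !dotRr !dotZr a1 en ae// (dot_eq0C (ae n _ _))//.
  by rewrite rmorphN /= conjcK; ring.
case: eqP => [dn|/eqP dn]; first exact: IH.
have [_ ni _ _ _] := DP dn.
by rewrite dotDl !dotZl IH// (dot_eq0C (rest_e mn ni)) !mulr0 addr0.
Qed.

Let rest_unit n : n != i0 -> dot (rest n) (rest n) = dot (e n) (e n).
Proof.
move=> ni; rewrite /rest (negPf ni); case: eqP => // /eqP dn.
have [dp _ en Dp dD] := DP dn; have [a1 ae _] := accP n.
have := rotP a1 en (ae n (leqnn n) ni) (t01 dn).
case: (rot _ _ _) => c s [/= c0 tc cs qq].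
rewrite !dotDl !dotDr !dotZl !dotRr !dotZr a1 en ae// (dot_eq0C (ae n _ _))//.
by rewrite rmorphN /= conjcK -[RHS]cs; ring.
Qed.

Let rest_i0 : rest i0 = 0. Proof. by rewrite /rest eqxx. Qed.

Let rest_ortho m n : (m < n)%N -> dot (rest m) (rest n) = 0.
Proof.
move=> mn; have [->|ni] := eqVneq n i0; first by rewrite rest_i0 dot0r.
rewrite {2}/rest (negPf ni); case: eqP => _; first exact: rest_e.
by rewrite dotDr !dotZr (dot_eq0C (acc_rest mn)) rest_e// !mulr0 addr0.
Qed.

Let ons_rest : ons rest.
Proof.
split=> [n|m n /eqP].
  have [->|ni] := eqVneq n i0; first by left.
  case: (oe.1 n) => [en|en]; last by right; rewrite rest_unit.
  by left; rewrite /rest (negPf ni) (de en) eqxx.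
rewrite neq_ltn => /orP[mn|nm]; first exact: rest_ortho.
by apply/dot_eq0C/rest_ortho.
Qed.

Let conserve b n : W n * qf b (acc n) +
    \sum_(m < n) (if (m : nat) == i0 then 0 else (x m - d m) * qf b (rest m)) =
  x i0 * qf b (e i0) + \sum_(m < n) (if (m : nat) == i0 then 0 else x m * qf b (e m)).
Proof.
elim: n => [|n IH]; first by rewrite !big_ord0 !addr0 /W big_ord0 addr0.
rewrite !big_ord_recr /= !addrA -IH [RHS]addrAC [LHS]addrAC; congr (_ + _).
rewrite /W big_ord_recr /= addrA -/(W n) /rest.
have [ni|ni] := eqVneq n i0; first by rewrite ni di0 eqxx !addr0.
case: eqP => [-> |/eqP dn]; first by rewrite subr0 addr0.
have [dp _ en Dp dD] := DP dn; have [a1 ae _] := accP n.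
have := rotP a1 en (ae n (leqnn n) ni) (t01 dn).
case: (rot _ _ _) => c s [/= c0 tc cs /(_ b)[-> ->]].
have Dn : D n != 0 by rewrite gt_eqF.
have tD : t n * D n = D n - d n by rewrite /t divfK.
set q1 := qf b _; set q2 := qf b _.
have WD : W n = D n + x n - 2 * d n by rewrite /D; ring.
rewrite WD; have -> : (D n + x n - 2 * d n + d n) * (t n * q1 + (1 - t n) * q2) +
    (x n - d n) * ((1 - t n) * q1 + t n * q2) =
    q1 * (t n * D n + x n - d n) + q2 * (D n - t n * D n + x n - d n) by ring.
by rewrite tD; ring.
Qed.

Let W_cvg : W @ \oo --> x i0 + rsum d.
Proof. by apply: cvgD; [exact: cvg_cst|exact: rsum_cvgE]. Qed.

Let r n : R := if d n == 0 then 0 else d n / D n.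

Let r0 n : 0 <= r n.
Proof. by rewrite /r; case: eqP => // /eqP /DP[dp _ _ Dp _]; rewrite divr_ge0 ?ltW. Qed.

Let sr : asum r.
Proof.
have Dw : D @ \oo --> x i0 + rsum d.
  have h : D @ \oo --> (x i0 + rsum d - 0 + 2 * 0).
    apply: cvgD; first by apply: cvgB => //; exact: asum_cvg0.
    by apply: cvgMr; exact: asum_cvg0.
  by move: h; rewrite subr0 mulr0 addr0.
have w2 : (x i0 + rsum d) / 2 < x i0 + rsum d by have := w0; set w := _ + _; lra.
have [K _ hK] := cvgr_gt _ Dw _ w2.
pose r1 n := if (n < K)%N then r n else 0.
pose r2 n := if (n < K)%N then 0 else r n.
have s1 : asum r1 by apply: (@asum_fin _ _ K) => n Kn; rewrite /r1 ltnNge Kn.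
have s2 : asum r2.
  apply: asum_le (asumZ (2 / (x i0 + rsum d)) sd) _ => n; rewrite /r2.
  case: ifP => nK; first by rewrite normr0.
  rewrite ger0_norm// /r; case: eqP => // /eqP dn; have [dp _ _ Dp _] := DP dn.
  have := hK n; rewrite /= leqNgt nK => /(_ isT) h.
  apply: le_trans (ler_norm _); rewrite [leLHS]mulrC; apply: (ler_wpM2r (ltW dp)).
  by rewrite -[leRHS]invf_div lef_pV2 ?posrE ?divr_gt0// ltW.
by have := asumD s1 s2; congr asum; apply/funext => n; rewrite /r1 /r2; case: ifP; rewrite ?addr0 ?add0r.
Qed.

Let acc_close m n : (m <= n)%N ->
  1 - \sum_(m <= k < n) r k <= complex.Re (dot (acc n) (acc m)).
Proof.
have [am1 ame _] := accP m.
elim: n => [|n IH]; first by rewrite leqn0 => /eqP mz; rewrite mz big_geq// subr0; have [-> _ _] := accP 0.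
rewrite leq_eqVlt => /orP[/eqP <-|]; first by rewrite big_geq// subr0 am1.
rewrite ltnS => mn; rewrite big_nat_recr//= /r; case: eqP => [dn|/eqP dn].
  by rewrite addr0; exact: IH.
have [dp ni en Dp dD] := DP dn; have [a1 ae _] := accP n.
have := rotP a1 en (ae n (leqnn n) ni) (t01 dn).
case: (rot _ _ _) => c s [/= c0 tc cs qq].
rewrite dotDl !dotZl (dot_eq0C (ame n mn ni)) mulr0 addr0 ReZ.
have rho : complex.Re (dot (acc n) (acc m)) <= 1.
  apply: le_trans (ler_norm _) _; apply: le_trans (Re_le_cabs _) _.
  apply: le_trans (cauchy_schwarz dot_norm _ _) _.
  by rewrite (dot1_nrm a1) (dot1_nrm am1) mulr1.
have c1 : c <= 1.
  have : c * c <= 1.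
    rewrite -lecR rmorphM /= rmorph1 -cs lerDl mulJc ler0c sqr_ge0//.
  nra.
have tE : t n = 1 - d n / D n by rewrite /t mulrBl divff// gt_eqF.
have := IH mn; rewrite tE in tc; set y := d n / D n in tc *; set z := \sum_(_ <= _ < _) _.
set p := complex.Re _ in rho *; nra.
Qed.

Let acc_cvg : exists f, hcvg acc f.
Proof.
apply: (hilbert_complete dot_norm) => eps e0.
have e2 : 0 < eps ^+ 2 / 2 by rewrite divr_gt0// exprn_gt0.
have [N hN] := rsum_tail_lt sr e2; exists N => m n /andP[Nm mn].
rewrite nrm_distC -ltr_sqr ?nnegrE ?nrm_ge0 ?(ltW e0)//.
have [am1 _ _] := accP m; have [an1 _ _] := accP n.
rewrite nrm_sqrD nrmN dotNr ReN (dot1_nrm am1) (dot1_nrm an1) expr1n.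
have h := acc_close mn.
have : \sum_(m <= k < n) r k <= rsum (fun n => if (n < N)%N then 0 else `|r n|).
  by apply: sum_le_tail; rewrite ?Nm.
by move: hN h; set a := rsum _; set b := \sum_(_ <= _ < _) _; lra.
Qed.

(** The weights [d] of all vectors [e n] are moved onto the vector [e i0], one
    rotation at a time.  The accumulated vectors converge because consecutive
    ones have inner product at least [1 - r n] with [r] summable. *)
Lemma concentrate : exists f e', [/\ dot f f = 1, ons e', e' i0 = 0,
    forall n, n != i0 -> dot (e' n) (e' n) = dot (e n) (e n) &
    forall n, dot f (e' n) = 0] /\
  (forall u, (forall n, dot (e n) u = 0) -> dot f u = 0 /\ forall n, dot (e' n) u = 0) /\
  (forall b, (x i0 + rsum d) * qf b f +
      rsum (fun n => if n == i0 then 0 else (x n - d n) * qf b (e' n)) =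
    rsum (fun n => x n * qf b (e n))).
Proof.
have [f hf] := acc_cvg; exists f, rest; split; last split.
- split=> //.
    have := hcvg_nrm dot_norm hf; under eq_fun do rewrite (dot1_nrm (let: And3 h _ _ := accP _ in h)).
    by move=> h; apply: nrm1_dot; rewrite -(rcvg_unique h (cvg_cst _)).
  move=> n; apply: (hcvg_dot_const dot_norm _ (hcvg_shift n.+1 hf)) => k.
  by rewrite acc_rest// addnS ltnS leq_addl.
- move=> u hu; have fu k : dot (acc k) u = 0 by have [_ _ ->] := accP k.
  split; first exact: (hcvg_dot_const dot_norm fu hf).
  move=> n; rewrite /rest; case: eqP => _; first by rewrite dot0l.
  by case: eqP => _ //; rewrite dotDl !dotZl fu hu !mulr0 addr0.
- move=> b.
  have s1 : asum (fun n => if n == i0 then 0 else (x n - d n) * qf b (rest n)).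
    by apply/asum_ifn/asum_qf => //; exact: asumB.
  have s2 := asum_qf b sx oe.
  rewrite (rsum_D1 i0 s2).
  pose u n := W n * qf b (acc n) +
    \sum_(m < n) (if (m : nat) == i0 then 0 else (x m - d m) * qf b (rest m)).
  apply: (@rcvg_unique _ u).
    by apply: cvgD; [apply: cvgM => //; exact: qf_cvg|exact: rsum_cvgE].
  have -> : u = fun n => x i0 * qf b (e i0) +
      \sum_(m < n) (if (m : nat) == i0 then 0 else x m * qf b (e m)).
    by apply/funext => n; exact: conserve.
  apply: cvgD; first exact: cvg_cst.
  exact: (rsum_cvgE (asum_ifn (fun n => n == i0) s2)).
Qed.

End Concentrate.

End Spreading.

(** * Peeling off one weight at a time *)

Section Hinge.
Context {R : realType}.
Implicit Types x y : nat -> R.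

(** The total excess of [x] over the level [t].  For nonnegative sequences,
    comparing these sums for all [t > 0] is equivalent to comparing the sums of
    the [n] largest terms for all [n]; unlike those, they are sums over all
    indices in their given order. *)
Definition hinge x (t : R) : R := rsum (fun n => Num.max (x n - t) 0).

Lemma hinge_asum x t : asum x -> 0 <= t -> asum (fun n => Num.max (x n - t) 0).
Proof.
move=> sx t0; apply: asum_le sx _ => n; rewrite ger0_norm ?le_max ?lexx ?orbT//.
rewrite ge_max normr_ge0 andbT; apply: le_trans (ler_norm _).
by rewrite gerBl.
Qed.

Lemma hinge_le_rsum x t : asum x -> 0 <= t -> (forall n, 0 <= x n) -> hinge x t <= rsum x.
Proof.
move=> sx t0 x0; apply: rsum_le => //; first exact: hinge_asum.
by move=> n; rewrite ge_max x0 andbT gerBl.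
Qed.

Lemma rsum_le_hinge x y : asum x -> asum y -> (forall n, 0 <= y n) ->
  (forall t, 0 < t -> hinge x t <= hinge y t) -> rsum x <= rsum y.
Proof.
move=> sx sy y0 h; apply: rsum_ub => // N; apply/ler_addgt0Pr => eps e0.
pose t := eps / N.+1%:R; have t0 : 0 < t by rewrite divr_gt0.
have hx := hinge_asum sx (ltW t0).
apply: (@le_trans _ _ (\sum_(i < N) Num.max (x i - t) 0 + \sum_(i < N) t)).
  rewrite -big_split /=; apply: ler_sum => i _.
  by rewrite -lerBlDr le_max lexx.
apply: lerD.
  apply: le_trans (rsum_part N hx _) _.
    by move=> n; rewrite le_max lexx orbT.
  by apply: le_trans (h t t0) _; apply: hinge_le_rsum => //; exact: ltW.
rewrite sumr_const card_ord -mulr_natr /t mulrAC ler_pdivrMr ?ltr0n//.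
by rewrite ler_wpM2l ?(ltW e0)// ler_nat.
Qed.

Lemma argmax x n0 : asum x -> (forall n, 0 <= x n) -> 0 < x n0 ->
  exists2 i, 0 < x i & forall n, x n <= x i.
Proof.
move=> sx x0 xn0; have /cvgrPdist_lt/(_ _ xn0)[N _ hN] := asum_cvg0 sx.
have small n : (N <= n)%N -> x n < x n0.
  by move=> /hN /=; rewrite sub0r normrN ger0_norm.
pose i := [arg max_(i > (ord_max : 'I_(maxn N n0).+1)) x i]%O.
have hi : forall j : 'I_(maxn N n0).+1, x j <= x i.
  by rewrite /i; case: arg_maxP => // k _ hk j; exact: hk.
have n0i : x n0 <= x i.
  have l : (n0 < (maxn N n0).+1)%N by rewrite ltnS leq_maxr.
  exact: (hi (Ordinal l)).
exists i; first exact: lt_le_trans n0i.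
move=> n; have [nN|Nn] := ltnP n N.
  have l : (n < (maxn N n0).+1)%N by rewrite ltnS (leq_trans (ltnW nN)) ?leq_maxl.
  exact: (hi (Ordinal l)).
by apply: le_trans (ltW (small _ Nn)) n0i.
Qed.

(** The intermediate value theorem for [hinge x], which is continuous because the
    hinge sums have a common dominating series. *)
Lemma hinge_level x (r : R) (m : R) : asum x -> (forall n, 0 <= x n <= m) ->
  0 <= r <= rsum x -> exists2 c, 0 <= c <= m & hinge x c = r.
Proof.
move=> sx xm /andP[r0 rx]; pose G (c : R) := hinge x `|c|.
have m0 : 0 <= m by have /andP[h1 h2] := xm 0%N; exact: le_trans h2.
have Gc : continuous G.
  move=> c; apply/cvgrPdist_lt => eps e0.
  have e2 : 0 < eps / 2 by rewrite divr_gt0.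
  have [N hN] := rsum_tail_lt sx e2.
  have d0 : 0 < eps / 2 / N.+1%:R by rewrite divr_gt0.
  apply: filterS (@cvgr_dist_lt _ _ _ _ _ id c (@cvg_id _ _) _ d0) => c' /= hc.
  have s1 := hinge_asum sx (normr_ge0 c); have s2 := hinge_asum sx (normr_ge0 c').
  rewrite /G /hinge -rsumB//; have sB := asumB s1 s2.
  apply: le_lt_trans (rsum_norm sB) _.
  rewrite (rsum_split N (asum_norm sB)).
  have lip n : `|Num.max (x n - `|c|) 0 - Num.max (x n - `|c'|) 0| <= `|c - c'|.
    have h1 := ler_dist_dist c c'.
    apply: le_trans (_ : `| `|c| - `|c'| | <= _) => //.
    move: `|c| `|c'| => a a'; rewrite /Num.max; do 2 case: ltP => ?;
      rewrite ?subrr ?normr0// ler_norml; apply/andP; split;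
      have := ler_norm (a - a'); have := ler_norm (a' - a); rewrite distrC => ? ?; lra.
  have bd n : `|Num.max (x n - `|c|) 0 - Num.max (x n - `|c'|) 0| <= `|x n|.
    have /andP[xn _] := xm n; rewrite (ger0_norm xn).
    have := normr_ge0 c; have := normr_ge0 c'; move: `|c| `|c'| => a a' a0 a'0.
    by rewrite ler_norml /Num.max; do 2 case: ltP => ?; apply/andP; split; lra.
  have p1 : \sum_(i < N) `|Num.max (x i - `|c|) 0 - Num.max (x i - `|c'|) 0| <= eps / 2.
    apply: (@le_trans _ _ (\sum_(i < N) (eps / 2 / N.+1%:R))).
      by apply: ler_sum => i _; apply: le_trans (lip i) (ltW hc).
    move: (eps / 2) e2 => e' e2; rewrite sumr_const card_ord -[X in X <= _]mulr_natr mulrAC.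
    by rewrite ler_pdivrMr ?ltr0n// ler_wpM2l ?(ltW e2)// ler_nat.
  have p2 : rsum (fun n => if (n < N)%N then 0 else
      `|Num.max (x n - `|c|) 0 - Num.max (x n - `|c'|) 0|) <=
      rsum (fun n => if (n < N)%N then 0 else `|x n|).
    apply: rsum_le => [||n]; [exact/asum_ifn/asum_norm|exact/asum_ifn/asum_norm|].
    by case: ifP.
  by move: p1 p2 hN; set a := \sum_(_ < _) _; set b := rsum _; set d := rsum _; lra.
have G0 : G 0 = rsum x.
  rewrite /G normr0; apply: rsum_ext => n; rewrite subr0; apply/max_idPl.
  by have /andP[] := xm n.
have Gm : G m = 0.
  rewrite /G (ger0_norm m0) -[RHS](@rsum0 R); apply: rsum_ext => n; apply/max_idPr.
  by rewrite subr_le0; have /andP[] := xm n.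
have [||c] := @IVT _ G 0 m r m0.
- exact: continuous_subspaceT.
- by rewrite G0 Gm ge_min le_max rx r0 orbT.
rewrite in_itv /= => cm Gcr; exists c => //.
by move: Gcr; rewrite /G ger0_norm//; have /andP[] := cm.
Qed.

End Hinge.

Section Peeling.
Context {R : realType} {H : completeNormedModType R[i]}.
Context {dot : {dot H for @conjc R}} (dot_norm : induces_norm dot).
Local Notation ons := (@ons R H dot).
Local Notation bnd := (@bnd R H dot).
Variables (A : H -> H) (M : R) (bA : bnd A M).
Local Notation qf := (@qf R H dot A).

Notation state := ((nat -> H) * (nat -> R))%type.

Definition qsum b (s : state) : R := rsum (fun n => s.2 n * qf b (s.1 n)).

Lemma qsum_le b (s : state) : ons s.1 -> asum s.2 ->
  `|qsum b s| <= M * rsum (fun n => `|s.2 n|).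
Proof.
move=> oe sx; have sq := asum_qf dot_norm bA b sx oe.
apply: le_trans (rsum_norm sq) _; rewrite -rsumZ; last exact: asum_norm.
apply: rsum_le => [||n]; [exact: asum_norm|exact/asumZ/asum_norm|].
by rewrite normrM mulrC ler_wpM2r// (qf_le_M dot_norm bA)// (ons_nrm n oe).
Qed.

(** One step splits off a vector [f] with weight [w] and keeps the weighted sum
    of the form; the clause about [u] says that all new vectors stay in the
    closed span of the old ones. *)
Definition peel_step (s : state) (f : H) (w : R) (s' : state) : Prop :=
  [/\ f = 0 \/ dot f f = 1, forall n, dot f (s'.1 n) = 0,
      forall u, (forall n, dot (s.1 n) u = 0) -> dot f u = 0 /\ forall n, dot (s'.1 n) u = 0 &
      forall b, w * qf b f + qsum b s' = qsum b s].

(** Iterating the steps: the vectors split off form an orthonormal system, and the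
    weighted sum of the form is recovered in the limit because what remains is
    bounded by [rho k], which tends to [0]. *)
Lemma peel (Inv : nat -> state -> Prop) (P : nat -> state -> H -> R -> state -> Prop)
    (rho : nat -> R) s0 :
  Inv 0%N s0 ->
  (forall k s, Inv k s -> exists f w s', [/\ Inv k.+1 s', P k s f w s' & peel_step s f w s']) ->
  rho @ \oo --> 0 -> (forall k s b, Inv k s -> `|qsum b s| <= rho k) ->
  exists (s : nat -> state) f w, [/\ s 0%N = s0,
    forall k, Inv k (s k) /\ P k (s k) (f k) (w k) (s k.+1), ons f,
    forall u, (forall n, dot (s0.1 n) u = 0) -> forall k, dot (f k) u = 0 &
    forall b, (fun K => \sum_(k < K) w k * qf b (f k)) @ \oo --> qsum b s0].
Proof.
move=> I0 step rho0 Irho.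
have /choice[g hg] : forall ks : nat * state, exists p : H * R * state,
    Inv ks.1 ks.2 -> [/\ Inv ks.1.+1 p.2, P ks.1 ks.2 p.1.1 p.1.2 p.2 &
      peel_step ks.2 p.1.1 p.1.2 p.2].
  move=> [k s] /=; have [/step[f [w [s' h]]]|no] := pselect (Inv k s).
    by exists (f, w, s').
  by exists (0, 0, s) => /no.
pose s := fix s n : state := if n is m.+1 then (g (m, s m)).2 else s0.
pose f k := (g (k, s k)).1.1; pose w k := (g (k, s k)).1.2.
have Is k : Inv k (s k) by elim: k => [//|k IH]; have [] := hg (k, s k) IH.
have Ps k : P k (s k) (f k) (w k) (s k.+1) by have [] := hg (k, s k) (Is k).
have Ss k : peel_step (s k) (f k) (w k) (s k.+1) by have [] := hg (k, s k) (Is k).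
have span j u : (forall n, dot ((s j).1 n) u = 0) ->
    forall k, (j <= k)%N -> (forall n, dot ((s k).1 n) u = 0) /\ dot (f k) u = 0.
  move=> hu k; elim: k => [|k IH].
    by rewrite leqn0 => /eqP j0; rewrite -j0; split=> //; have [_ _ h _] := Ss j; have [] := h u hu.
  rewrite leq_eqVlt => /orP[/eqP jk|].
    by rewrite -jk; split=> //; have [_ _ h _] := Ss j; have [] := h u hu.
  rewrite ltnS => /IH[h1 _]; have [_ _ /(_ u h1)[_ h2] _] := Ss k.
  by split=> //; have [_ _ /(_ u h2)[]] := Ss k.+1.
have orth j k : (j < k)%N -> dot (f k) (f j) = 0.
  move=> jk; have [_ h _ _] := Ss j.
  by have [] := span j.+1 (f j) (fun n => dot_eq0C (h n)) k jk.
exists s, f, w; split=> //.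
- split=> [n|m n /eqP]; first by have [] := Ss n.
  rewrite neq_ltn => /orP[/orth/dot_eq0C//|/orth//].
- by move=> u hu k; have [] := span 0%N u hu k (leq0n k).
- move=> b; have tele K : \sum_(k < K) w k * qf b (f k) = qsum b s0 - qsum b (s K).
    elim: K => [|K IH]; first by rewrite big_ord0 subrr.
    rewrite big_ord_recr /= IH; have [_ _ _ /(_ b) <-] := Ss K.
    by rewrite opprD addrA addrAC subrK.
  apply/cvgP0; apply: cvg0_le rho0 => K; rewrite normr_ge0 /= tele.
  by rewrite addrAC subrr add0r normrN Irho.
Qed.

(** The state after the targets [lam 0 .. lam (k - 1)] have been peeled off: the
    remaining weights lie between [0] and their targets, with the same total. *)
Definition dominated (lam : nat -> R) k (s : state) : Prop :=
  [/\ ons s.1, forall n, (n < k)%N -> s.1 n = 0 /\ s.2 n = 0,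
      forall n, (k <= n)%N -> lam n != 0 -> dot (s.1 n) (s.1 n) = 1,
      forall n, (0 <= lam n -> 0 <= s.2 n <= lam n) /\ (lam n <= 0 -> lam n <= s.2 n <= 0) &
      rsum s.2 = rsum (fun n => if (n < k)%N then 0 else lam n)].

Lemma dominated_le lam k s n : dominated lam k s ->
  `|s.2 n| <= `|if (n < k)%N then 0 else lam n|.
Proof.
move=> [_ sz _ sl _]; case: ifP => nk; first by rewrite (sz n nk).2.
have [h1 h2] := sl n; have [l0|l0] := leP 0 (lam n).
  by have /andP[a b] := h1 l0; rewrite !ger0_norm//; exact: le_trans b.
by have /andP[a b] := h2 (ltW l0); rewrite (ler0_norm b) (ltr0_norm l0) lerN2.
Qed.

Lemma dominated_asum lam k s : asum lam -> dominated lam k s -> asum s.2.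
Proof.
move=> sl ds; apply: asum_le (asum_ifn (fun n => n < k)%N sl) _ => n.
exact: dominated_le ds.
Qed.

Lemma dominatedN lam k s : asum lam -> dominated lam k s ->
  dominated (fun n => - lam n) k (s.1, fun n => - s.2 n).
Proof.
move=> sl ds; have [oe sz s1 sb sr] := ds; split=> //=.
- by move=> n /sz[-> ->]; rewrite oppr0.
- by move=> n kn; rewrite oppr_eq0; exact: s1.
- move=> n; have [h1 h2] := sb n; split=> l0.
    have /h2/andP[a b] : lam n <= 0 by rewrite -oppr_ge0.
    by rewrite oppr_ge0 b lerN2.
  have /h1/andP[a b] : 0 <= lam n by rewrite -oppr_le0.
  by rewrite oppr_le0 a lerN2 b.
- rewrite rsumN; last exact: dominated_asum ds.
  rewrite sr -rsumN; last exact: asum_ifn.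
  by apply: rsum_ext => n; case: ifP; rewrite ?oppr0.
Qed.

(** What [lam k] still lacks is at most the total deficit on the indices with
    [lam n < 0], as the totals agree; it is taken from those indices in
    proportion to their deficits, which lowers each [x n] toward [lam n]. *)
Lemma dominated_step_pos lam k s : asum lam -> dominated lam k s -> 0 < lam k ->
  exists f s', [/\ dominated lam k.+1 s', dot f f = 1 & peel_step s f (lam k) s'].
Proof.
case: s => e x sl ds lk; have sx := dominated_asum sl ds.
have [oe sz s1 sb sr] := ds; rewrite /= in oe sz s1 sb sr sx.
pose y n := (if (n < k)%N then 0 else lam n) - x n.
have slk := asum_ifn (fun n => n < k)%N sl.
have sy : asum y by exact: asumB.
have y0 : rsum y = 0 by rewrite rsumB// sr subrr.
pose yp n := if lam n < 0 then 0 else y n.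
pose ym n := if lam n < 0 then - y n else 0.
have syp : asum yp by exact: asum_ifn.
have sym : asum ym by apply: (@asum_if _ (fun n => lam n < 0)); exact: asumN.
have xk0 n : (n < k)%N -> x n = 0 by move=> /sz[].
have yp0 n : 0 <= yp n.
  rewrite /yp /y; case: ltP => // l0; case: ifP => nk; first by rewrite xk0// subr0.
  by have [/(_ l0)/andP[_ h] _] := sb n; rewrite subr_ge0.
have ym0 n : 0 <= ym n.
  rewrite /ym /y; case: ltP => // l0; case: ifP => nk; first by rewrite xk0// subr0 oppr0.
  by have [_ /(_ (ltW l0))/andP[h _]] := sb n; rewrite oppr_ge0 subr_le0.
have ypm : rsum yp = rsum ym.
  apply/eqP; rewrite -subr_eq0 -rsumB// -y0; apply/eqP; apply: rsum_ext => n.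
  by rewrite /yp /ym; case: ifP; rewrite ?sub0r ?opprK ?subr0.
have ypk : yp k = lam k - x k by rewrite /yp /y ltnn ltNge ltW.
have ypk_le : lam k - x k <= rsum ym by rewrite -ypk -ypm; exact: rsum_term.
have [/(_ (ltW lk))/andP[xk xlk] _] := sb k.
pose th := (lam k - x k) / rsum ym.
have rm0 : 0 <= rsum ym by exact: rsum_ge0.
have th01 : 0 <= th <= 1.
  rewrite /th divr_ge0 ?subr_ge0//=; have [->|rn] := eqVneq (rsum ym) 0.
    by rewrite invr0 mulr0.
  by rewrite ler_pdivrMr ?mul1r// lt_def rn.
have /andP[th0 th1] := th01.
pose d n := th * ym n.
have sd : asum d by exact: asumZ.
have rd : rsum d = lam k - x k.
  rewrite rsumZ// /th; have [r0|rn] := eqVneq (rsum ym) 0; last by rewrite divfK.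
  by rewrite r0 mulr0; apply/esym/eqP; rewrite eq_le -{1}r0 ypk_le subr_ge0.
have d0 n : 0 <= d n by rewrite mulr_ge0.
have dk : d k = 0 by rewrite /d /ym ltNge (ltW lk) /= mulr0.
have dpos n : 0 < d n -> lam n < 0 /\ (k <= n)%N.
  rewrite /d /ym; case: (ltP (lam n) 0) => [l0 h|_]; last by rewrite mulr0 ltxx.
  split=> //; rewrite leqNgt; apply/negP => nk; move: h.
  by rewrite /y nk xk0// subrr oppr0 mulr0 ltxx.
have de n : e n = 0 -> d n = 0.
  move=> en; apply/eqP; rewrite eq_le d0 andbT leNgt; apply/negP => /dpos[l0 kn].
  by have := s1 n kn (ltr0_neq0 l0); rewrite en dot0l => /eqP; rewrite eq_sym oner_eq0.
have xd n : 0 < d n -> x n <= x k.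
  move=> /dpos[l0 _]; have [_ /(_ (ltW l0))/andP[_ h]] := sb n.
  exact: le_trans h xk.
have e1 : dot (e k) (e k) = 1 by apply: s1 => //; rewrite gt_eqF.
have wE : x k + rsum d = lam k by rewrite rd addrC subrK.
have [|f [e' [[f1 oe' e'k e'n fe'] [sp cons]]]] := concentrate dot_norm bA oe e1 sx sd d0 dk de xd.
  by rewrite wE.
rewrite wE in cons.
exists f, (e', fun n => if n == k then 0 else x n - d n).
split=> //; last first.
  split=> //; first by right.
  move=> b; rewrite /qsum -cons /=; congr (_ + _); apply: rsum_ext => n.
  by case: ifP; rewrite ?mul0r.
split=> //=.
- move=> n; rewrite ltnS leq_eqVlt => /orP[/eqP ->|nk]; first by rewrite eqxx.
  have nk' : n != k by rewrite ltn_eqF.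
  rewrite (negPf nk'); split.
    apply: contrapT => en; have := e'n n nk'; rewrite (ons_unit oe' en) (sz n nk).1 dot0l.
    by move/eqP; rewrite oner_eq0.
  rewrite xk0//; have -> : d n = 0 by apply: de; have [] := sz n nk.
  by rewrite subr0.
- move=> n kn ln; rewrite e'n ?gtn_eqF//; apply: s1 => //; exact: ltnW.
- move=> n; have [h1 h2] := sb n; case: eqP => [->|_].
    by rewrite lexx (ltW lk); split=> // l0; move: lk; rewrite ltNge l0.
  split=> l0.
    have -> : d n = 0 by rewrite /d /ym ltNge l0 /= mulr0.
    by rewrite subr0; exact: h1.
  have /andP[a b] := h2 l0; apply/andP; split; last by rewrite subr_le0 (le_trans b).
  have [nk|kn] := ltnP n k.
    have [en xn] := sz n nk; rewrite (de _ en) subr0 xn//.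
  have [ln|ln] := eqVneq (lam n) 0.
    by rewrite /d /ym ln ltxx mulr0 subr0 -ln.
  have l0' : lam n < 0 by rewrite lt_def eq_sym ln.
  rewrite /d /ym l0' /y ltnNge kn /=.
  have : 0 <= (1 - th) * (x n - lam n) by rewrite mulr_ge0 ?subr_ge0.
  by lra.
- have sxd : asum (fun n => x n - d n) by exact: asumB.
  have := rsum_D1 k sxd; rewrite rsumB// sr dk subr0 rd.
  rewrite (rsum_D1 k slk) ltnn => h.
  have -> : rsum (fun n => if n == k then 0 else x n - d n) =
      rsum (fun n => if n == k then 0 else if (n < k)%N then 0 else lam n).
    by move: h; set a := rsum _; set c := rsum _; lra.
  apply: rsum_ext => n; rewrite ltnS (leq_eqVlt n).
  by case: eqP.
Qed.

Lemma dominated_step lam k s : asum lam -> dominated lam k s ->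
  exists f w s', [/\ dominated lam k.+1 s',
    w = lam k /\ (lam k != 0 -> dot f f = 1) & peel_step s f w s'].
Proof.
move=> sl ds; have [lk|lk|lk] := ltgtP (lam k) 0; last first.
- have [oe sz s1 sb sr] := ds.
  have sk : s.2 k = 0.
    have [h _] := sb k; have /h/andP[h1 h2] : 0 <= lam k by rewrite lk.
    by apply/eqP; rewrite eq_le h1 -lk h2.
  pose e' n := if (n < k.+1)%N then 0 else s.1 n.
  exists 0, 0, (e', s.2); rewrite lk; split=> //; last first.
    split=> /=; [by left|by move=> n; rewrite dot0l| |].
      move=> u hu; split=> [|n]; first by rewrite dot0l.
      by rewrite /e'; case: ifP; rewrite ?dot0l.
    move=> b; rewrite mul0r add0r; apply: rsum_ext => n /=; rewrite /e' ltnS leq_eqVlt.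
    case: eqP => [->|_] /=; first by rewrite sk !mul0r.
    by case: ifP => // /sz[-> ->].
  split=> /=.
  + split=> [n|m n mn]; rewrite /e'; first by case: ifP => _; [left|exact: oe.1].
    by case: ifP; case: ifP; rewrite ?dot0l ?dot0r// => _ _; exact: oe.2.
  + move=> n nk; rewrite /e' nk; split=> //; move: nk.
    by rewrite ltnS leq_eqVlt => /orP[/eqP ->//|/sz[]].
  + by move=> n kn ln; rewrite /e' ltnNge kn /=; apply: s1 => //; exact: ltnW.
  + by [].
  + rewrite sr; apply: rsum_ext => n; rewrite ltnS (leq_eqVlt n).
    by case: eqP => [->|//]; rewrite ltnn lk.
- have [f [s' [h1 h2 h3]]] := dominated_step_pos sl ds lk.
  by exists f, (lam k), s'; split.
- have lkN : 0 < - lam k by rewrite oppr_gt0.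
  have slN := asumN sl.
  have [f [s' [h1 h2 [g1 g2 g3 g4]]]] := dominated_step_pos slN (dominatedN sl ds) lkN.
  exists f, (lam k), (s'.1, fun n => - s'.2 n); split=> //.
    have := dominatedN slN h1; congr dominated.
    by apply/funext => n; rewrite opprK.
  split=> // b; have := g4 b.
  have [oe _ _ _ _] := ds; have [oe' _ _ _ _] := h1.
  have qN (s0 : state) : ons s0.1 -> asum s0.2 ->
      qsum b (s0.1, fun n => - s0.2 n) = - qsum b s0.
    move=> o sa; rewrite /qsum -(rsumN (asum_qf dot_norm bA b sa o)).
    by apply: rsum_ext => n; rewrite mulNr.
  rewrite (qN s oe (dominated_asum sl ds)) (qN s' oe' (dominated_asum slN h1)).
  by rewrite mulNr; set a := qsum b s; set c := qsum b s'; set l := _ * _; lra.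
Qed.

Lemma dominated_fill lam (v : nat -> H) (m : nat -> R) : asum lam -> ons v ->
  (forall n, lam n != 0 -> dot (v n) (v n) = 1) ->
  (forall n, (0 <= lam n -> 0 <= m n <= lam n) /\ (lam n <= 0 -> lam n <= m n <= 0)) ->
  rsum m = rsum lam ->
  exists f, [/\ ons f, forall n, lam n != 0 -> dot (f n) (f n) = 1 &
    forall b, rsum (fun n => lam n * qf b (f n)) = rsum (fun n => m n * qf b (v n))].
Proof.
move=> sl ov v1 ml rm.
have d0 : dominated lam 0 (v, m).
  by split=> //= n _; exact: v1.
have step k s : dominated lam k s -> exists f w s', [/\ dominated lam k.+1 s',
    w = lam k /\ (lam k != 0 -> dot f f = 1) & peel_step s f w s'].
  exact: dominated_step.
have M0 : 0 <= M by have [] := bA.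
have [|s [f [w [_ sP of_ _ hf]]]] := peel d0 step (cvgM0 M (rsum_tail sl)).
  move=> k s b ds; have [oe _ _ _ _] := ds; have sx := dominated_asum sl ds.
  apply: le_trans (qsum_le b oe sx) _; rewrite ler_wpM2l//.
  apply: rsum_le => [||n]; [exact: asum_norm|exact/asum_ifn/asum_norm|].
  by apply: le_trans (dominated_le n ds) _; case: ifP; rewrite ?normr0.
exists f; split=> // [n|b]; first by have [_ [_]] := sP n.
apply: rsum_unique; have -> : (fun K => \sum_(k < K) lam k * qf b (f k)) =
    fun K => \sum_(k < K) w k * qf b (f k).
  by apply/funext => K; apply: eq_bigr => k _; have [_ [-> _]] := sP k.
exact: hf.
Qed.

End Peeling.

(** * Filling targets that weakly majorize the weights *)

Lemma cut_hinge (R : realType) (a c t : R) :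
  Num.max (a - Num.max (a - c) 0 - t) 0 =
    if c <= t then 0 else Num.max (a - t) 0 - Num.max (a - c) 0.
Proof.
have [ac|ca] := leP (a - c) 0; have [ct|tc] := leP c t.
- by rewrite subr0; apply/max_idPr; lra.
- by rewrite !subr0.
- by apply/max_idPr; lra.
- by rewrite !(max_idPl _); lra.
Qed.

Section Majorization.
Context {R : realType} {H : completeNormedModType R[i]}.
Context {dot : {dot H for @conjc R}} (dot_norm : induces_norm dot).
Local Notation ons := (@ons R H dot).
Local Notation bnd := (@bnd R H dot).
Variables (A : H -> H) (M : R) (bA : bnd A M).
Local Notation qf := (@qf R H dot A).
Local Notation qsum := (@qsum R H dot A).
Local Notation peel_step := (@peel_step R H dot A).
Notation state := ((nat -> H) * (nat -> R))%type.

Definition tail (y : nat -> R) k n := if (n < k)%N then 0 else y n.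

(** The state after [k] targets have been treated: the remaining weights are
    weakly majorized by the remaining targets. *)
Definition below (y : nat -> R) k (s : state) : Prop :=
  [/\ ons s.1, asum s.2, forall n, 0 <= s.2 n, forall n, s.1 n = 0 -> s.2 n = 0 &
      forall t, 0 < t -> hinge s.2 t <= hinge (tail y k) t].

Variables (y : nat -> R) (sy : asum y) (y0 : forall n, 0 <= y n).
(* [y] is nonincreasing up to interspersed zeros, like the positive part of a
   sequence of nonincreasing modulus. *)
Hypothesis ydec : forall m n, (m <= n)%N -> y m = 0 \/ y n <= y m.

Let tail0 k n : 0 <= tail y k n. Proof. by rewrite /tail; case: ifP. Qed.

Let tail_asum k : asum (tail y k). Proof. exact: asum_ifn. Qed.

Lemma hinge_tailS k t : 0 <= t ->
  hinge (tail y k) t = Num.max (y k - t) 0 + hinge (tail y k.+1) t.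
Proof.
move=> t0; rewrite /hinge (rsum_D1 k (hinge_asum (tail_asum k) t0)).
rewrite {1}/tail ltnn; congr (_ + _); apply: rsum_ext => n.
rewrite /tail ltnS (leq_eqVlt n); case: eqP => //= _.
by rewrite sub0r; apply/esym/max_idPr; rewrite oppr_le0.
Qed.

Definition filled k (s : state) (f : H) (w : R) (s' : state) : Prop :=
  [/\ 0 <= w <= y k, rsum s'.2 = rsum s.2 - w,
      w = y k \/ (forall n, s'.2 n = 0) & w != 0 -> dot f f = 1].

Lemma below_le k s : below y k s -> rsum s.2 <= rsum (tail y k).
Proof. by move=> [_ sx _ _ h]; exact: rsum_le_hinge. Qed.

(** The largest current weight [x i0] is raised to [y k], or to the whole
    remaining weight if that is less.  In the first case the other weights are
    cut down to a common level [c]; below [c] the hinge sums then drop by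
    exactly the hinge of [y k], so the remaining weights are still below the
    remaining targets. *)
Lemma below_step k s : below y k s -> exists f w s',
  [/\ below y k.+1 s', filled k s f w s' & peel_step s f w s'].
Proof.
case: s => e x bs; have := bs => -[/= oe sx x0 ex hx].
have [triv|nontriv] := pselect (y k = 0 \/ forall n, x n = 0).
  exists 0, 0, (e, x); split.
  - split=> //= t t0; have := hx t t0; rewrite (hinge_tailS _ (ltW t0)).
    case: triv => [->|xz _].
      by rewrite sub0r (max_idPr _) ?add0r// oppr_le0 ltW.
    have -> : hinge x t = 0.
      rewrite /hinge -[RHS](@rsum0 R); apply: rsum_ext => n; rewrite xz sub0r.
      by apply/max_idPr; rewrite oppr_le0 ltW.
    apply: rsum_ge0 => [|n]; last by rewrite le_max lexx orbT.
    by apply: hinge_asum => //; exact: ltW.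
  - split=> /=; rewrite ?lexx ?y0 ?subr0 ?eqxx//.
    by case: triv => [->|xz]; [left|right].
  - split=> /=; [by left|by move=> n; rewrite dot0l| |by move=> b; rewrite mul0r add0r].
    by move=> u hu; rewrite dot0l.
have yk : 0 < y k.
  by rewrite lt_def y0 andbT; apply/eqP => yk; apply: nontriv; left.
have [n0 xn0] : exists n, 0 < x n.
  apply: contrapT => no; apply: nontriv; right=> n; apply/eqP; rewrite eq_le x0 andbT.
  by rewrite leNgt; apply/negP => xn; apply: no; exists n.
have [i xi xmax] := argmax sx x0 xn0.
have xiy : x i <= y k.
  have h := hx _ yk.
  have hz : hinge (tail y k) (y k) = 0.
    rewrite /hinge -[RHS](@rsum0 R); apply: rsum_ext => n; apply/max_idPr.
    rewrite subr_le0 /tail; case: ltnP => [_|kn]; first exact: ltW.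
    by have [ykz|//] := ydec kn; move: yk; rewrite ykz ltxx.
  have sm := hinge_asum sx (ltW yk).
  have : Num.max (x i - y k) 0 <= 0.
    apply: le_trans (_ : hinge x (y k) <= 0); last by rewrite -hz.
    by apply: (rsum_term i sm) => n; rewrite le_max lexx orbT.
  by rewrite ge_max lexx andbT subr_le0.
have sxi : asum (fun n => if n == i then 0 else x n) by exact: asum_ifn.
have rx := rsum_D1 i sx.
pose Done (d : nat -> R) (w : R) := [/\ asum d, forall n, 0 <= d n <= x n, d i = 0,
  rsum d = w - x i & w <= y k /\ (w = y k \/ forall n, n != i -> x n - d n = 0)] /\
  (forall t, 0 < t ->
    hinge (fun n => if n == i then 0 else x n - d n) t <= hinge (tail y k.+1) t).
have [d [w [[sd dx di rd [wy wfin]] hd]]] : exists d w, Done d w.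
  have [hyx|hyx] := leP (y k) (rsum x).
    pose z n := if n == i then 0 else x n.
    have zb n : 0 <= z n <= x i by rewrite /z; case: ifP => _; rewrite ?lexx ?(ltW xi) ?x0 ?xmax.
    have rb : 0 <= y k - x i <= rsum z by rewrite subr_ge0 xiy /= lerBlDl -rx.
    have [c /andP[c0 cx] hc] := hinge_level sxi zb rb.
    have sz : asum z by exact: sxi.
    have smx := hinge_asum sz c0.
    exists (fun n => Num.max (z n - c) 0), (y k); split.
      split=> //; last by split; [|left].
      - move=> n; rewrite le_max lexx orbT /= ge_max x0 andbT lerBlDr.
        apply: (@le_trans _ _ (x n)); last by rewrite lerDl.
        by rewrite /z; case: ifP.
      - by rewrite /z eqxx sub0r; apply/max_idPr; rewrite oppr_le0.
    move=> t t0.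
    have eqn n : Num.max ((if n == i then 0 else x n - Num.max (z n - c) 0) - t) 0 =
        if c <= t then 0 else Num.max (z n - t) 0 - Num.max (z n - c) 0.
      rewrite -cut_hinge// /z; case: eqP => // _.
      have -> : Num.max (0 - c) 0 = 0 by apply/max_idPr; rewrite sub0r oppr_le0.
      by rewrite subr0.
    have szt := hinge_asum sz (ltW t0); have sxt := hinge_asum sx (ltW t0).
    have -> : hinge (fun n => if n == i then 0 else x n - Num.max (z n - c) 0) t =
        if c <= t then 0 else hinge z t - hinge z c.
      rewrite {1}/hinge (rsum_ext eqn); case: ifP => ct; first exact: rsum0.
      exact: rsumB.
    case: ifP => ct.
      apply: rsum_ge0 => [|n]; last by rewrite le_max lexx orbT.
      by apply: hinge_asum => //; exact: ltW.
    move/negbT: ct; rewrite -ltNge => tc; rewrite hc.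
    have : hinge x t = (x i - t) + hinge z t.
      rewrite /hinge (rsum_D1 i sxt); congr (_ + _).
        by apply/max_idPl; rewrite subr_ge0 (le_trans (ltW tc)).
      apply: rsum_ext => n; rewrite /z; case: eqP => // _.
      by rewrite sub0r; apply/esym/max_idPr; rewrite oppr_le0 ltW.
    have := hx t t0; rewrite (hinge_tailS _ (ltW t0)) (max_idPl _); last first.
      by rewrite subr_ge0 (le_trans (ltW tc))// (le_trans cx).
    by set a := hinge x t; set b := hinge z t; set g := hinge _ t; lra.
  exists (fun n => if n == i then 0 else x n), (rsum x); split.
    split=> //.
    - by move=> n; case: eqP => [->|_]; rewrite ?lexx ?(ltW xi) ?x0.
    - by rewrite eqxx.
    - by rewrite rx addrC addKr.
    - by split; [exact: ltW|right=> n ni; rewrite (negPf ni) subrr].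
  move=> t t0; rewrite {1}/hinge (rsum_ext (v := fun=> 0)); last first.
    move=> n; case: eqP => _; rewrite ?subrr sub0r; apply/max_idPr; by rewrite oppr_le0 ltW.
  rewrite rsum0; apply: rsum_ge0 => [|n]; last by rewrite le_max lexx orbT.
  by apply: hinge_asum => //; exact: ltW.
have ei : dot (e i) (e i) = 1.
  by apply: ons_unit oe _ => ei; move: xi; rewrite (ex _ ei) ltxx.
have d0 n : 0 <= d n by have /andP[] := dx n.
have de n : e n = 0 -> d n = 0.
  by move=> /ex xn; have /andP[a b] := dx n; apply/eqP; rewrite eq_le a andbT -xn.
have wE : x i + rsum d = w by rewrite rd addrC subrK.
have w0 : 0 < x i + rsum d by apply: ltr_wpDr => //; exact: rsum_ge0.
have [f [e' [[f1 oe' e'i e'n fe'] [sp cons]]]] :=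
  concentrate dot_norm bA oe ei sx sd d0 di de (fun n _ => xmax n) w0.
rewrite wE in cons w0.
have sxd := asumB sx sd.
exists f, w, (e', fun n => if n == i then 0 else x n - d n); split.
- split=> //=; first exact: asum_ifn.
  + by move=> n; case: ifP => // _; rewrite subr_ge0; have /andP[] := dx n.
  + move=> n en; case: eqP => // /eqP ni; have := e'n n ni; rewrite en dot0l => enn.
    have e0 : e n = 0.
      apply: contrapT => enz; move: enn; rewrite (ons_unit oe enz) => /eqP.
      by rewrite eq_sym oner_eq0.
    by rewrite (de _ e0) (ex _ e0) subrr.
- split=> //=.
  + by rewrite (ltW w0).
  + have := rsum_D1 i sxd; rewrite rsumB// di rd => h.
    by move: h; set a := rsum _; set b := rsum _; lra.
  + by case: wfin => [->|h]; [left|right=> n; case: eqP => // /eqP; exact: h].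
- split=> //; first by right.
  move=> b; rewrite /qsum -cons /=; congr (_ + _); apply: rsum_ext => n.
  by case: ifP; rewrite ?mul0r.
Qed.

(** If the totals differ, some target is not reached; there all remaining weight
    has been used, so all later [w k] vanish. *)
Lemma below_fill (e : nat -> H) (x : nat -> R) : below y 0 (e, x) ->
  exists f w, [/\ ons f, forall k, 0 <= w k <= y k /\ (w k != 0 -> dot (f k) (f k) = 1),
    asum w /\ rsum w = rsum x,
    rsum x < rsum y -> exists K, forall k, (K <= k)%N -> w k = 0 &
    (forall u, (forall n, dot (e n) u = 0) -> forall k, dot (f k) u = 0) /\
    (forall b, rsum (fun k => w k * qf b (f k)) = rsum (fun n => x n * qf b (e n)))].
Proof.
move=> b0; have M0 : 0 <= M by have [] := bA.
have htl : (fun k => rsum (tail y k)) @ \oo --> 0.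
  have -> : (fun k => rsum (tail y k)) =
      fun k => rsum (fun n => if (n < k)%N then 0 else `|y n|).
    by apply/funext => k; apply: rsum_ext => n; rewrite /tail ger0_norm.
  exact: rsum_tail.
have [|s [f [w [s0 sP of_ sp hf]]]] := peel b0 below_step (cvgM0 M htl).
  move=> k s b bs; have [oe sx x0 _ _] := bs.
  apply: le_trans (qsum_le dot_norm bA b oe sx) _; rewrite ler_wpM2l//.
  apply: le_trans (below_le bs); apply: rsum_le => //; first exact: asum_norm.
  by move=> n; rewrite ger0_norm.
have wy k : 0 <= w k <= y k by have [_ []] := sP k.
have sw : asum w.
  apply: asum_le sy _ => k; have /andP[a b] := wy k.
  by rewrite !ger0_norm.
have tele K : \sum_(k < K) w k = rsum x - rsum (s K).2.
  elim: K => [|K IH]; first by rewrite big_ord0 s0 subrr.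
  rewrite big_ord_recr /= IH; have [_ [_ -> _ _]] := sP K.
  by rewrite opprB addrA addrAC.
have rw : rsum w = rsum x.
  apply: rsum_unique; apply/cvgP0; apply: cvg0_le htl => K.
  have [bs _] := sP K; have [_ sx x0 _ _] := bs.
  rewrite normr_ge0 /= tele addrAC subrr add0r normrN ger0_norm ?rsum_ge0//.
  exact: below_le.
exists f, w; split=> //.
- by move=> k; split=> //; have [_ []] := sP k.
- move=> xy; have [wE|/existsNP[k wk]] := pselect (forall k, w k = y k).
    by move: xy; rewrite -rw (rsum_ext wE) ltxx.
  exists k.+1 => j kj.
  have z : forall n, (s k.+1).2 n = 0 by have [_ [_ _ []]] := sP k.
  have zj l : (k.+1 <= l)%N -> rsum (s l).2 = 0.
    elim: l => // l IH; rewrite leq_eqVlt => /orP[/eqP <-|].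
      by rewrite (rsum_ext z) rsum0.
    rewrite ltnS => /IH sl; have [_ [/andP[w0 _] sr _ _]] := sP l.
    have [[_ sx x0 _ _] _] := sP l.+1.
    have := rsum_ge0 sx x0; rewrite sr sl sub0r oppr_ge0 => w1.
    by apply/eqP; rewrite oppr_eq0 eq_le w1 w0.
  have [_ [/andP[w0 _] sr _ _]] := sP j.
  have := zj j.+1 (leqW kj); rewrite sr (zj j kj) sub0r => /eqP.
  by rewrite oppr_eq0 => /eqP.
- by split=> // b; apply: rsum_unique; exact: hf.
Qed.

End Majorization.

(** * Unitary operators matching two orthonormal systems *)

Section Unitary.
Context {R : realType} {H : completeNormedModType R[i]}.
Context {dot : {dot H for @conjc R}} (dot_norm : induces_norm dot).
Implicit Types (p q w z : H).
Local Notation nrm := (@nrm R H dot).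
Local Notation ons := (@ons R H dot).

(** The reflection in the hyperplane orthogonal to [w]. *)
Definition reflection w z : H := z - (2 * dot z w / dot w w) *: w.

Lemma reflection_dot w z : dot (reflection w z) w = - dot z w.
Proof.
rewrite /reflection dotBl dotZl; have [->|w0] := eqVneq w 0.
  by rewrite !dot0r mulr0 subrr oppr0.
rewrite divfK; first by ring.
by rewrite gt_eqF// neq0_dnorm_gt0.
Qed.

Lemma reflection_linear w : linear (reflection w).
Proof.
move=> a x y; rewrite /reflection dotDl dotZl scalerBr scalerA.
have -> : 2 * (a * dot x w + dot y w) / dot w w =
    a * (2 * dot x w / dot w w) + 2 * dot y w / dot w w by ring.
by rewrite scalerDl opprD addrACA.
Qed.

Lemma reflection_adjoint w : is_adjoint dot (reflection w) (reflection w).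
Proof.
move=> x y; rewrite /reflection dotBl dotBr dotZl dotZr; congr (_ - _).
have -> : (2 * dot y w / dot w w)^* = 2 * dot w y / dot w w.
  rewrite rmorphM fmorphV rmorphM rmorph_nat; congr (_ * _ / _); exact/esym/dotC.
by ring.
Qed.

Lemma reflectionK w : reflection w \o reflection w = id.
Proof.
apply/funext => z /=; rewrite {1}/reflection reflection_dot /reflection.
rewrite mulrN mulNr scaleNr opprK subrK//.
Qed.

Lemma reflection_unitary w : unitary_with_adjoint dot (reflection w) (reflection w).
Proof.
split; [|exact: reflection_adjoint|exact: reflectionK|exact: reflectionK].
apply/(boundedP dot_norm); exists 1; split=> //; first exact: reflection_linear.
move=> x; rewrite mul1r /nrm reflection_adjoint.
by rewrite -[reflection w (reflection w x)]/((reflection w \o reflection w) x) reflectionK.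
Qed.

Lemma unitary_compose U V U' V' : unitary_with_adjoint dot U V ->
  unitary_with_adjoint dot U' V' -> unitary_with_adjoint dot (U \o U') (V' \o V).
Proof.
move=> [/(boundedP dot_norm)[M bU] UV uv vu] [/(boundedP dot_norm)[M' bU'] UV' uv' vu'].
split.
- by apply/(boundedP dot_norm); eexists; exact: bnd_comp bU bU'.
- by move=> x y /=; rewrite UV UV'.
- apply/funext => x /=.
  by rewrite -[U' (V' (V x))]/((U' \o V') (V x)) uv' -[U (V x)]/((U \o V) x) uv.
- apply/funext => x /=.
  by rewrite -[V (U (U' x))]/((V \o U) (U' x)) vu -[V' (U' x)]/((V' \o U') x) vu'.
Qed.

Lemma unitary_id : unitary_with_adjoint dot id id.
Proof.
by split=> //; apply/(boundedP dot_norm); exists 1; exact: bnd_id.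
Qed.

(** A reflection exchanges two unit vectors exactly when their inner product is
    real, which the phase [om] achieves. *)
Lemma reflection_swap p q : dot p p = 1 -> dot q q = 1 -> exists om : R[i],
  om * om^* = 1 /\ reflection (p - om *: q) p = om *: q.
Proof.
move=> p1 q1; pose om := if dot p q == 0 then 1 else dot p q / (cabs (dot p q))%:C.
have [omu omr] : om * om^* = 1 /\ om^* * dot p q = (cabs (dot p q))%:C.
  rewrite /om; case: eqP => [->|/eqP pq]; first by rewrite rmorph1 mulr1 mulr0 cabs0.
  have c0 : (cabs (dot p q))%:C != 0 :> R[i].
    by apply: contra_neq pq => /complexI/cabs_eq0.
  rewrite rmorphM fmorphV /= oppr0 -[_ +i* 0]/((cabs (dot p q))%:C).
  have h : dot p q * (dot p q)^* = (cabs (dot p q))%:C * (cabs (dot p q))%:C.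
    by rewrite mulJc expr2 rmorphM.
  split.
    by rewrite mulrACA h -invfM divff// mulf_neq0.
  by rewrite mulrAC [_^* * _]mulrC h mulfK.
exists om; split=> //; set w := p - om *: q.
set a := (cabs (dot p q))%:C in omr.
have pw : dot p w = 1 - a by rewrite /w dotBr p1 dotZr omr.
have qp : om * dot q p = a.
  transitivity ((om^* * dot p q)^*); last by rewrite omr; exact: conjR.
  by rewrite (dotC q) rmorphM; congr (_ * _); exact/esym/conjcK.
have ww : dot w w = 2 * (1 - a).
  by rewrite {1}/w dotBl pw dotZl /w dotBr dotZr q1 mulrBr qp mulr1 omu; ring.
rewrite /reflection pw; have [w0|wn] := eqVneq (dot w w) 0.
  have wz : w = 0.
    by apply: (nrm_eq0 dot_norm); rewrite /nrm w0 sqrtr0.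
  by rewrite wz scaler0 subr0; apply/subr0_eq.
by rewrite -ww divff// scale1r /w opprB addrC subrK.
Qed.

(** The reflection that takes [U (u N)] to a multiple of [v N] fixes the earlier
    images, as they are orthogonal to both vectors. *)
Lemma unitary_match (u v : nat -> H) N : ons u -> ons v ->
  (forall k, v k <> 0 -> u k <> 0) ->
  exists U V, unitary_with_adjoint dot U V /\
    forall k, (k < N)%N -> v k <> 0 -> exists om, om * om^* = 1 /\ U (u k) = om *: v k.
Proof.
move=> ou ov uv; elim: N => [|N [U [V [hU hk]]]].
  by exists id, id; split=> //; exact: unitary_id.
have [vN|vN] := pselect (v N = 0).
  exists U, V; split=> // k; rewrite ltnS leq_eqVlt => /orP[/eqP ->//|]; exact: hk.
have q1 := ons_unit ov vN; have uN1 := ons_unit ou (uv _ vN).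
have p1 : dot (U (u N)) (U (u N)) = 1 by rewrite (unitary_dot _ _ hU).
have [om [om1 sw]] := reflection_swap p1 q1.
set w := U (u N) - om *: v N in sw.
exists (reflection w \o U), (V \o reflection w); split.
  exact: unitary_compose (reflection_unitary w) hU.
move=> k; rewrite ltnS leq_eqVlt => /orP[/eqP -> _|kN vk]; first by exists om.
have [om' [om'1 Uk]] := hk k kN vk; exists om'; split=> //=.
have kn : k <> N by move=> kn; move: kN; rewrite kn ltnn.
have : dot (U (u k)) w = 0.
  rewrite /w dotBr (unitary_dot _ _ hU) (ou.2 _ _ kn) Uk dotZl dotZr.
  by rewrite (ov.2 _ _ kn) !mulr0 subrr.
by move=> h; rewrite /reflection h mulr0 mul0r scale0r subr0.
Qed.

End Unitary.

(** * Systems with majorized weights *)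

Section MajorizedSystem.
Context {R : realType} {H : completeNormedModType R[i]}.
Context {dot : {dot H for @conjc R}} (dot_norm : induces_norm dot).
Local Notation ons := (@ons R H dot).
Local Notation bnd := (@bnd R H dot).
Variables (A : H -> H) (M : R) (bA : bnd A M).
Local Notation qf := (@qf R H dot A).

Definition ppart (x : nat -> R) n : R := Num.max (x n) 0.

Lemma ppart_asum x : asum x -> asum (ppart x).
Proof.
move=> sx; apply: asum_le sx _ => n; rewrite /ppart ger0_norm ?le_max ?lexx ?orbT//.
by rewrite ge_max normr_ge0 andbT ler_norm.
Qed.

Lemma hinge_ppart x t : 0 < t -> hinge (ppart x) t = hinge x t.
Proof.
move=> t0; apply: rsum_ext => n; rewrite /ppart /Num.max.
by case: (ltP (x n) 0) => ?; do ?(case: ltP => ?); lra.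
Qed.

Lemma rsum_ppart x : asum x ->
  rsum x = rsum (ppart x) - rsum (ppart (fun n => - x n)).
Proof.
move=> sx; rewrite -rsumB; [|exact: ppart_asum|exact/ppart_asum/asumN].
apply: rsum_ext => n; rewrite /ppart /Num.max.
by do ?(case: ltP => ?); lra.
Qed.

Variables (e : nat -> H) (mu lam : nat -> R).
Hypotheses (oe : ons e) (smu : asum mu) (sl : asum lam).
Hypothesis e0 : forall n, e n = 0 -> mu n = 0.
Hypothesis ldec : forall m n, (m <= n)%N -> `|lam n| <= `|lam m|.

(** Only the [e n] with [mu n > 0] are used, hence the [f k] lie in their closed
    span; this makes the systems for the positive and the negative parts
    orthogonal to each other. *)
Lemma positive_part : (forall t, 0 < t -> hinge mu t <= hinge lam t) ->
  exists f w, [/\ ons f,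
    forall k, 0 <= w k <= ppart lam k /\ (w k != 0 -> dot (f k) (f k) = 1),
    asum w /\ rsum w = rsum (ppart mu),
    rsum (ppart mu) < rsum (ppart lam) -> exists K, forall k, (K <= k)%N -> w k = 0 &
    (forall u, (forall n, 0 < mu n -> dot (e n) u = 0) -> forall k, dot (f k) u = 0) /\
    (forall b, rsum (fun k => w k * qf b (f k)) = rsum (fun n => ppart mu n * qf b (e n)))].
Proof.
move=> hm; pose e' n := if 0 < mu n then e n else 0.
have y0 n : 0 <= ppart lam n by rewrite le_max lexx orbT.
have ydec m n : (m <= n)%N -> ppart lam m = 0 \/ ppart lam n <= ppart lam m.
  move=> /ldec h; rewrite /ppart; have [l0|l0] := leP (lam m) 0; first by left.
  right; rewrite ge_max (ltW l0) andbT; apply: le_trans (ler_norm _) _.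
  by rewrite (le_trans h)// ger0_norm// ltW.
have b0 : @below R H dot (ppart lam) 0 (e', ppart mu).
  split=> /=.
  - exact: ons_if.
  - exact: ppart_asum.
  - by move=> n; rewrite le_max lexx orbT.
  - move=> n; rewrite /e' /ppart; case: ltP => [m0|m0 _]; last by [].
    by move=> /e0 mz; move: m0; rewrite mz ltxx.
  - move=> t t0; rewrite hinge_ppart//.
    have -> : tail (ppart lam) 0 = ppart lam by apply/funext => n; rewrite /tail ltn0.
    by rewrite hinge_ppart// hm.
have [f [w [of_ wy rw fin [sp eq]]]] :=
  below_fill dot_norm bA (ppart_asum sl) y0 ydec b0.
exists f, w; split=> //; split.
  by move=> u hu; apply: sp => n; rewrite /e'; case: ifP => [/hu//|_]; rewrite dot0l.
move=> b; rewrite eq; apply: rsum_ext => n; rewrite /e' /ppart; case: ltP => // m0.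
by rewrite !mul0r.
Qed.

End MajorizedSystem.

Section Combine.
Context {R : realType} {H : completeNormedModType R[i]}.
Context {dot : {dot H for @conjc R}} (dot_norm : induces_norm dot).
Local Notation ons := (@ons R H dot).
Local Notation bnd := (@bnd R H dot).
Variables (A : H -> H) (M : R) (bA : bnd A M).
Local Notation qf := (@qf R H dot A).

(** The positive and the negative parts of [mu] are placed below those of [lam],
    in orthogonal systems.  As [rsum mu = rsum lam], both parts have the same
    defect.  If it is positive, only finitely many slots carry weight, and a
    unitary operator moves the system [u] so that these slots agree and the
    others hold unit vectors; if it is zero, every slot is exactly filled.  Then
    [dominated_fill] levels the two defects against each other. *)
Lemma majorized_system (e u : nat -> H) (mu lam : nat -> R) :
  ons e -> asum mu -> (forall n, e n = 0 -> mu n = 0) ->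
  ons u -> asum lam -> (forall k, lam k != 0 -> dot (u k) (u k) = 1) ->
  (forall m n, (m <= n)%N -> `|lam n| <= `|lam m|) ->
  (forall t, 0 < t -> hinge mu t <= hinge lam t) ->
  (forall t, 0 < t -> hinge (fun n => - mu n) t <= hinge (fun n => - lam n) t) ->
  rsum mu = rsum lam ->
  exists f, [/\ ons f, forall k, lam k != 0 -> dot (f k) (f k) = 1 &
    forall b, rsum (fun k => lam k * qf b (f k)) = rsum (fun n => mu n * qf b (e n))].
Proof.
move=> oe smu e0 ou sl u1 ldec hp hn rml.
have [f1 [w1 [on1 p1 [s1 r1] fin1 [sp1 q1]]]] :=
  positive_part dot_norm bA oe smu sl e0 ldec hp.
have e0N n : e n = 0 -> - mu n = 0 by move=> /e0 ->; rewrite oppr0.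
have ldecN m n : (m <= n)%N -> `|- lam n| <= `|- lam m| by rewrite !normrN; exact: ldec.
have [f2 [w2 [on2 p2 [s2 r2] fin2 [sp2 q2]]]] :=
  positive_part dot_norm bA oe (asumN smu) (asumN sl) e0N ldecN hn.
have f12 k l : dot (f1 k) (f2 l) = 0.
  apply: sp1 => n mn; apply: dot_eq0C; apply: sp2 => m mm; apply: oe.2 => mn2.
  by move: mm mn; rewrite mn2; lra.
have w1l k : w1 k != 0 -> 0 < lam k.
  have [/andP[w0 wy] _] := p1 k => wn; rewrite ltNge; apply: contra wn => l0.
  by rewrite eq_le w0 andbT (le_trans wy)// /ppart (max_idPr l0).
have w2l k : w2 k != 0 -> lam k < 0.
  have [/andP[w0 wy] _] := p2 k => wn; rewrite ltNge; apply: contra wn => l0.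
  by rewrite eq_le w0 andbT (le_trans wy)// /ppart (max_idPr _)// oppr_le0.
have w12 k : w1 k != 0 -> w2 k = 0.
  by move=> /w1l l0; apply/eqP; apply: contraTT l0 => /w2l l0; rewrite -leNgt ltW.
pose v k := if w1 k != 0 then f1 k else if w2 k != 0 then f2 k else 0.
pose m k := w1 k - w2 k.
have ov : ons v.
  split=> [k|k l kl]; rewrite /v.
    case: (eqVneq (w1 k)) => /= _; last exact: on1.1.
    by case: (eqVneq (w2 k)) => /= _; [left|exact: on2.1].
  case: (eqVneq (w1 k)) => /= _; case: (eqVneq (w1 l)) => /= _.
  - case: (eqVneq (w2 k)) => /= _; first by rewrite dot0l.
    by case: (eqVneq (w2 l)) => /= _; [rewrite dot0r|exact: on2.2].
  - by case: (eqVneq (w2 k)) => /= _; [rewrite dot0l|apply: dot_eq0C].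
  - by case: (eqVneq (w2 l)) => /= _; [rewrite dot0r|].
  - exact: on1.2.
have v1 k : w1 k != 0 \/ w2 k != 0 -> dot (v k) (v k) = 1.
  rewrite /v; have [w10|w10 _] := eqVneq (w1 k) 0; last exact: (p1 k).2.
  by case=> // w20; rewrite w20; exact: (p2 k).2.
have vm b : rsum (fun k => m k * qf b (v k)) = rsum (fun n => mu n * qf b (e n)).
  transitivity (rsum (fun k => w1 k * qf b (f1 k)) - rsum (fun k => w2 k * qf b (f2 k))).
    rewrite -rsumB; [|exact (asum_qf dot_norm bA b s1 on1)|exact (asum_qf dot_norm bA b s2 on2)].
    apply: rsum_ext => k; rewrite /m /v; have [w10|/w12 ->] := eqVneq (w1 k) 0; last first.
      by rewrite subr0 mul0r subr0.
    by rewrite w10 sub0r mul0r sub0r mulNr; case: eqVneq => //= ->; rewrite !mul0r.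
  rewrite q1 q2 -rsumB; [|exact (asum_qf dot_norm bA b (ppart_asum smu) oe)|
    exact (asum_qf dot_norm bA b (ppart_asum (asumN smu)) oe)].
  apply: rsum_ext => n; rewrite -mulrBl; congr (_ * _); rewrite /ppart.
  by do 2 (case: ltP => ?); lra.
have rm : rsum m = rsum lam.
  by rewrite rsumB// r1 r2 -rsum_ppart.
have ml k : (0 <= lam k -> 0 <= m k <= lam k) /\ (lam k <= 0 -> lam k <= m k <= 0).
  have [/andP[a1 b1] _] := p1 k; have [/andP[a2 b2] _] := p2 k.
  split=> l0.
    have w20 : w2 k = 0.
      by apply/eqP; apply: contraTT l0 => /w2l l0; rewrite -ltNge.
    by move: b1; rewrite /m w20 subr0 a1 /ppart (max_idPl l0).
  have w10 : w1 k = 0.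
    by apply/eqP; apply: contraTT l0 => /w1l l0; rewrite -ltNge.
  move: b2; rewrite /m w10 sub0r /ppart (max_idPl _) ?oppr_ge0// => b2.
  by rewrite oppr_le0 a2 andbT; lra.
(* it remains to put unit vectors into the slots with [lam k != 0] *)
suff [v' [ov' v'1 v'v]] : exists v', [/\ ons v',
    forall k, lam k != 0 -> dot (v' k) (v' k) = 1 &
    forall b k, m k * qf b (v' k) = m k * qf b (v k)].
  have [f [of_ f1' hf]] := dominated_fill dot_norm bA sl ov' v'1 ml rm.
  exists f; split=> // b; rewrite hf -vm; apply: rsum_ext; exact: v'v.
have rp := rsum_ppart smu; have rl := rsum_ppart sl.
have [lt1|] := ltP (rsum (ppart mu)) (rsum (ppart lam)).
  have lt2 : rsum (ppart (fun n => - mu n)) < rsum (ppart (fun n => - lam n)).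
    by lra.
  have [K1 hK1] := fin1 lt1; have [K2 hK2] := fin2 lt2.
  have vu k : v k <> 0 -> u k <> 0.
    have ul : lam k != 0 -> u k <> 0.
      by move=> /u1 uk u0; move: uk; rewrite u0 dot0l => /esym/eqP; rewrite oner_eq0.
    rewrite /v; case: eqVneq => /= [_|/w1l l0 _]; last by apply: ul; rewrite gt_eqF.
    by case: eqVneq => //= /w2l l0 _; apply: ul; rewrite lt_eqF.
  have [U [V [hU hk]]] := unitary_match dot_norm (maxn K1 K2) ou ov vu.
  exists (U \o u); split=> [|k lk|b k].
  - split=> [k|k l kl] /=; last by rewrite (unitary_dot _ _ hU); exact: ou.2.
    have [->|uk] := ou.1 k; last by right; rewrite (unitary_dot _ _ hU).
    have [bU _ _ _] := hU; left; exact: (lin0 bU.1).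
  - by rewrite /= (unitary_dot _ _ hU) u1.
  have [kN|Nk] := ltnP k (maxn K1 K2); last first.
    move: Nk; rewrite geq_max => /andP[/hK1 a /hK2 c].
    by rewrite /m a c subrr !mul0r.
  have [m0|mn] := eqVneq (m k) 0; first by rewrite m0 !mul0r.
  have vk : v k <> 0.
    suff /v1 h : w1 k != 0 \/ w2 k != 0.
      by move=> v0; move: h; rewrite v0 dot0l => /esym/eqP; rewrite oner_eq0.
    have [w10|] := eqVneq (w1 k) 0; last by left.
    by right; apply: contra_neq mn; rewrite /m w10 => ->; rewrite subrr.
  have [om [om1 /= ->]] := hk k kN vk.
  by congr (_ * _); exact: qf_phase bA _ _ _ om1.
move=> le1; have ge1 : rsum (ppart mu) <= rsum (ppart lam).
  by rewrite -r1; apply: rsum_le => [||k]; [|exact: ppart_asum|have [/andP[]] := p1 k].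
have eq1 : rsum (ppart mu) = rsum (ppart lam) by apply/eqP; rewrite eq_le le1 ge1.
have eq2 : rsum (ppart (fun n => - mu n)) = rsum (ppart (fun n => - lam n)) by lra.
have W1 : forall k, w1 k = ppart lam k.
  apply: rsum_eq_le; [|exact: ppart_asum| |by rewrite r1] => //.
  by move=> k; have [/andP[]] := p1 k.
have W2 : forall k, w2 k = ppart (fun n => - lam n) k.
  apply: rsum_eq_le; [|exact/ppart_asum/asumN| |by rewrite r2] => //.
  by move=> k; have [/andP[]] := p2 k.
exists v; split=> // k lk; apply: v1; rewrite W1 W2 /ppart.
case: (ltgtP (lam k) 0) lk => // l0 _.
  by right; rewrite (max_idPl _) ?oppr_ge0 ?ltW// oppr_eq0 lt_eqF.
by left; rewrite gt_eqF.
Qed.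

End Combine.

(** * Majorization through hinge sums *)

Section Rearrangement.
Context {R : realType}.
Implicit Types (d u : nat -> R) (s : seq nat).

Lemma sum_uniq_le_rsum u s : asum u -> (forall n, 0 <= u n) -> uniq s ->
  \sum_(n <- s) u n <= rsum u.
Proof.
elim: s u => [|a s IH] u su u0 /=; first by rewrite big_nil rsum_ge0.
move=> /andP[/negP as_ us]; rewrite big_cons (rsum_D1 a su) lerD2l.
have ua0 n : 0 <= (if n == a then 0 else u n) by case: (n == a).
have := IH _ (asum_ifn (pred1 a) su) ua0 us.
congr (_ <= _); apply: eq_big_seq => n ns /=; case: eqVneq => // na.
by case: as_; rewrite -na.
Qed.

Let level_set d k := [set t : R | exists s : seq nat,
  [/\ uniq s, size s = k.+1 & forall n, n \in s -> t <= Num.max (d n) 0]].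

Lemma level_set_has_sup d k : asum d -> has_sup (level_set d k).
Proof.
move=> sd; split.
  by exists 0, (iota 0 k.+1); rewrite iota_uniq size_iota; split=> // n _; rewrite le_max lexx orbT.
exists (rsum (fun n => `|d n|)) => t [[|a s] [_ //]] _ /(_ a)/(_ (mem_head _ _)) h.
apply: le_trans h _; rewrite ge_max (le_trans (ler_norm _)) /=; last first.
  exact: (rsum_term (u := fun n => `|d n|) a (asum_norm sd)).
by apply: rsum_ge0 => //; exact: asum_norm.
Qed.

Lemma min_entry (x : nat -> R) s : s != [::] ->
  exists2 a, a \in s & forall n, n \in s -> x a <= x n.
Proof.
elim: s => // a [|b s] IH _; first by exists a; rewrite ?mem_head// => n; rewrite inE => /eqP ->.
have [//|c cs hc] := IH; have [ac|ca] := leP (x a) (x c).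
  exists a; first exact: mem_head.
  by move=> n; rewrite in_cons => /orP[/eqP -> //|/hc]; exact: le_trans.
exists c; first by rewrite in_cons cs orbT.
by move=> n; rewrite in_cons => /orP[/eqP ->|/hc//]; exact: ltW.
Qed.

(** The least entry over [s] is at most the [size s]-th largest one; remove it
    and repeat. *)
Lemma sum_le_rearrangement d s : asum d -> uniq s ->
  \sum_(n <- s) Num.max (d n) 0 <= \sum_(k < size s) pos_rearrangement d k.
Proof.
move=> sd; move sz : (size s) => m; elim: m s sz => [|m IH] s sz us.
  by rewrite (size0nil sz) big_nil big_ord0.
have sn : s != [::] by case: s sz {us}.
have [a as_ ha] := min_entry (fun n => Num.max (d n) 0) sn.
rewrite (perm_big _ (perm_to_rem as_)) big_cons big_ord_recr /= addrC lerD//.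
  by apply: IH; [rewrite size_rem// sz|exact: rem_uniq].
by apply: (ub_le_sup (level_set_has_sup m sd).2); exists s.
Qed.

Lemma rearrangement_approx d m (eps : R) : asum d -> 0 < eps -> exists s,
  [/\ uniq s, size s = m &
      \sum_(k < m) pos_rearrangement d k <= \sum_(n <- s) Num.max (d n) 0 + m%:R * eps].
Proof.
move=> sd e0; elim: m => [|m [s [us sz hs]]].
  by exists [::]; rewrite big_nil big_ord0 mul0r addr0.
have [t [s' [us' sz' hs']] ht] := sup_adherent e0 (level_set_has_sup m sd).
have [a as' as_] : exists2 a, a \in s' & a \notin s.
  apply/hasP; rewrite has_predC; apply/negP => /allP sub.
  by have := uniq_leq_size us' sub; rewrite sz sz' ltnn.
exists (a :: s); rewrite /= as_ us sz; split=> //.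
rewrite big_ord_recr big_cons /=; have := hs' a as'.
rewrite -[level_set d m]/([set t : R | _]) in ht.
rewrite -natr1 mulrDl mul1r.
have -> : pos_rearrangement d m = sup (level_set d m) by [].
by lra.
Qed.

Lemma rearrangement_le_hinge d m (t : R) : asum d -> 0 < t ->
  \sum_(k < m) pos_rearrangement d k <= hinge d t + m%:R * t.
Proof.
move=> sd t0; apply/ler_addgt0Pr => eps e0.
have em : 0 < eps / m.+1%:R by rewrite divr_gt0.
have [s [us sz hs]] := rearrangement_approx m sd em.
apply: le_trans hs _; apply: lerD; last first.
  rewrite mulrCA; apply: ler_piMr; first exact: ltW.
  by rewrite ler_pdivrMr ?ltr0n// mul1r ler_nat.
have x0 n : 0 <= Num.max (d n - t) 0 by rewrite le_max lexx orbT.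
have h := sum_uniq_le_rsum (hinge_asum sd (ltW t0)) x0 us; apply: le_trans (lerD h (lexx _)).
rewrite -sz -sum1_size natr_sum mulr_suml -big_split /=; apply: ler_sum => n _.
by rewrite mul1r /Num.max; do 2 (case: ltP => ?); lra.
Qed.

(** The entries of [d] above [t], all among the first ones, attain equality in
    the bound for the sums of the largest entries. *)
Lemma hinge_finite d (t : R) : asum d -> 0 < t -> exists s, uniq s /\
  hinge d t = \sum_(n <- s) Num.max (d n) 0 - (size s)%:R * t.
Proof.
move=> sd t0.
have [N _ hN] : \forall n \near \oo, d n < t.
  by apply: (cvgr_lt (0 : R)) => //; exact: asum_cvg0.
exists [seq n <- iota 0 N | t < d n]; split; first by rewrite filter_uniq ?iota_uniq.
rewrite /hinge (@rsum_fin _ _ N); last first.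
  by move=> n Nn; apply/max_idPr; have := hN n Nn => /= /ltW; rewrite subr_le0.
rewrite -(big_mkord xpredT (fun n => Num.max (d n - t) 0)) /index_iota subn0.
rewrite -sum1_size natr_sum mulr_suml -sumrB big_filter [RHS]big_mkcond /=.
apply: eq_bigr => n _; rewrite mul1r /Num.max.
by case: (ltP t (d n)) => ?; do ?(case: ltP => ?); lra.
Qed.

Lemma hinge_le_of_rearrangement d mu : asum d -> asum mu ->
  (forall n, \sum_(k < n) pos_rearrangement d k <=
             \sum_(k < n) pos_rearrangement mu k) ->
  forall t, 0 < t -> hinge d t <= hinge mu t.
Proof.
move=> sd smu h t t0; have [s [us ->]] := hinge_finite sd t0.
rewrite lerBlDr; apply: le_trans (sum_le_rearrangement sd us) _.
by apply: le_trans (h _) _; exact: rearrangement_le_hinge.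
Qed.

End Rearrangement.

(** * The eigenvalue sequence of a selfadjoint trace-class operator *)

Lemma wide_kernel (F : fieldType) m n (W : 'M[F]_(m, n)) : (n < m)%N ->
  exists c : 'rV[F]_m, c != 0 /\ c *m W = 0.
Proof.
move=> nm; have K0 : kermx W != 0.
  rewrite kermx_eq0 /row_free neq_ltn (leq_ltn_trans (rank_leq_col W))//.
have /rowV0Pn[c cK cn] := K0.
by exists c; split; [|apply/sub_kermxP].
Qed.

Lemma free_family_le (F : fieldType) (V : lmodType F) m n (w : 'I_m -> V) (b : 'I_n -> V) :
  (forall c : 'rV[F]_m, \sum_i c 0 i *: w i = 0 -> c = 0) ->
  (forall i, exists c : 'rV[F]_n, w i = \sum_j c 0 j *: b j) -> (m <= n)%N.
Proof.
move=> free /choice[W hW]; rewrite leqNgt; apply/negP => nm.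
have [c [c0 cW]] := wide_kernel (\matrix_(i, j) W i 0 j) nm.
move/negP: c0; apply; apply/eqP/free.
under eq_bigr do rewrite hW scaler_sumr; rewrite exchange_big /= big1// => j _.
under eq_bigr do rewrite scalerA; rewrite -scaler_suml.
have /matrixP/(_ 0 j) := cW; rewrite !mxE => h.
rewrite (eq_bigr (fun i => c 0 i * (\matrix_(i, j) W i 0 j) i j)) ?h ?scale0r// => i _.
by rewrite mxE.
Qed.

Lemma card_seq_set (s : seq nat) : uniq s -> [set` s] #= `I_(size s).
Proof.
move=> us; apply/card_esym/card_set_bijP; exists (nth 0%N s); split.
- by move=> i /= si; rewrite mem_nth.
- by move=> i j; rewrite !inE /= => si sj /eqP; rewrite nth_uniq// => /eqP.
- by move=> j /= js; exists (index j s); rewrite /= ?index_mem ?nth_index.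
Qed.

Section EigenvalueSequence.
Context {R : realType} {H : completeNormedModType R[i]}.
Context {dot : {dot H for @conjc R}} (dot_norm : induces_norm dot).
Hypothesis sepH : separable_space H.
Local Notation ons := (@ons R H dot).
Local Notation total_sys := (@total_sys R H dot).
Local Notation bnd := (@bnd R H dot).
Local Notation diag_op := (@diag_op R H dot).

Section Count.
Variables (C : H -> H) (M : R) (bC : bnd C M) (sC : is_adjoint dot C C).
Variables (v : nat -> H) (c : nat -> R).
Hypotheses (ov : ons v) (tv : total_sys v).
Hypothesis (Cv : forall n, C (v n) = (c n)%:C *: v n).
Hypothesis (v0 : forall n, v n = 0 -> c n = 0).
Hypothesis (sc : asum c).

Lemma iter_sub_eigen (a : R) k x j : dot (iter k (fun y => C y - a%:C *: y) x) (v j) =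
  (c j - a)%:C ^+ k * dot x (v j).
Proof.
elim: k => [|k IH]; first by rewrite expr0 mul1r.
by rewrite iterS dotBl dotZl sC Cv dotRr IH rmorphB exprS -mulrA mulrBl.
Qed.

Lemma generalized_eigenspace_coord (a : R) x : generalized_eigenspace C a%:C x ->
  forall j, c j != a -> dot x (v j) = 0.
Proof.
move=> [k hk] j ja; have := iter_sub_eigen a k x j; rewrite hk dot0l.
move/esym/eqP; rewrite mulf_eq0 => /orP[|/eqP//].
rewrite expf_eq0 => /andP[_]; rewrite -[0]/(0%:C).
by move=> /eqP/complexI/eqP; rewrite subr_eq0 (negbTE ja).
Qed.

(** In the coordinates of the eigenbasis [v], the generalized eigenspace of [a] is
    the span of the [v j] with [c j = a], and two finite bases have the same
    size. *)
Lemma eigenvalue_count (a : R) n : a != 0 ->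
  has_dim (generalized_eigenspace C a%:C) n -> [set j | c j = a] #= `I_n.
Proof.
move=> a0 [b [bfree bV]].
have [N _ hN] : \forall j \near \oo, `|c j| < `|a|.
  apply: (cvgr_lt (0 : R)); last by rewrite normr_gt0.
  exact/asum_cvg0/asum_norm.
pose s := [seq j <- iota 0 N | c j == a].
have us : uniq s by rewrite filter_uniq ?iota_uniq.
have sP j : (j \in s) = (c j == a).
  rewrite mem_filter mem_iota /= add0n; case: eqP => //= ca; rewrite ltnNge.
  by apply/negP => Nj; have := hN j Nj; rewrite /= ca ltxx.
have -> : [set j | c j = a] = [set` s].
  by apply/seteqP; split=> j /=; rewrite sP => /eqP.
pose w (i : 'I_(size s)) := v (nth 0%N s i).
have cw (i : 'I_(size s)) : c (nth 0%N s i) = a.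
  by apply/eqP; rewrite -sP mem_nth.
have w1 i : dot (w i) (w i) = 1.
  by apply: (ons_unit ov) => /v0/eqP; rewrite cw (negbTE a0).
have w2 i j : i != j -> dot (w i) (w j) = 0.
  by move=> ij; apply: ov.2 => /eqP; rewrite nth_uniq//; exact/negP.
have wV i : generalized_eigenspace C a%:C (w i).
  by exists 1%N; rewrite /= Cv cw subrr.
have wspan x : generalized_eigenspace C a%:C x -> x = \sum_i dot x (w i) *: w i.
  move=> /generalized_eigenspace_coord hx; apply/subr0_eq/tv => j.
  rewrite dotBl dot_suml; have [ca|ca] := eqVneq (c j) a; last first.
    rewrite hx// big1 ?subr0// => i _; rewrite dotZl ov.2 ?mulr0// => ij.
    by move: ca; rewrite -ij cw eqxx.
  have js : j \in s by rewrite sP ca.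
  have is_ : (index j s < size s)%N by rewrite index_mem.
  pose i := Ordinal is_; have wi : w i = v j by rewrite /w /= nth_index.
  rewrite (bigD1 i)//= dotZl -wi w1 mulr1 big1 ?addr0 ?subrr// => k ki.
  by rewrite dotZl w2 ?mulr0.
suff -> : n = size s by exact: card_seq_set.
apply/eqP; rewrite eqn_leq; apply/andP; split.
  apply: (free_family_le bfree) => i.
  have /wspan hb : generalized_eigenspace C a%:C (b i).
    rewrite bV; exists (delta_mx 0 i) => //; rewrite (bigD1 i)//= mxE !eqxx scale1r.
    by rewrite big1 ?addr0// => k ki; rewrite mxE eqxx (negbTE ki) scale0r.
  by exists (\row_k dot (b i) (w k)); rewrite {1}hb; apply: eq_bigr => k _; rewrite mxE.
apply: (@free_family_le _ _ _ _ w b) => [d hd|i].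
  apply/matrixP => z i; rewrite ord1 mxE.
  have : dot (\sum_j d 0 j *: w j) (w i) = 0 by rewrite hd dot0l.
  rewrite dot_suml (bigD1 i)//= dotZl w1 mulr1 big1 ?addr0// => k ki.
  by rewrite dotZl w2 ?mulr0.
by have := wV i; rewrite bV => -[d _ hd]; exists d; rewrite -hd.
Qed.

End Count.

Lemma selfadjoint_diag C : selfadjoint dot C -> trace_class dot C ->
  exists v c, [/\ ons v, total_sys v, forall n, C (v n) = (c n)%:C *: v n,
    forall n, v n = 0 -> c n = 0 & asum c].
Proof.
move=> [bC sC] [_ tC]; have [M bM] := (boundedP dot_norm C).1 bC.
have [oe te] := onb_spec dot_norm sepH.
have [v [c [ov tv Cv v0]]] := spectral dot_norm sepH bM sC oe
  (trace_norm_tail_small dot_norm sepH bC tC).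
exists v, c; split=> //.
by have [] := trace_norm_lower dot_norm sepH bC sC tC ov Cv v0.
Qed.

Lemma eigenvalue_sequence_diag C (lam : nat -> R) :
  selfadjoint dot C -> trace_class dot C ->
  eigenvalue_sequence C (fun n => (lam n)%:C) ->
  exists u, [/\ diag_op C lam u, asum lam &
    forall k, lam k != 0 -> dot (u k) (u k) = 1].
Proof.
move=> saC tC [_ hl]; have [v [c [ov tv Cv v0 sc]]] := selfadjoint_diag saC tC.
have [bC sC] := saC; have [M bM] := (boundedP dot_norm C).1 bC.
have /choice[F hF] : forall a : R, exists f : nat -> nat,
    a != 0 -> set_bij [set k | lam k = a] [set j | c j = a] f.
  move=> a; have [->|a0] := eqVneq a 0; first by exists id.
  have ac0 : a%:C != 0 :> R[i] by apply: contra_neq a0 => /complexI.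
  have [n dn ln] := hl _ ac0.
  have lE : [set k | (lam k)%:C = a%:C] = [set k | lam k = a].
    by apply/seteqP; split=> k /= => [/complexI|->].
  rewrite lE in ln; have cn := eigenvalue_count sC ov tv Cv v0 sc a0 dn.
  by have /card_set_bijP[f hf] := card_eq_trans ln (card_esym cn); exists f.
pose u k := if lam k == 0 then 0 else v (F (lam k) k).
have cF k : lam k != 0 -> c (F (lam k) k) = lam k.
  by move=> lk; have [h _ _] := hF _ lk; exact: (h k).
have u1 k : lam k != 0 -> dot (u k) (u k) = 1.
  move=> lk; rewrite /u (negbTE lk); apply: (ons_unit ov) => /v0/eqP.
  by rewrite cF// (negbTE lk).
have ou : ons u.
  split=> [k|k l kl].
    by have [lk|/u1] := eqVneq (lam k) 0; [left; rewrite /u lk eqxx|right].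
  rewrite /u; case: eqVneq => [_|lk]; first by rewrite dot0l.
  case: eqVneq => [_|ll]; first by rewrite dot0r.
  apply: ov.2 => FF; have ckl : lam k = lam l by rewrite -(cF k)// -(cF l)// FF.
  have [_ inj _] := hF _ lk; apply: kl; apply: inj; rewrite ?inE//=.
  by rewrite FF ckl.
have Cu k : C (u k) = (lam k)%:C *: u k.
  rewrite /u; case: eqVneq => [_|lk]; first by rewrite (lin0 bC.1) scaler0.
  by rewrite Cv cF.
have u0 k : u k = 0 -> lam k = 0.
  move=> uk; apply/eqP/negPn/negP => /u1; rewrite uk dot0l => /esym/eqP.
  by rewrite oner_eq0.
have [sl _] := trace_norm_lower dot_norm sepH bC sC tC.2 ou Cu u0.
exists u; split=> //; split=> //; first by exists M.
move=> x xu; apply: tv => j; rewrite sC Cv dotRr.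
have [->|cj] := eqVneq (c j) 0; first by rewrite mul0r.
have [_ _ surj] := hF _ cj; have [k /= lk Fk] := surj j erefl.
have := xu k; rewrite /u lk (negbTE cj) Fk => ->; exact: mulr0.
Qed.

End EigenvalueSequence.

(** * Eigenvalues of the operators in an orbit closure *)

Section OrbitClosure.
Context {R : realType} {H : completeNormedModType R[i]}.
Context {dot : {dot H for @conjc R}} (dot_norm : induces_norm dot).
Hypothesis sepH : separable_space H.
Local Notation nrm := (@nrm R H dot).
Local Notation ons := (@ons R H dot).
Local Notation diag_op := (@diag_op R H dot).
Implicit Types (lam mu tau : nat -> R).

Lemma diag_opN T mu f : diag_op T mu f -> diag_op (fun x => - T x) (fun n => - mu n) f.
Proof.
move=> [[M bT] of_ Tf f0 Tk]; split=> //.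
- exists M; have [lT M0 hT] := bT; split=> // [a x y|x]; last by rewrite nrmN.
  by rewrite lT opprD scalerN.
- by move=> n; rewrite Tf rmorphN scaleNr.
- by move=> n /f0 ->; rewrite oppr0.
- by move=> x /Tk ->; rewrite oppr0.
Qed.

(** Ky Fan's inequality with an error term.  With the indicator [chi] of
    [t < mu n], the [N]-th partial hinge sum is the compression of [Y + D] with
    weights [chi] minus [t * \sum chi].  The compression of [D] is at most
    [eps]; that of [Y] is the sum of the [lam k * theta k] with [theta k]
    between [0] and [1] and total at most [\sum chi], and
    [lam k * theta k <= max (lam k - t) 0 + t * theta k]. *)
Lemma hinge_perturb Y lam g D tau h e mu (eps t : R) :
  diag_op Y lam g -> asum lam -> diag_op D tau h -> asum tau ->
  rsum (fun n => `|tau n|) <= eps -> ons e -> asum mu ->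
  (forall n, mu n = complex.Re (dot (Y (e n)) (e n)) + complex.Re (dot (D (e n)) (e n))) ->
  0 < t -> hinge mu t <= hinge lam t + eps.
Proof.
move=> dY sl dD st teps oe smu muE t0; apply: rsum_ub; first exact: hinge_asum (ltW t0).
move=> N; pose chi n : R := if t < mu n then 1 else 0.
have chi0 n : 0 <= chi n by rewrite /chi; case: ifP.
have chi1 n : `|chi n| <= 1 by rewrite ger0_norm// /chi; case: ifP.
pose theta k := \sum_(n < N) chi n * cabs (dot (e n) (g k)) ^+ 2.
have [YE th1 thS] : [/\ \sum_(n < N) chi n * complex.Re (dot (Y (e n)) (e n)) =
      rsum (fun k => lam k * theta k), forall k, `|theta k| <= 1 &
      forall K, \sum_(k < K) `|theta k| <= \sum_(n < N) `|chi n|] :=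
  diag_compress dot_norm dY sl N oe chi1.
have th0 k : 0 <= theta k by apply: sumr_ge0 => n _; rewrite mulr_ge0 ?sqr_ge0.
have sth : asum theta by exists (\sum_(n < N) `|chi n|).
have rth : rsum theta <= \sum_(n < N) chi n.
  apply: rsum_ub => // K; under [leRHS]eq_bigr do rewrite -(ger0_norm (chi0 _)).
  by apply: le_trans (thS K); apply: ler_sum => k _; exact: ler_norm.
have -> : \sum_(n < N) Num.max (mu n - t) 0 =
    \sum_(n < N) chi n * complex.Re (dot (Y (e n)) (e n)) +
    \sum_(n < N) chi n * complex.Re (dot (D (e n)) (e n)) - t * \sum_(n < N) chi n.
  rewrite mulr_sumr -big_split -sumrB /=; apply: eq_bigr => n _.
  rewrite -mulrDr -muE /chi /Num.max subr_lt0; case: ltgtP => ?; rewrite ?mul1r ?mul0r ?mulr1 ?mulr0; lra.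
have hD := le_trans (ler_norm _) (diag_compress_le dot_norm dD st N oe chi1).
have sm : asum (fun k => lam k * theta k) by exact: asumM.
have hY : rsum (fun k => lam k * theta k) <= hinge lam t + t * rsum theta.
  rewrite -rsumZ// -rsumD; [|exact: hinge_asum (ltW t0)|exact: asumZ].
  apply: rsum_le => // [|k].
    by apply: asumD; [exact: hinge_asum (ltW t0)|exact: asumZ].
  have th1' : theta k <= 1 by apply: le_trans (th1 k); exact: ler_norm.
  rewrite -lerBlDr -mulrBl; have [lt0|lt0] := leP (lam k - t) 0.
    by apply: mulr_le0_ge0.
  by apply: ler_piMr => //; exact: ltW.
rewrite YE; have : t * rsum theta <= t * \sum_(n < N) chi n by apply: ler_wpM2l => //; exact: ltW.
by move: hD hY teps; lra.
Qed.

Lemma orbit_diag C lam u Y : diag_op C lam u -> unitary_orbit dot C Y ->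
  exists g, diag_op Y lam g.
Proof.
by move=> dC [U [V [hU ->]]]; exists (U \o u); exact: unitary_conj.
Qed.

(** Selfadjointness passes to limits in operator norm, which the trace norm
    dominates. *)
Lemma closure_selfadjoint C lam u X : diag_op C lam u -> orbit_closure dot C X ->
  selfadjoint dot X.
Proof.
move=> dC [[bX tX] hX]; split=> // x y; apply/eqP; rewrite -subr_eq0; apply/eqP.
apply: cabs_eq0; apply/eqP; rewrite eq_le cabs_ge0 andbT.
apply/ler_addgt0Pr => eps e0; rewrite add0r.
pose K := 2 * (nrm x * nrm y) + 1.
have K0 : 0 < K by rewrite ltr_wpDl// !mulr_ge0 ?nrm_ge0.
have d0 : 0 < eps / K by rewrite divr_gt0.
have [Y oY hY] := hX _ d0; have [g dY] := orbit_diag dC oY.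
have [MX bMX] := (boundedP dot_norm X).1 bX; have [[MY bMY] _ _ _ _] := dY.
have bD : bounded_op (X \- Y).
  by apply/(boundedP dot_norm); exists (MX + MY); exact: bnd_sub.
have hD z : nrm ((X \- Y) z) <= eps / K * nrm z := trace_norm_ge dot_norm sepH z bD d0 (ltW hY).
have -> : dot (X x) y - dot x (X y) = dot ((X \- Y) x) y - dot x ((X \- Y) y).
  by rewrite /= dotBl dotBr (diag_adjoint dot_norm dY); ring.
apply: le_trans (cabsD _ _) _; rewrite cabsN.
have h1 := le_trans (cauchy_schwarz dot_norm ((X \- Y) x) y) (ler_wpM2r (@nrm_ge0 _ _ dot y) (hD x)).
have h2 := le_trans (cauchy_schwarz dot_norm x ((X \- Y) y)) (ler_wpM2l (@nrm_ge0 _ _ dot x) (hD y)).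
apply: le_trans (lerD h1 h2) _.
have -> : eps / K * nrm x * nrm y + nrm x * (eps / K * nrm y) = eps / K * (2 * (nrm x * nrm y)) by ring.
rewrite mulrAC ler_pdivrMr//; apply: ler_wpM2l; first exact: ltW.
by rewrite /K lerDl.
Qed.

(** [X] differs from an operator [Y] with eigenvalues [lam] by a selfadjoint
    operator of arbitrarily small trace norm. *)
Lemma closure_eigenvalues C lam u X : diag_op C lam u -> asum lam ->
  orbit_closure dot C X -> exists e mu, [/\ diag_op X mu e, asum mu,
    forall t, 0 < t -> hinge mu t <= hinge lam t,
    forall t, 0 < t -> hinge (fun n => - mu n) t <= hinge (fun n => - lam n) t &
    rsum mu = rsum lam].
Proof.
move=> dC sl cX; have sX := closure_selfadjoint dC cX; have [tX hX] := cX.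
have [e [mu [oe te Xe e0 smu]]] := selfadjoint_diag dot_norm sepH sX tX.
have [bX aX] := sX; have [MX bMX] := (boundedP dot_norm X).1 bX.
have muE n : mu n = complex.Re (dot (X (e n)) (e n)).
  rewrite Xe dotZl ReZ; have [en|->] := oe.1 n; last by rewrite mulr1.
  by rewrite en dot0l mulr0 e0.
have dX : diag_op X mu e.
  split=> //; first by exists MX.
  by move=> x /te ->; exact: (lin0 bX.1).
have approx (eps : R) : 0 < eps -> exists Y g D tau h,
    [/\ diag_op Y lam g, diag_op D tau h, asum tau, rsum (fun n => `|tau n|) <= eps &
        forall n, mu n = complex.Re (dot (Y (e n)) (e n)) + complex.Re (dot (D (e n)) (e n))].
  move=> ep; have [Y oY hY] := hX _ ep; have [g dY] := orbit_diag dC oY.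
  have [[MY bMY] _ _ _ _] := dY; have bMD := bnd_sub dot_norm bMX bMY.
  have bD : bounded_op (X \- Y) by apply/(boundedP dot_norm); exists (MX + MY).
  have aD : is_adjoint dot (X \- Y) (X \- Y).
    by move=> x y; rewrite /= dotBl dotBr aX (diag_adjoint dot_norm dY).
  have tD : (trace_norm dot (X \- Y)%R < +oo)%E by apply: lt_trans hY _; rewrite ltry.
  have [h [tau [oh th Dh h0 st]]] := selfadjoint_diag dot_norm sepH (conj bD aD) (conj bD tD).
  exists Y, g, (X \- Y), tau, h; split=> //.
  - split=> //; first by exists (MX + MY).
    by move=> x /th ->; exact: (lin0 bD.1).
  - have [_ hle] := trace_norm_lower dot_norm sepH bD aD tD oh Dh h0.
    by rewrite -lee_fin; apply: le_trans hle (ltW hY).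
  - by move=> n; rewrite muE /= dotBl ReD ReN; ring.
exists e, mu; split=> // [t t0|t t0|].
- apply/ler_addgt0Pr => eps ep; have [Y [g [D [tau [h [dY dD st teps hm]]]]]] := approx _ ep.
  exact: hinge_perturb dY sl dD st teps oe smu hm t0.
- apply/ler_addgt0Pr => eps ep; have [Y [g [D [tau [h [dY dD st teps hm]]]]]] := approx _ ep.
  apply: hinge_perturb (diag_opN dY) (asumN sl) (diag_opN dD) (asumN st) _ oe (asumN smu) _ t0.
    by under rsum_ext do rewrite normrN.
  by move=> n; rewrite hm !dotNl !ReN; ring.
apply/eqP; rewrite -subr_eq0 -normr_le0; apply/ler_addgt0Pr => eps ep; rewrite add0r.
have [Y [g [D [tau [h [dY dD st teps hm]]]]]] := approx _ ep.
have [_ hY] := diag_trace dot_norm sepH dY sl true bnd_id oe te.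
have gE : rsum (fun n => lam n * rpart true (dot (id (g n)) (g n))) = rsum lam.
  apply: rsum_ext => n; have [_ og _ g0 _] := dY.
  have [gn|gn] := og.1 n; first by rewrite (g0 n gn) mul0r.
  by rewrite /= gn mulr1.
rewrite gE in hY; have hn : (fun N => `|\sum_(i < N) mu i - rpart true (\sum_(k < N) dot (Y (e k)) (e k))|)
    @ \oo --> `|rsum mu - rsum lam|.
  by apply: cvg_norm; apply: cvgB; first exact: rsum_cvgE.
apply: (ler_cvg_to hn (cvg_cst eps)); apply: nearW => N.
rewrite /= Re_sum -sumrB.
have chi1 (n : nat) : `|1 : R| <= 1 by rewrite normr1.
apply: le_trans teps; apply: le_trans (diag_compress_le dot_norm dD st N oe chi1).
rewrite le_eqVlt; apply/orP; left; apply/eqP; congr `|_|.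
by apply: eq_bigr => i _; rewrite hm mul1r; ring.
Qed.

End OrbitClosure.

(** * Inclusion of the orbit-closed numerical ranges *)

Section Inclusion.
Context {R : realType} {H : completeNormedModType R[i]}.
Context {dot : {dot H for @conjc R}} (dot_norm : induces_norm dot).
Hypothesis sepH : separable_space H.
Local Notation bnd := (@bnd R H dot).
Local Notation diag_op := (@diag_op R H dot).
Local Notation qf := (@qf R H dot).
Implicit Types (lam mu : nat -> R).

Lemma trace_of_parts T (r : bool -> R) :
  (forall b, (fun K => rpart b (\sum_(k < K) dot (T (onb dot k)) (onb dot k))) @ \oo --> r b) ->
  trace dot T = r true +i* r false.
Proof.
move=> hr; apply: (@cvg_lim R[i]^o); first exact: norm_hausdorff.
apply/(@cvgrPdist_lt _ R[i]^o) => eps e0.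
have [e1 e2] : 0 < complex.Re eps /\ eps = (complex.Re eps)%:C.
  by move: e0; case: eps => a b; rewrite ltcE /= => /andP[/eqP -> ->].
have e3 : 0 < complex.Re eps / 2 by rewrite divr_gt0.
have h b : \forall N \near \oo,
    `|r b - rpart b (\sum_(k < N) dot (T (onb dot k)) (onb dot k))| < complex.Re eps / 2.
  by have /cvgrPdist_lt/(_ _ e3) := hr b.
near=> N.
have hN b : `|r b - rpart b (\sum_(k < N) dot (T (onb dot k)) (onb dot k))| < complex.Re eps / 2.
  by case: b; near: N; exact: h.
rewrite e2 cabsE ltcR; apply: le_lt_trans (cabs_le_ReIm _) _.
rewrite ReD ImD ReN ImN /=; have := hN true; have := hN false; rewrite /=.
by rewrite seriesEord /=; lra.
Unshelve. all: by end_near.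
Qed.

Lemma diag_trace_comp T lam f A M : diag_op T lam f -> asum lam -> bnd A M ->
  trace dot (T \o A) = rsum (fun n => lam n * qf A true (f n)) +i*
                       rsum (fun n => lam n * qf A false (f n)).
Proof.
move=> dT sl bA; have [oe te] := onb_spec dot_norm sepH.
pose r b := rsum (fun n => lam n * qf A b (f n)).
apply: (@trace_of_parts _ r) => b.
by have [_] := diag_trace dot_norm sepH dT sl b bA oe te.
Qed.

(** A unitary operator matches the first [N] eigenvectors up to phase; by
    [diag_close] the error is at most twice the tail of the eigenvalues. *)
Lemma same_eigenvalues_closure C lam u X f : diag_op C lam u -> diag_op X lam f ->
  asum lam -> (forall k, f k <> 0 -> u k <> 0) -> orbit_closure dot C X.
Proof.
move=> dC dX sl fu; have [[MX bMX] of_ _ f0 _] := dX; have [_ ou _ _ _] := dC.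
have bX : bounded_op X by apply/(boundedP dot_norm); exists MX.
split.
  by split=> //; apply: le_lt_trans (diag_trace_norm_le dot_norm sepH dX sl) _; rewrite ltry.
move=> eps e0; have e4 : 0 < eps / 4 by rewrite divr_gt0.
have [N hN] := rsum_tail_lt sl e4.
have [U [V [hU hk]]] := unitary_match dot_norm N ou of_ fu.
exists (U \o C \o V); first by exists U, V.
have dY := unitary_conj dot_norm hU dC.
apply: le_lt_trans (diag_close dot_norm sepH (N := N) dX dY sl _) _.
  move=> n x nN ln; have fn : f n <> 0 by move=> /f0 ln0; rewrite ln0 eqxx in ln.
  have [om [om1 /= ->]] := hk n nN fn; rewrite dotZr cabsM cabsJ.
  have := mulJc om; rewrite om1 => /(congr1 (@complex.Re R)) /= /esym/eqP.
  by rewrite sqrp_eq1 ?cabs_ge0// => /eqP ->; rewrite mul1r.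
rewrite lte_fin; lra.
Qed.

End Inclusion.

Theorem corollary4p7 (R : realType) (H : completeNormedModType R[i])
    (dot : {dot H for @conjc R}) (dot_norm : induces_norm dot)
    (H_separable : separable_space H)
    (A C C' : H -> H) (A_bounded : bounded_op A)
    (C_selfadjoint : selfadjoint dot C) (C_trace_class : trace_class dot C)
    (C'_selfadjoint : selfadjoint dot C') (C'_trace_class : trace_class dot C')
    (lambda lambda' : nat -> R)
    (lambdaP : eigenvalue_sequence C (fun n => (lambda n)%:C))
    (lambda'P : eigenvalue_sequence C' (fun n => (lambda' n)%:C))
    (lambda_maj : majorized lambda' lambda) :
  orbit_closed_range dot C' A `<=` orbit_closed_range dot C A.
Proof.
have [M bA] := (boundedP dot_norm A).1 A_bounded.
have [u [dC sl u1]] :=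
  eigenvalue_sequence_diag dot_norm H_separable C_selfadjoint C_trace_class lambdaP.
have [u' [dC' sl' _]] :=
  eigenvalue_sequence_diag dot_norm H_separable C'_selfadjoint C'_trace_class lambda'P.
have [maj_pos maj_neg maj_sum] := lambda_maj.
move=> _ [X' cX' <-].
have [e [mu [dX' smu hpos hneg hsum]]] :=
  closure_eigenvalues dot_norm H_separable dC' sl' cX'.
have [_ ou _ _ _] := dC; have [_ oe _ e0 _] := dX'.
have ldec m n : (m <= n)%N -> `|lambda n| <= `|lambda m|.
  by move=> /(lambdaP.1 m n); rewrite !cabsE !cabsR lecR.
have [f [of_ f1 fE]] : exists f, [/\ @ons R H dot f,
    forall k, lambda k != 0 -> dot (f k) (f k) = 1 &
    forall b, rsum (fun k => lambda k * @qf R H dot A b (f k)) =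
              rsum (fun n => mu n * @qf R H dot A b (e n))].
  apply: (majorized_system dot_norm bA oe smu e0 ou sl u1 ldec).
  - move=> t t0; apply: le_trans (hpos t t0) _.
    exact: (hinge_le_of_rearrangement sl' sl maj_pos).
  - move=> t t0; apply: le_trans (hneg t t0) _.
    exact: (hinge_le_of_rearrangement (asumN sl') (asumN sl) maj_neg).
  - by rewrite hsum; exact: maj_sum.
(* the members of [f] at zero eigenvalues are deleted, as [u] may vanish there *)
pose g k := if lambda k != 0 then f k else 0.
have og : @ons R H dot g by exact: (@ons_if _ _ _ (fun k => lambda k != 0) _ of_).
have g0 k : g k = 0 -> lambda k = 0.
  rewrite /g; case: eqVneq => //= /f1 fk fk0.
  by move: fk; rewrite fk0 dot0l => /esym/eqP; rewrite oner_eq0.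
have [X dX] := diag_exists dot_norm og sl g0.
exists X.
  apply: (same_eigenvalues_closure dot_norm H_separable dC dX sl) => k gk uk.
  have lk : lambda k != 0 by apply/eqP => lk; apply: gk; rewrite /g lk eqxx.
  by have := u1 k lk; rewrite uk dot0l => /esym/eqP; rewrite oner_eq0.
rewrite (diag_trace_comp dot_norm H_separable dX sl bA).
rewrite (diag_trace_comp dot_norm H_separable dX' smu bA) -!fE.
have gf b : rsum (fun n => lambda n * @qf R H dot A b (g n)) =
            rsum (fun n => lambda n * @qf R H dot A b (f n)).
  by apply: rsum_ext => n; rewrite /g; case: eqVneq => //= ->; rewrite !mul0r.
by rewrite !gf.
Qed.
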